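(* Let $f=(f_1,\dots,f_n)$ be an $n$-tuple of formal power series in the class $\mathcal M^b$ and let $(M_{Z_1},\dots,M_{Z_n})$ be the universal model associated with the noncommutative domain $\mathbb B_f$. Let $\mathcal H$ be a Hilbert space. Every $n$-tuple of operators $T=(T_1,\dots,T_n)\in\mathbb B_f^{cnc}(\mathcal H)$ is unitarily equivalent to an $n$-tuple $\mathbf T=(\mathbf T_1,\dots,\mathbf T_n)$ in $\mathbb B_f^{cnc}(\mathbf H)$ on the Hilbert space $$\mathbf H:=\Big[(\mathbb H^2(f)\otimes\mathcal D_{f,T})\oplus\overline{\Delta_{\Theta_{f,T}}(\mathbb H^2(f)\otimes\mathcal D_{f,T^*})}\Big]\ominus\{\Theta_{f,T}x\oplus\Delta_{\Theta_{f,T}}x:\ x\in\mathbb H^2(f)\otimes\mathcal D_{f,T^*}\},$$ where $\Delta_{\Theta_{f,T}}:=(I-\Theta_{f,T}^*\Theta_{f,T})^{1/2}$ and the operator $\mathbf T_i$ is defined by $$\mathbf T_i^*[x\oplus\Delta_{\Theta_{f,T}}y]:=(M_{Z_i}^*\otimes I_{\mathcal D_{f,T}})x\oplus D_i^*(\Delta_{\Theta_{f,T}}y),\qquad i=1,\dots,n,$$ for $x\in\mathbb H^2(f)\otimes\mathcal D_{f,T}$, $y\in\mathbb H^2(f)\otimes\mathcal D_{f,T^*}$ (with $x\oplus\Delta_{\Theta_{f,T}}y\in\mathbf H$), where $D_i$ is the bounded operator on $\overline{\Delta_{\Theta_{f,T}}(\mathbb H^2(f)\otimes\mathcal D_{f,T^*})}$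 given by $D_i(\Delta_{\Theta_{f,T}}y):=\Delta_{\Theta_{f,T}}(M_{Z_i}\otimes I_{\mathcal D_{f,T^*}})y$. Moreover, $T$ is a pure $n$-tuple of operators in $\mathbb B_f(\mathcal H)$ if and only if the characteristic function $\Theta_{f,T}$ is an isometry. In this case the model reduces to $$\mathbf H=(\mathbb H^2(f)\otimes\mathcal D_{f,T})\ominus\Theta_{f,T}(\mathbb H^2(f)\otimes\mathcal D_{f,T^*}),\qquad \mathbf T_i^*x=(M_{Z_i}^*\otimes I_{\mathcal D_{f,T}})x,\quad x\in\mathbf H.$$
   Context: Words and series. $\mathbb F_n^+$ is the free semigroup of words in the letters $1,\dots,n$, with empty word $\varnothing$; $|\alpha|$ is the length of $\alpha$. For an $n$-tuple $Y=(Y_1,\dots,Y_n)$ of elements of a unital algebra, $Y_\alpha:=Y_{i_1}\cdots Y_{i_k}$ if $\alpha=i_1\cdots i_k$, and $Y_\varnothing:=1$. Power series are formal power series $\psi=\sum_\alpha a_\alpha Z_\alpha$ with complex coefficients in noncommuting indeterminates $Z_1,\dots,Z_n$. For $Y\in B(\mathcal H)^n$ put $\psi(Y):=\sum_{k\ge0}\sum_{|\alpha|=k}a_\alpha Y_\alpha$ (series over $k$); $\mathcal C_\psi(\mathcal H)$ (resp. $\mathcal C_\psi^{SOT}(\mathcal H)$) is the set of $Y$ for which this converges in norm (resp. in the strong operator topology, SOT). $\mathcal C_\psi^{rad}(\mathcal H)$ is the set of $Y$ for which there is $\delta\in(0,1)$ with $rY\in\mathcal C_\psi(\mathcal H)$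 for $r\in(\delta,1)$ and $\text{SOT-}\lim_{r\to1}\psi(rY)$ exists; then $\psi(Y)$ denotes this limit. For an $n$-tuple $f=(f_1,\dots,f_n)$ of power series these conditions are required for every $f_i$; $f(Y)=(f_1(Y),\dots,f_n(Y))$ is also regarded as a row operator $\mathcal H^{(n)}\to\mathcal H$, where $\mathcal H^{(n)}$ is the direct sum of $n$ copies of $\mathcal H$. $[B(\mathcal H)^n]_r:=\{X\in B(\mathcal H)^n:\|\sum_iX_iX_i^*\|^{1/2}<r\}$. A free holomorphic function on $[B(\mathcal H)^n]_\gamma$ is (the evaluation map of) a power series with $\limsup_k(\sum_{|\alpha|=k}|a_\alpha|^2)^{1/2k}\le1/\gamma$. Model property. $\mathbb H^2(f)$ denotes the Hilbert space with orthonormal basis $\{f_\alpha\}_{\alpha\in\mathbb F_n^+}$ ($f_\varnothing=1$), whose elements are the series $\sum_\alpha c_\alpha f_\alpha$, $\sum|c_\alpha|^2<\infty$. $f$ has the model property ($f\in\mathcal M$) if one of the following holds. ($\mathcal A$) $f$ is an $n$-tuple of noncommutative polynomials and there is an $n$-tuple $q$ of polynomials with $f\circ q=q\circ f=\mathrm{id}$. ($\mathcal S$) $f(0)=0$, each $f_i$ has nonzero radius of convergence, the matrix of linear coefficients of $f$ is invertible ($\det J_f(0)\ne0$; then elements of $\mathbb H^2(f)$ are formal power series), $Z_1,\dots,Z_n\in\mathbb H^2(f)$, each $M_{Z_i}\psi:=Z_i\psi$ is a bounded operator on $\mathbb H^2(f)$, and $M_{f_j}=f_j(M_{Z_1},\dots,M_{Z_n})$,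 where $M_{f_j}\psi:=f_j\psi$ and $(M_{Z_1},\dots,M_{Z_n})$ is in $\mathcal C_f^{SOT}(\mathbb H^2(f))$ or $\mathcal C_f^{rad}(\mathbb H^2(f))$. ($\mathcal F$) for some $\gamma>0$, $f$ is an $n$-tuple of free holomorphic functions on $[B(\mathcal H)^n]_\gamma$ ($\mathcal H$ infinite dimensional) with range in $[B(\mathcal H)^n]_1$, there is no nonzero free holomorphic $G$ on $[B(\mathcal H)^n]_1$ with $G\circ f=0$ (then $\mathbb H^2(f)=\{G\circ f: G=\sum c_\alpha Z_\alpha,\ \sum|c_\alpha|^2<\infty\}$), the coordinate functions lie in $\mathbb H^2(f)$, and the boundedness of $M_{Z_i}$ and $M_{f_j}=f_j(M_{Z_1},\dots,M_{Z_n})$ hold as in ($\mathcal S$). The universal model of $\mathbb B_f$ is $M_Z=(M_{Z_1},\dots,M_{Z_n})$. Writing $Z_i=\sum_\alpha a_\alpha^{(i)}f_\alpha$ in $\mathbb H^2(f)$, the inverse of $f$ under composition is $g=(g_1,\dots,g_n)$, $g_i:=\sum_\alpha a^{(i)}_\alpha Z_\alpha$ (so $g\circ f=\mathrm{id}$). Domain. $\mathbb B_f(\mathcal H)$ is the set of $X\in B(\mathcal H)^n$ with $X\in\mathcal C_f^{SOT}(\mathcal H)$ or $X\in\mathcal C_f^{rad}(\mathcal H)$, $\|f(X)\|\le1$ and $g(f(X))=X$, meaning that either $X_i=\sum_k\sum_{|\alpha|=k}a_\alpha^{(i)}[f(X)]_\alpha$ (SOT convergence) for all $i$, or $X_i=\text{SOT-}\lim_{r\to1}\sum_k\sum_{|\alpha|=k}a_\alpha^{(i)}r^{|\alpha|}[f(X)]_\alpha$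 for all $i$. $T\in\mathbb B_f(\mathcal H)$ is pure if $\text{SOT-}\lim_k\sum_{|\alpha|=k}[f(T)]_\alpha[f(T)]_\alpha^*=0$, and completely non-coisometric (c.n.c.) if no nonzero $h\in\mathcal H$ satisfies $\langle\Phi_{f,T}^m(I)h,h\rangle=\|h\|^2$ for all $m\ge1$, where $\Phi_{f,T}(Y):=\sum_if_i(T)Yf_i(T)^*$. $\mathbb B_f^{pure}(\mathcal H)$ and $\mathbb B_f^{cnc}(\mathcal H)$ are the sets of pure, resp. c.n.c., elements of $\mathbb B_f(\mathcal H)$. Class $\mathcal M^b$. With $f_i=\sum_\alpha b_\alpha^{(i)}Z_\alpha$, $f\in\mathcal M^b$ means $f\in\mathcal M$ and either $M_Z\in\mathcal C_f^{SOT}(\mathbb H^2(f))$ and $\sup_m\|\sum_{|\alpha|\le m}b^{(i)}_\alpha(M_Z)_\alpha\|<\infty$ for all $i$, or $M_Z\in\mathcal C_f^{rad}(\mathbb H^2(f))$ and $\sup_{r\in[0,1)}\|\sum_k\sum_{|\alpha|=k}b^{(i)}_\alpha r^{|\alpha|}(M_Z)_\alpha\|<\infty$ for all $i$. Characteristic function. For $T\in\mathbb B_f(\mathcal H)$: $\Delta_{f,T}:=(I_{\mathcal H}-\sum_if_i(T)f_i(T)^* )^{1/2}$, $\Delta_{f,T^*}:=(I_{\mathcal H^{(n)}}-f(T)^*f(T))^{1/2}$, $\mathcal D_{f,T}:=\overline{\Delta_{f,T}\mathcal H}$, $\mathcal D_{f,T^*}:=\overline{\Delta_{f,T^*}\mathcal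 H^{(n)}}$. $\Lambda_i$ is right multiplication by $f_i$ on $\mathbb H^2(f)$ ($\Lambda_if_\alpha=f_\alpha f_i$). $\Theta_{f,T}:\mathbb H^2(f)\otimes\mathcal D_{f,T^*}\to\mathbb H^2(f)\otimes\mathcal D_{f,T}$ is the contraction with formal Fourier representation $$-I\otimes f(T)+(I\otimes\Delta_{f,T})\Big(I-\sum_i\Lambda_i\otimes f_i(T)^*\Big)^{-1}[\Lambda_1\otimes I_{\mathcal H},\dots,\Lambda_n\otimes I_{\mathcal H}](I\otimes\Delta_{f,T^*}),$$ i.e. the SOT-limit as $r\uparrow1$ of the operators obtained by replacing each $\Lambda_i$ by $r\Lambda_i$. It commutes with the universal model: $\Theta_{f,T}(M_{Z_i}\otimes I)=(M_{Z_i}\otimes I)\Theta_{f,T}$. *)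

(* Defs.v *)
From HB Require Import structures.
From mathcomp Require Import all_boot all_order all_algebra.
From mathcomp Require Import all_classical all_reals all_analysis.
From mathcomp Require Import complex ring.
Set Implicit Arguments.
Unset Strict Implicit.
Unset Printing Implicit Defensive.
Import Order.TTheory GRing.Theory Num.Theory.
Import numFieldNormedType.Exports.
Local Open Scope classical_set_scope.
Local Open Scope ring_scope.

(* Complex Hilbert spaces: complete normed spaces over R[i] whose norm comes
   from an inner product, linear in its first argument.  The norm of such a
   space takes its (real, nonnegative) values in R[i]. *)
HB.mixin Record isHilbert (R : realType) V
    & CompleteNormedModule R[i]%C V := {
  inner : V -> V -> R[i]%C;
  inner_linear : forall z, linear_for *%R (inner ^~ z);
  innerC : forall x y, inner y x = (inner x y)^*;
  inner_norm : forall x, inner x x = `|x| ^+ 2;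
}.

#[short(type="hilbertType")]
HB.structure Definition Hilbert (R : realType) :=
  {V of CompleteNormedModule R[i]%C V & isHilbert R V}.

HB.factory Record Lmodule_isHilbert (R : realType) V
    & GRing.Lmodule R[i]%C V := {
  form : V -> V -> R[i]%C;
  form_linear : forall z, linear_for *%R (form ^~ z);
  formC : forall x y, form y x = (form x y)^*;
  form_gt0 : forall x, x != 0 -> 0 < form x x;
  form_complete : forall u : nat -> V,
    (forall e : R[i]%C, 0 < e -> exists N, forall p q, (N <= p)%N -> (N <= q)%N ->
       form (u p - u q) (u p - u q) < e) ->
    exists l, forall e : R[i]%C, 0 < e -> exists N, forall p, (N <= p)%N ->
       form (u p - l) (u p - l) < e;
}.

Section pos_complex.
Variable R : realType.

Lemma Cgt0_real (e : R[i]%C) : 0 < e -> e = (complex.Re e)%:C%C /\ 0 < complex.Re e.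
Proof.
case: e => a b; rewrite ltcE/= => /andP[/eqP -> a0]; by split.
Qed.

Lemma C_archi (e : R[i]%C) : 0 < e -> exists N : nat, (N.+1%:R^-1 : R[i]%C) < e.
Proof.
move=> /Cgt0_real[-> e0].
have /ltr_add_invr[k hk] := e0; exists k.
rewrite add0r in hk.
by rewrite -(rmorph_nat (real_complex R)) -fmorphV/= ltcR.
Qed.

End pos_complex.

HB.builders Context R V & Lmodule_isHilbert R V.

Local Notation C := R[i]%C.

Lemma formDl z x y : form (x + y) z = form x z + form y z.
Proof. by have := form_linear z 1 x y; rewrite scale1r mul1r. Qed.
Lemma form0l z : form 0 z = 0.
Proof. by apply: (@addrI _ (form 0 z)); rewrite -formDl !addr0. Qed.
Lemma formZl z a x : form (a *: x) z = a * form x z.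
Proof. by have := form_linear z a x 0; rewrite addr0 form0l addr0. Qed.
Lemma formDr z x y : form z (x + y) = form z x + form z y.
Proof. by rewrite formC formDl rmorphD/= -!formC. Qed.
Lemma formZr z a x : form z (a *: x) = a^* * form z x.
Proof. by rewrite formC formZl rmorphM/= -formC. Qed.
Lemma form0r z : form z 0 = 0.
Proof. by rewrite formC form0l rmorph0. Qed.
Lemma form_ge0 x : 0 <= form x x.
Proof. by have [->|/form_gt0/ltW//] := eqVneq x 0; rewrite form0l. Qed.

Definition fnorm x : C := sqrtC (form x x).

Lemma fnorm_ge0 x : 0 <= fnorm x.
Proof. by rewrite sqrtC_ge0 form_ge0. Qed.

Lemma fnormZ (l : C) x : fnorm (l *: x) = `|l| * fnorm x.
Proof.
rewrite /fnorm formZl formZr mulrA -normCK sqrtCM ?nnegrE ?exprn_ge0 ?form_ge0//.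
by rewrite sqrCK.
Qed.

Lemma fnorm_eq0 x : fnorm x = 0 -> x = 0.
Proof.
move/eqP; rewrite sqrtC_eq0; apply: contraTeq => /form_gt0.
by rewrite lt0r => /andP[].
Qed.

Lemma CS x y : `|form x y| <= fnorm x * fnorm y.
Proof.
have [->|x0] := eqVneq x 0.
  by rewrite form0l normr0 mulr_ge0 ?fnorm_ge0.
have fx := form_gt0 x0.
rewrite -(@ler_pXn2r _ 2)// ?nnegrE ?mulr_ge0 ?fnorm_ge0// exprMn !sqrtCK normCK.
have := form_ge0 (form x x *: y - (form x y)^* *: x).
rewrite -scaleNr !(formDl, formDr, formZl, formZr) rmorphN/= conjCK -(formC x x) (formC x y).
set a := form x x in fx *; set b := form x y; set d := form y y.
rewrite [X in 0 <= X](_ : _ = a * (a * d - b * b^*)); last by ring.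
by rewrite pmulr_rge0// subr_ge0.
Qed.

Lemma fnormD x y : fnorm (x + y) <= fnorm x + fnorm y.
Proof.
rewrite -(@ler_pXn2r _ 2)// ?nnegrE ?addr_ge0 ?fnorm_ge0//.
rewrite sqrrD !sqrtCK formDl !formDr addrA lerD2r -!addrA lerD2l.
rewrite [form y x]formC mulr2n.
have xyr : form x y + (form x y)^* \is Num.real.
  apply/CrealP; by rewrite rmorphD/= conjCK addrC.
apply: (le_trans (real_ler_norm xyr)); apply: (le_trans (ler_normD _ _)).
by rewrite norm_conjC lerD// CS.
Qed.

HB.instance Definition _ := @Lmodule_isNormed.Build R[i]%C V fnorm fnormD fnormZ fnorm_eq0.


Lemma fnorm_complete (F : set_system V) : ProperFilter F -> cauchy F -> cvg F.
Proof.
move=> FF /cauchyP Fc.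
have /choice[u uF] : forall k : nat, exists x, F (ball x (k.+1%:R^-1 : R[i]%C)).
  by move=> k; apply: Fc; rewrite invr_gt0 ltr0n.
have formE x : form x x = `|x| ^+ 2 by rewrite -[LHS]sqrtCK.
have sqlt (x : V) (e : R[i]%C) : 0 < e -> (`|x| ^+ 2 < e ^+ 2) = (`|x| < e).
  by move=> e0; apply: ltr_pXn2r => //; rewrite nnegrE ?(ltW e0) ?normr_ge0.
have half (e : R[i]%C) : 0 < e -> exists N : nat, forall p, (N <= p)%N ->
    (p.+1%:R^-1 : R[i]%C) < e / 2.
  move=> e0; have [N hN] := C_archi (divr_gt0 e0 (ltr0Sn _ 1)).
  exists N => p Np; apply: le_lt_trans hN.
  by rewrite lef_pV2 ?posrE ?ltr0n// ler_nat.
have [|l ul] := @form_complete u.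
  move=> e e0; have se0 : 0 < sqrtC e by rewrite sqrtC_gt0.
  have [N hN] := half _ se0; exists N => p q Np Nq.
  have [z [zp zq]] := @filter_ex _ _ FF _ (filterI (uF p) (uF q)).
  rewrite formE -(sqrtCK e) sqlt//.
  move: zp zq; rewrite -!ball_normE/= => zp zq.
  rewrite -(subrKA z) (splitr (sqrtC e)).
  rewrite (le_lt_trans (ler_normD _ _))// ltrD//.
    exact: lt_trans zp (hN _ Np).
  by rewrite distrC; exact: lt_trans zq (hN _ Nq).
apply/cvg_ex; exists l; apply/cvgrPdist_lt => e e0.
have [N1 hN1] := half _ e0.
have [N2 hN2] := ul _ (exprn_gt0 2 (divr_gt0 e0 (ltr0Sn _ 1))).
have := uF (maxn N1 N2); apply: filterS => z; rewrite -ball_normE/= => zu.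
have := hN2 _ (leq_maxr N1 N2); rewrite formE sqlt ?divr_gt0 ?ltr0Sn// => lu.
rewrite -(subrKA (u (maxn N1 N2))) (splitr e).
rewrite (le_lt_trans (ler_normD _ _))// ltrD// 1?distrC//.
by rewrite distrC; exact: lt_trans zu (hN1 _ (leq_maxl _ _)).
Qed.

HB.instance Definition _ := Uniform_isComplete.Build V fnorm_complete.

Lemma form_norm x : form x x = `|x| ^+ 2.
Proof. by rewrite -[LHS]sqrtCK. Qed.

HB.instance Definition _ := isHilbert.Build R V form_linear formC form_norm.

HB.end.

Section scalars.
Variable R : realType.
Local Notation C := R[i]%C.

#[non_forgetful_inheritance] HB.instance Definition _ := NormedModule.copy C C^o.

Lemma normC_real (x : R) : `|x%:C%C : C| = `|x|%:C%C.
Proof. by rewrite normc_def/= expr0n/= addr0 sqrtr_sqr. Qed.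

Lemma normC_leD (z : C) : `|z| <= (`|complex.Re z| + `|complex.Im z|)%:C%C.
Proof.
case: z => a b; rewrite /= (_ : Complex a b = a%:C%C + 'i%C * b%:C%C); last first.
  by simpc.
rewrite (le_trans (ler_normD _ _))// normrM !normC_real normc_def/=.
by rewrite expr0n expr1n add0r sqrtr1 mul1r rmorphD.
Qed.

Lemma Re_norm_le (z : C) : (`|complex.Re z|)%:C%C <= `|z|.
Proof.
case: z => a b; rewrite normc_def/= lecR -sqrtr_sqr ler_wsqrtr//.
by rewrite lerDl sqr_ge0.
Qed.

Lemma Im_norm_le (z : C) : (`|complex.Im z|)%:C%C <= `|z|.
Proof.
case: z => a b; rewrite normc_def/= lecR -sqrtr_sqr ler_wsqrtr//.
by rewrite lerDr sqr_ge0.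
Qed.

Lemma C_complete (F : set_system C) : ProperFilter F -> cauchy F -> cvg F.
Proof.
move=> FF /cauchyP Fc.
have Fex (h : C -> R) : (forall z : C, (`|h z|)%:C%C <= `|z|) ->
    (forall x y, h (x - y) = h x - h y) -> cvg ((fun z : C => h z) @ F).
  move=> hle hB; apply: cauchy_cvg; apply/cauchy_exP => e e0.
  have [|z Fz] := Fc e%:C%C; first by rewrite ltcR.
  exists (h z); change (F ((h : C -> R) @^-1` ball (h z) e)).
  apply: (@filterS _ F _ (ball (z : C) (e%:C%C : C))) => // w.
  rewrite -!ball_normE/= => zw.
  by rewrite -hB -ltcR (le_lt_trans (hle _)).
have /cvg_ex[a Fa] := Fex (fun z => complex.Re z) Re_norm_le (fun x y => raddfB _ x y).
have /cvg_ex[b Fb] := Fex (fun z => complex.Im z) Im_norm_le (fun x y => raddfB _ x y).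
apply/cvg_ex; exists (Complex a b); apply/cvgrPdist_lt => e /Cgt0_real[-> e0].
move/cvgrPdist_lt : Fa => /(_ _ (divr_gt0 e0 (ltr0Sn _ 1))) Fa.
move/cvgrPdist_lt : Fb => /(_ _ (divr_gt0 e0 (ltr0Sn _ 1))) Fb.
apply: filterS2 Fa Fb => -[c d]/= ca db.
rewrite (le_lt_trans (normC_leD _))// ltcR/=.
by rewrite [X in _ < X]splitr ltrD.
Qed.

HB.instance Definition _ := Uniform_isComplete.Build C C_complete.


HB.instance Definition _ := @isHilbert.Build R C (fun x y : C => x * y^* )
  (fun z a x y => etrans (mulrDl _ _ _) (congr1 (fun t => t + y * z^* ) (esym (mulrA _ _ _))))
  (fun x y => etrans (etrans (mulrC _ _) (congr1 (fun t => x^* * t) (esym (conjCK y)))) (esym (rmorphM _ _ _)))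
  (fun x => esym (normCK x)).
End scalars.

Section Cseries.
Variable R : realType.
Local Notation C := R[i]%C.
Implicit Types (a : nat -> C).

Lemma Cge0_real (z : C) : 0 <= z -> z = (complex.Re z)%:C%C.
Proof. by case: z => x y; rewrite lecE/= => /andP[/eqP -> _]. Qed.

Lemma cvgC_real (u : nat -> R) (l : R) :
  u @ \oo --> l -> (fun k => (u k)%:C%C : C) @ \oo --> (l%:C%C : C).
Proof.
move=> /cvgrPdist_lt ul; apply/cvgrPdist_lt => e /Cgt0_real[-> e0].
apply: filterS (ul _ e0) => k /= ulk.
by rewrite -rmorphB/= normC_real ltcR.
Qed.

Lemma Cseries_bounded a (M : C) : (forall k, 0 <= a k) ->
  (forall N, series a N <= M) ->
  cvgn (series a) /\ limn (series a) <= M.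
Proof.
move=> a0 aM.
pose r k := complex.Re (a k).
have ar k : a k = (r k)%:C%C by exact: Cge0_real.
have r0 k : 0 <= r k by rewrite -ler0c -ar.
have sE : series a = fun N => (series r N)%:C%C.
  apply/funext => N; rewrite /series/= rmorph_sum/=.
  by apply: eq_bigr => k _; exact: ar.
have M0 : 0 <= M by apply: le_trans (aM 0%N); rewrite /series/= big_geq.
move: aM; rewrite (Cge0_real M0) => aM.
have rM N : series r N <= complex.Re M by have := aM N; rewrite sE lecR.
have cr : cvgn (series r).
  apply: nondecreasing_is_cvgn; first by apply: nondecreasing_series => k _ _.
  by exists (complex.Re M) => _ [k _ <-].
have cl := cvgC_real cr.
rewrite sE; split; first by apply/cvg_ex; eexists; exact: cl.
by rewrite (cvg_lim _ cl)// lecR; apply: limr_le => //; exact: nearW.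
Qed.

Lemma Cseries_le_lim a N : (forall k, 0 <= a k) -> cvgn (series a) ->
  series a N <= limn (series a).
Proof.
move=> a0 ca.
pose r k := complex.Re (a k).
have ar k : a k = (r k)%:C%C by exact: Cge0_real.
have r0 k : 0 <= r k by rewrite -ler0c -ar.
have sE : series a = fun N => (series r N)%:C%C.
  apply/funext => m; rewrite /series/= rmorph_sum/=.
  by apply: eq_bigr => k _; exact: ar.
have cr : cvgn (series r).
  have /cvg_ex[l sal] := ca.
  apply/cvg_ex; exists (complex.Re l); apply/cvgrPdist_lt => e e0.
  move/cvgrPdist_lt : sal => /(_ (e%:C%C)); rewrite ltcR => /(_ e0).
  apply: filterS => k /=; rewrite sE => lk.
  rewrite -ltcR; apply: le_lt_trans lk.
  by apply: le_trans (Re_norm_le _); rewrite raddfB/=.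
rewrite sE (cvg_lim _ (cvgC_real cr))// lecR.
by apply: nondecreasing_cvgn_le => //; apply: nondecreasing_series => k _ _.
Qed.

Lemma Cseries_normed_cvg (a b : nat -> C) : (forall k, `|a k| <= b k) ->
  cvgn (series b) -> cvgn (series a).
Proof.
move=> ab /cauchy_cvgP/cauchy_seriesP cb.
apply/cauchy_cvgP/cauchy_seriesP => e /cb.
apply: filterS => n /=; apply: le_lt_trans.
rewrite (le_trans (ler_norm_sum _ _ _))// [X in _ <= X]ger0_norm.
  by apply: ler_sum => k _; exact: ab.
by apply: sumr_ge0 => k _; exact: le_trans (ab k).
Qed.

Lemma cvgC_conj a l : a @ \oo --> (l : C) -> (fun k => (a k)^*) @ \oo --> (l^* : C).
Proof.
move=> /cvgrPdist_lt al; apply/cvgrPdist_lt => e e0.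
apply: filterS (al _ e0) => k /=.
by rewrite -rmorphB/= norm_conjC.
Qed.

End Cseries.

Section hilbert_theory.
Variables (R : realType) (V : hilbertType R).
Local Notation C := R[i]%C.
Implicit Types x y z : V.

Lemma innerDl z x y : inner (x + y) z = inner x z + inner y z.
Proof. by have := inner_linear z 1 x y; rewrite scale1r mul1r. Qed.
Lemma inner0l z : inner 0 z = 0.
Proof. by apply: (@addrI _ (inner 0 z)); rewrite -innerDl !addr0. Qed.
Lemma innerZl z a x : inner (a *: x) z = a * inner x z.
Proof. by have := inner_linear z a x 0; rewrite addr0 inner0l addr0. Qed.
Lemma innerDr z x y : inner z (x + y) = inner z x + inner z y.
Proof. by rewrite innerC innerDl rmorphD/= -!innerC. Qed.
Lemma innerZr z a x : inner z (a *: x) = a^* * inner z x.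
Proof. by rewrite innerC innerZl rmorphM/= -innerC. Qed.
Lemma inner0r z : inner z 0 = 0.
Proof. by rewrite innerC inner0l rmorph0. Qed.
Lemma innerNr z x : inner z (- x) = - inner z x.
Proof. by rewrite -scaleN1r innerZr rmorphN1 mulN1r. Qed.
Lemma innerNl z x : inner (- x) z = - inner x z.
Proof. by rewrite -scaleN1r innerZl mulN1r. Qed.

Lemma hnorm_parallelogram x y :
  `|x + y| ^+ 2 + `|x - y| ^+ 2 = (`|x| ^+ 2 + `|y| ^+ 2) *+ 2.
Proof.
rewrite -(inner_norm (x+y)) -(inner_norm (x-y)) -(inner_norm x) -(inner_norm y) !(innerDl, innerDr, innerNl, innerNr); ring.
Qed.

Lemma hnormD_sq x y : `|x + y| ^+ 2 <= (`|x| ^+ 2 + `|y| ^+ 2) *+ 2.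
Proof. by rewrite -hnorm_parallelogram lerDl exprn_ge0. Qed.

Lemma Cauchy_Schwarz x y : `|inner x y| <= `|x| * `|y|.
Proof.
have [->|x0] := eqVneq x 0; first by rewrite inner0l !normr0 mul0r.
have fx : 0 < inner x x by rewrite inner_norm exprn_gt0 ?normr_gt0.
rewrite -(@ler_pXn2r _ 2)// ?nnegrE ?mulr_ge0//.
rewrite exprMn -(inner_norm x) -(inner_norm y) normCK.
have : 0 <= inner (inner x x *: y - (inner x y)^* *: x)
   (inner x x *: y - (inner x y)^* *: x) by rewrite inner_norm exprn_ge0.
rewrite -scaleNr !(innerDl, innerDr, innerZl, innerZr) rmorphN/= conjCK.
rewrite -(innerC x x) (innerC x y).
set a := inner x x in fx *; set b := inner x y; set d := inner y y.
rewrite [X in 0 <= X](_ : _ = a * (a * d - b * b^*)); last by ring.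
by rewrite pmulr_rge0// subr_ge0.
Qed.

Lemma inner_le x y : `|inner x y| <= `|x| ^+ 2 + `|y| ^+ 2.
Proof.
apply: le_trans (Cauchy_Schwarz x y) _.
have h : 0 <= (`|x| - `|y|) ^+ 2 by rewrite real_exprn_even_ge0// rpredB ?normr_real.
rewrite -subr_ge0.
have -> : `|x| ^+ 2 + `|y| ^+ 2 - `|x| * `|y| =
  ((`|x| - `|y|) ^+ 2 + (`|x| ^+ 2 + `|y| ^+ 2)) / 2 by field.
by rewrite divr_ge0// addr_ge0// addr_ge0// exprn_ge0.
Qed.

End hilbert_theory.

Section csum.
Variables (R : realType) (I : countType).
Local Notation C := R[i]%C.
Implicit Types u v : I -> C.

(* Sum of a family over a countable type, along the enumeration of the type;
   only absolutely summable families are used below. *)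
Definition cterm u (k : nat) : C := oapp u 0 (pickle_inv k).
Definition csummable u : Prop := cvgn (series (cterm u)).
Definition csum u : C := limn (series (cterm u)).

Lemma ctermD u v : cterm (fun i => u i + v i) = cterm u \+ cterm v.
Proof.
by apply/funext => k; rewrite /cterm/=; case: pickle_inv => //=; rewrite addr0.
Qed.

Lemma ctermZ c u : cterm (fun i => c * u i) = (fun k => c * cterm u k).
Proof.
by apply/funext => k; rewrite /cterm/=; case: pickle_inv => //=; rewrite mulr0.
Qed.

Lemma seriesD (a b : nat -> C) : series (a \+ b) = series a \+ series b.
Proof. by apply/funext => k; rewrite /series/= big_split. Qed.

Lemma seriesZ c (a : nat -> C) : series (fun k => c * a k) = (fun k => c *: series a k).
Proof. by apply/funext => k; rewrite /series/= scaler_sumr. Qed.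

Lemma csummable0 : csummable (fun=> 0 : C).
Proof.
rewrite /csummable (_ : series _ = fun=> 0); first by apply/cvg_ex; exists 0; exact: cvg_cst.
apply/funext => N; rewrite /series/= big1// => k _.
by rewrite /cterm; case: pickle_inv.
Qed.

Lemma csumD u v : csummable u -> csummable v ->
  csummable (fun i => u i + v i) /\
  csum (fun i => u i + v i) = csum u + csum v.
Proof.
rewrite /csummable /csum ctermD seriesD => cu cv.
have h : series (cterm u) \+ series (cterm v) @ \oo -->
    (limn (series (cterm u)) + limn (series (cterm v)) : C).
  exact: (@cvgD C C nat \oo _ (series (cterm u)) (series (cterm v)) _ _ cu cv).
split; first by apply/cvg_ex; eexists; exact: h.
exact: (cvg_lim (@norm_hausdorff _ _) h).
Qed.

Lemma csumZ c u : csummable u ->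
  csummable (fun i => c * u i) /\ csum (fun i => c * u i) = c * csum u.
Proof.
rewrite /csummable /csum ctermZ seriesZ => cu.
have h : (fun k => c *: series (cterm u) k) @ \oo --> (c * limn (series (cterm u)) : C).
  exact: (@cvgZl_tmp C C nat \oo _ c (series (cterm u)) _ cu).
split; first by apply/cvg_ex; eexists; exact: h.
exact: (cvg_lim (@norm_hausdorff _ _) h).
Qed.

Lemma csum_conj u : csummable u ->
  csummable (fun i => (u i)^*) /\ csum (fun i => (u i)^*) = (csum u)^*.
Proof.
rewrite /csummable /csum => cu.
have -> : series (cterm (fun i => (u i)^*)) = fun k => (series (cterm u) k)^*.
  apply/funext => k; rewrite /series/= rmorph_sum/=; apply: eq_bigr => j _.
  by rewrite /cterm; case: pickle_inv => //=; rewrite rmorph0.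
have := cvgC_conj cu => h; split; first by apply/cvg_ex; eexists; exact: h.
exact: (cvg_lim (@norm_hausdorff _ _) h).
Qed.

Lemma csum_le (u v : I -> C) : (forall i, `|u i| <= v i) -> csummable v -> csummable u.
Proof.
move=> uv; apply: Cseries_normed_cvg => k.
by rewrite /cterm; case: pickle_inv => //=; rewrite normr0.
Qed.

Lemma cterm_ge0 u : (forall i, 0 <= u i) -> forall k, 0 <= cterm u k.
Proof. by move=> u0 k; rewrite /cterm; case: pickle_inv. Qed.

Lemma csum_ge_term u i : (forall i, 0 <= u i) -> csummable u -> u i <= csum u.
Proof.
move=> u0 su; have := Cseries_le_lim (pickle i).+1 (cterm_ge0 u0) su.
apply: le_trans; rewrite /series/= big_nat_recr//= /cterm pickleK_inv/=.
by rewrite lerDr sumr_ge0// => k _; exact: cterm_ge0.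
Qed.

Lemma csum_ge0 u : (forall i, 0 <= u i) -> csummable u -> 0 <= csum u.
Proof.
move=> u0 su; have := Cseries_le_lim 0 (cterm_ge0 u0) su.
by rewrite /series/= big_geq.
Qed.

End csum.

Section ell2_def.
Variables (R : realType) (I : countType) (V : hilbertType R).
Local Notation C := R[i]%C.

Definition square_summable : {pred I -> V} :=
  [pred x : I -> V | `[< csummable (fun i => `|x i| ^+ 2) >]].

Lemma square_summableP (x : I -> V) :
  x \in square_summable <-> csummable (fun i => `|x i| ^+ 2).
Proof. by split => [/asboolP|h]; [|apply/asboolP]. Qed.

Lemma square_summable_submod : submod_closed square_summable.
Proof.
have Z c (x : I -> V) : x \in square_summable -> c *: x \in square_summable.
  move=> /square_summableP sx; apply/square_summableP.
  have [h _] := csumZ (`|c| ^+ 2) sx.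
  by apply: csum_le h => i; rewrite normrX normr_id normrZ exprMn.
split.
  apply/square_summableP; apply: (@csum_le _ _ _ (fun=> 0)) => [i|].
    by rewrite normrX normr_id normr0 expr0n.
  exact: csummable0.
move=> c x y /(Z c) /square_summableP sx /square_summableP sy.
apply/square_summableP.
have [h _] := csumD sx sy.
have [h2 _] := csumZ 2 h.
apply: csum_le h2 => i; rewrite normrX normr_id mulrC mulr_natr.
exact: hnormD_sq.
Qed.

HB.instance Definition _ := GRing.isSubmodClosed.Build C (I -> V) square_summable
  square_summable_submod.

(* The Hilbert direct sum of copies of V indexed by I. *)
Record ell2 := Ell2 { ell2_fun :> I -> V; ell2P : ell2_fun \in square_summable }.

HB.instance Definition _ := [isSub for ell2_fun].
HB.instance Definition _ := [Choice of ell2 by <:].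
HB.instance Definition _ := [SubChoice_isSubLmodule of ell2 by <:].

End ell2_def.

Section seq_complete.
Variables (R : realType) (V : hilbertType R).
Local Notation C := R[i]%C.

Lemma Csq_lt (r e : C) : 0 <= r -> 0 < e -> (r ^+ 2 < e ^+ 2) = (r < e).
Proof. by move=> r0 e0; apply: ltr_pXn2r => //; rewrite nnegrE// ltW. Qed.

Lemma hilbert_seq_complete (u : nat -> V) :
  (forall e : C, 0 < e -> exists N, forall p q, (N <= p)%N -> (N <= q)%N ->
     `|u p - u q| ^+ 2 < e) -> cvgn u.
Proof.
move=> uc; apply: cauchy_cvg; apply/cauchy_exP => e e0.
have [N hN] := uc _ (exprn_gt0 2 e0).
exists (u N); exists N => // q /= Nq.
rewrite -ball_normE/=.
have := hN N q (leqnn _) Nq.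
by rewrite Csq_lt.
Qed.

Lemma cvg_norm_sq (u : nat -> V) l :
  u @ \oo --> l -> (fun k => `|u k| ^+ 2) @ \oo --> (`|l| ^+ 2 : C).
Proof.
move=> ul; have h : (fun k => `|u k|) @ \oo --> (`|l| : C) by exact: cvg_norm.
by rewrite expr2; under eq_fun do rewrite expr2; exact: cvgM.
Qed.

End seq_complete.

Section cvgC_le.
Variable (R : realType).
Local Notation C := R[i]%C.

Lemma cvgC_le_cst (u : nat -> C) (l M : C) : (forall k, 0 <= u k) ->
  u @ \oo --> l -> (\forall k \near \oo, u k <= M) -> l <= M.
Proof.
move=> u0 ul uM.
have key (h : C -> R) (z : C) : (forall z, (`|h z|)%:C%C <= `|z|) ->
   (forall x y, h (x - y) = h x - h y) -> (fun k => h (u k)) @ \oo --> h l.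
  move=> hle hB; apply/cvgrPdist_lt => e e0.
  move/cvgrPdist_lt : (ul) => /(_ (e%:C%C)); rewrite ltcR => /(_ e0).
  apply: filterS => k /= lk; rewrite -ltcR; apply: le_lt_trans lk.
  by rewrite -hB.
have cRe := key (fun z => complex.Re z) 0 (@Re_norm_le _) (fun x y => raddfB _ x y).
have cIm := key (fun z => complex.Im z) 0 (@Im_norm_le _) (fun x y => raddfB _ x y).
have [k uk] := filter_ex uM.
have M0 : 0 <= M := le_trans (u0 k) uk.
have Iml : complex.Im l = 0.
  have h : (fun k => complex.Im (u k)) = fun=> 0.
    by apply/funext => j; rewrite (Cge0_real (u0 j)).
  rewrite h in cIm.
  exact: (cvg_unique (@norm_hausdorff _ _) cIm (cvg_cst _)).
have lE : l = (complex.Re l)%:C%C by case: (l) Iml => a b /= ->.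
rewrite lE (Cge0_real M0) lecR.
rewrite -(cvg_lim (@norm_hausdorff _ _) cRe).
apply: limr_le; first by apply/cvg_ex; exists (complex.Re l).
by apply: filterS uM => j; rewrite (Cge0_real (u0 j)) (Cge0_real M0) lecR.
Qed.

End cvgC_le.

Section ell2_hilbert.
Variables (R : realType) (I : countType) (V : hilbertType R).
Local Notation C := R[i]%C.
Local Notation E := (ell2 I V).
Implicit Types x y : E.

Definition ell2_inner x y : C := csum (fun i => inner (x i) (y i)).

Lemma ell2_sq x : csummable (fun i => `|x i| ^+ 2).
Proof. by apply/square_summableP; exact: ell2P. Qed.

Arguments ell2_sq : clear implicits.

Lemma ell2_inner_summable x y : csummable (fun i => inner (x i) (y i)).
Proof.
have [h _] := csumD (ell2_sq x) (ell2_sq y).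
by apply: csum_le h => i; exact: inner_le.
Qed.

Arguments ell2_inner_summable : clear implicits.

Lemma ell2_inner_linear z : linear_for *%R (ell2_inner ^~ z).
Proof.
move=> c x y; rewrite /ell2_inner.
have [h1 h2] := csumZ c (ell2_inner_summable x z).
have [h3 h4] := csumD h1 (ell2_inner_summable y z).
rewrite -h2 -h4; congr csum; apply/funext => i.
exact: inner_linear.
Qed.

Lemma ell2_innerC x y : ell2_inner y x = (ell2_inner x y)^*.
Proof.
rewrite /ell2_inner; have [_ <-] := csum_conj (ell2_inner_summable x y).
by congr csum; apply/funext => i; exact: innerC.
Qed.

Lemma ell2_inner_sq x : ell2_inner x x = csum (fun i => `|x i| ^+ 2).
Proof. by congr csum; apply/funext => i; exact: inner_norm. Qed.

Lemma ell2_inner_gt0 x : x != 0 -> 0 < ell2_inner x x.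
Proof.
rewrite ell2_inner_sq => x0; rewrite lt0r.
have p i : 0 <= `|x i| ^+ 2 by exact: exprn_ge0.
rewrite (csum_ge0 p (ell2_sq x)) andbT; apply: contraNN x0 => /eqP s0.
apply/eqP/val_inj/funext => i /=; apply/eqP.
rewrite -normr_eq0.
suff : `|x i| ^+ 2 == 0 by rewrite expf_eq0.
by rewrite eq_le p andbT -s0; exact: (csum_ge_term i p (ell2_sq x)).
Qed.

Lemma ell2_sub x y i : (x - y) i = x i - y i.
Proof. by []. Qed.

Lemma ell2_complete (u : nat -> E) :
  (forall e : C, 0 < e -> exists N, forall p q, (N <= p)%N -> (N <= q)%N ->
     ell2_inner (u p - u q) (u p - u q) < e) ->
  exists l, forall e : C, 0 < e -> exists N, forall p, (N <= p)%N ->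
     ell2_inner (u p - l) (u p - l) < e.
Proof.
move=> uc.
have sq0 (x : I -> V) i : 0 <= `|x i| ^+ 2 by exact: exprn_ge0.
have ci i : cvgn (fun p => u p i).
  apply: hilbert_seq_complete => e e0; have [N hN] := uc _ e0.
  exists N => p q Np Nq; apply: le_lt_trans (hN p q Np Nq).
  rewrite ell2_inner_sq -ell2_sub.
  exact: (csum_ge_term i (sq0 _) (ell2_sq (u p - u q))).
pose l i := limn (fun p => u p i).
have bound (e : C) N p : 0 < e ->
    (forall q, (N <= q)%N -> ell2_inner (u p - u q) (u p - u q) < e) ->
    csummable (fun i => `|u p i - l i| ^+ 2) /\
    csum (fun i => `|u p i - l i| ^+ 2) <= e.
  move=> e0 hN; apply: Cseries_bounded => [|K]; first exact: cterm_ge0 (sq0 _).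
  apply: (@cvgC_le_cst _ (fun q => series (cterm (fun i => `|(u p - u q) i| ^+ 2)) K)).
  - by move=> q; rewrite /series/= sumr_ge0// => k _; exact: cterm_ge0 (sq0 _) k.
  - elim: K => [|K IH].
      rewrite /series/= big_geq//; under eq_fun do rewrite big_geq//.
      exact: cvg_cst.
    rewrite seriesSr; under eq_fun do rewrite seriesSr.
    apply: cvgD IH _; rewrite /cterm; case: pickle_inv => [i|] /=; last exact: cvg_cst.
    apply: cvg_norm_sq; apply: cvgB; first exact: cvg_cst.
    exact: ci.
  - exists N => // q /= Nq; apply: ltW; apply: le_lt_trans (hN q Nq).
    rewrite ell2_inner_sq.
    exact: (Cseries_le_lim K (cterm_ge0 (sq0 _)) (ell2_sq (u p - u q))).
have lP : l \in @square_summable R I V.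
  have [N hN] := uc 1 ltr01.
  have [h _] := bound 1 N N ltr01 (fun q => hN N q (leqnn _)).
  have hd : (ell2_fun (u N) - l) \in @square_summable R I V.
    by apply/square_summableP.
  have -> : l = ell2_fun (u N) - (ell2_fun (u N) - l).
    by rewrite opprB addrCA subrr addr0.
  apply: rpredB; [exact: ell2P | exact: hd].
exists (Ell2 lP) => e e0.
have e20 : 0 < e / 2 by rewrite divr_gt0.
have [N hN] := uc _ e20; exists N => p Np.
have [_ h] := bound _ N p e20 (fun q => hN p q Np).
rewrite ell2_inner_sq; apply: (le_lt_trans h).
by rewrite ltr_pdivrMr// mulr_natr mulr2n ltrDl.
Qed.

HB.instance Definition _ := @Lmodule_isHilbert.Build R E ell2_inner
  ell2_inner_linear ell2_innerC ell2_inner_gt0 ell2_complete.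

End ell2_hilbert.
Arguments ell2_sq {R I V} x.
Arguments ell2_inner_summable {R I V} x y.

Section hilbert_cvg.
Variables (R : realType) (V : hilbertType R).
Local Notation C := R[i]%C.

Lemma cvg_sq (u : nat -> V) l : u @ \oo --> l -> forall e : C, 0 < e ->
  exists N, forall p, (N <= p)%N -> `|u p - l| ^+ 2 < e.
Proof.
move=> /cvgrPdist_lt ul e e0.
have se0 : 0 < sqrtC e by rewrite sqrtC_gt0.
have [N _ hN] := ul _ se0; exists N => p Np.
by rewrite -(sqrtCK e) Csq_lt// distrC; exact: hN.
Qed.

Lemma closureE_norm (A : set V) x :
  closure A x <-> forall e : C, 0 < e -> exists2 z, A z & `|x - z| < e.
Proof.
split=> [Ax e e0|Ax B /nbhs_ballP[e e0 eB]].
  have [z [Az]] := Ax _ (nbhsx_ballx x e e0).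
  by rewrite -ball_normE/= => xz; exists z.
have [z Az xz] := Ax e e0; exists z; split => //.
by apply: eB; rewrite -ball_normE.
Qed.

End hilbert_cvg.

Section dsum.
Variables (R : realType) (V W : hilbertType R).
Local Notation C := R[i]%C.

(* Hilbert direct sum; the alias keeps it apart from the product normed module
   of the library, which carries the max norm. *)
Definition dsum := (V * W)%type.

HB.instance Definition _ := GRing.Lmodule.copy dsum (V * W)%type.

Definition dsum_inner (x y : dsum) : C := inner x.1 y.1 + inner x.2 y.2.

Lemma dsum_inner_linear z : linear_for *%R (dsum_inner ^~ z).
Proof.
move=> a x y; rewrite /dsum_inner/= !innerDl !innerZl mulrDr.
by rewrite addrACA.
Qed.

Lemma dsum_innerC x y : dsum_inner y x = (dsum_inner x y)^*.
Proof. by rewrite /dsum_inner rmorphD/= -!innerC. Qed.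

Lemma dsum_inner_gt0 x : x != 0 -> 0 < dsum_inner x x.
Proof.
rewrite /dsum_inner !inner_norm => x0.
rewrite lt0r addr_ge0 ?exprn_ge0// andbT; apply: contraNN x0.
rewrite paddr_eq0 ?exprn_ge0// !expf_eq0/= !normr_eq0 => /andP[/eqP x1 /eqP x2].
by apply/eqP; case: x x1 x2 => a b /= -> ->.
Qed.

Lemma dsum_complete (u : nat -> dsum) :
  (forall e : C, 0 < e -> exists N, forall p q, (N <= p)%N -> (N <= q)%N ->
     dsum_inner (u p - u q) (u p - u q) < e) ->
  exists l, forall e : C, 0 < e -> exists N, forall p, (N <= p)%N ->
     dsum_inner (u p - l) (u p - l) < e.
Proof.
move=> uc.
have c1 : cvgn (fun k => (u k).1).
  apply: hilbert_seq_complete => e /uc[N hN]; exists N => p q Np Nq.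
  apply: le_lt_trans (hN p q Np Nq).
  by rewrite /dsum_inner/= !inner_norm lerDl exprn_ge0.
have c2 : cvgn (fun k => (u k).2).
  apply: hilbert_seq_complete => e /uc[N hN]; exists N => p q Np Nq.
  apply: le_lt_trans (hN p q Np Nq).
  by rewrite /dsum_inner/= !inner_norm lerDr exprn_ge0.
have /cvg_ex[l1 /cvg_sq ul1] := c1; have /cvg_ex[l2 /cvg_sq ul2] := c2.
exists (l1, l2) => e e0; have e20 : 0 < e / 2 by rewrite divr_gt0.
have [N1 h1] := ul1 _ e20; have [N2 h2] := ul2 _ e20.
exists (maxn N1 N2) => p; rewrite geq_max => /andP[p1 p2].
rewrite /dsum_inner/= !inner_norm [X in _ < X]splitr ltrD//.
  exact: h1.
exact: h2.
Qed.

HB.instance Definition _ := @Lmodule_isHilbert.Build R dsum dsum_inner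
  dsum_inner_linear dsum_innerC dsum_inner_gt0 dsum_complete.

End dsum.

Section closed_subspace.
Variables (R : realType) (V : hilbertType R).
Local Notation C := R[i]%C.

Record closed_subspace := ClosedSubspace {
  cs_set :> set V;
  cs_zero : cs_set 0;
  cs_lin : forall (a : C) x y, cs_set x -> cs_set y -> cs_set (a *: x + y);
  cs_closed : closed cs_set
}.

Definition cs_pred (A : closed_subspace) : {pred V} := [pred x | `[< cs_set A x >]].

Lemma cs_predP A x : x \in cs_pred A <-> cs_set A x.
Proof. by split => [/asboolP|h]; [|apply/asboolP]. Qed.

Lemma cs_submod A : submod_closed (cs_pred A).
Proof.
split; first by apply/cs_predP; exact: cs_zero.
by move=> a x y /cs_predP Ax /cs_predP Ay; apply/cs_predP; exact: cs_lin.
Qed.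

HB.instance Definition _ A := GRing.isSubmodClosed.Build C V (cs_pred A) (cs_submod A).

Record subsp (A : closed_subspace) := Subsp { subsp_val :> V; subspP : subsp_val \in cs_pred A }.

Section subsp_hilbert.
Variable A : closed_subspace.

HB.instance Definition _ := [isSub for (@subsp_val A)].
HB.instance Definition _ := [Choice of subsp A by <:].
HB.instance Definition _ := [SubChoice_isSubLmodule of subsp A by <:].

Definition subsp_inner (x y : subsp A) : C := inner (x : V) (y : V).

Lemma subsp_inner_linear z : linear_for *%R (subsp_inner ^~ z).
Proof. by move=> a x y; exact: inner_linear. Qed.

Lemma subsp_innerC x y : subsp_inner y x = (subsp_inner x y)^*.
Proof. exact: innerC. Qed.

Lemma subsp_inner_gt0 x : x != 0 -> 0 < subsp_inner x x.
Proof.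
move=> x0; rewrite /subsp_inner inner_norm exprn_gt0// normr_gt0.
by apply: contraNN x0 => /eqP h; apply/eqP/val_inj.
Qed.

Lemma subsp_complete (u : nat -> subsp A) :
  (forall e : C, 0 < e -> exists N, forall p q, (N <= p)%N -> (N <= q)%N ->
     subsp_inner (u p - u q) (u p - u q) < e) ->
  exists l, forall e : C, 0 < e -> exists N, forall p, (N <= p)%N ->
     subsp_inner (u p - l) (u p - l) < e.
Proof.
move=> uc.
have : cvgn (fun k => (u k : V)).
  apply: hilbert_seq_complete => e /uc[N hN]; exists N => p q Np Nq.
  by rewrite -inner_norm; exact: hN.
move=> /cvg_ex[l ul].
have lP : l \in cs_pred A.
  apply/cs_predP.
  have uA : \forall k \near \oo, cs_set A (u k : V).
    by apply: nearW => k; apply/cs_predP; exact: subspP.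
  exact: (@closed_cvg _ _ \oo _ (fun k => u k : V) (cs_set A) (@cs_closed A) uA l ul).
exists (Subsp lP) => e /(cvg_sq ul)[N hN]; exists N => p Np.
by rewrite /subsp_inner inner_norm; exact: hN.
Qed.

HB.instance Definition _ := @Lmodule_isHilbert.Build R (subsp A) subsp_inner
  subsp_inner_linear subsp_innerC subsp_inner_gt0 subsp_complete.

End subsp_hilbert.

Section orthogonal.
Variable S : set V.

Definition orth_set : set V := [set x | forall y, S y -> inner x y = 0].

Lemma orth0 : orth_set 0.
Proof. by move=> y _; exact: inner0l. Qed.

Lemma orth_lin (a : C) x y : orth_set x -> orth_set y -> orth_set (a *: x + y).
Proof. by move=> hx hy z Sz; rewrite innerDl innerZl hx// hy// mulr0 addr0. Qed.

Lemma orth_closed : closed orth_set.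
Proof.
move=> x /closureE_norm hx y Sy; apply/eqP; rewrite -normr_eq0.
apply/negPn/negP => n0.
have i0 : 0 < `|inner x y| by rewrite lt0r n0 normr_ge0.
have y0 : 0 < `|y|.
  rewrite normr_gt0; apply: contraTneq i0 => ->.
  by rewrite inner0r normr0 ltxx.
have [z hz xz] := hx _ (divr_gt0 i0 y0).
have : `|inner x y| < `|inner x y|.
  rewrite -[inner x y in X in X < _]subr0 -(hz y Sy) -innerNl -innerDl.
  apply: le_lt_trans (Cauchy_Schwarz _ _) _.
  by rewrite -ltr_pdivlMr.
by rewrite ltxx.
Qed.

Definition orth := ClosedSubspace orth0 orth_lin orth_closed.
End orthogonal.

End closed_subspace.

Section operators.
Variables (R : realType) (V W : hilbertType R).
Local Notation C := R[i]%C.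

Definition bop_pred : {pred V -> W} :=
  [pred f : V -> W | `[< linear f /\ continuous f >]].

Lemma bop_predP f : f \in bop_pred <-> linear f /\ continuous f.
Proof. by split => [/asboolP|h]; [|apply/asboolP]. Qed.

Lemma bop_submod : submod_closed bop_pred.
Proof.
split.
  apply/bop_predP; split; last exact: cst_continuous.
  by move=> a x y; change ((0 : W) = a *: 0 + 0); rewrite scaler0 addr0.
move=> a f g /bop_predP[lf cf] /bop_predP[lg cg]; apply/bop_predP; split.
  move=> b x y.
  change (a *: f (b *: x + y) + g (b *: x + y) =
    b *: (a *: f x + g x) + (a *: f y + g y)).
  rewrite lf lg !scalerDr !scalerA (mulrC a b) -!addrA; congr (_ + _).
  by rewrite addrCA.
move=> x; apply: (@cvgD C W V (nbhs x) _ (a *: f) g _ _ _ (cg x)).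
exact: (@cvgZl_tmp C W V (nbhs x) _ a f _ (cf x)).
Qed.

HB.instance Definition _ := GRing.isSubmodClosed.Build C (V -> W) bop_pred bop_submod.

(* B(V, W): continuous linear maps. *)
Record bop := Bop { bop_fun :> V -> W; bopP : bop_fun \in bop_pred }.

HB.instance Definition _ := [isSub for bop_fun].
HB.instance Definition _ := [Choice of bop by <:].
HB.instance Definition _ := [SubChoice_isSubLmodule of bop by <:].

Lemma bop_linear (A : bop) : linear A.
Proof. by have /bop_predP[] := bopP A. Qed.

Lemma bop_continuous (A : bop) : continuous A.
Proof. by have /bop_predP[] := bopP A. Qed.

HB.instance Definition _ (A : bop) := @GRing.isLinear.Build C V W *:%R A (@bop_linear A).

Lemma bounded_bopP (f : V -> W) (M : C) : linear f -> (forall x, `|f x| <= M * `|x|) ->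
  f \in bop_pred.
Proof.
move=> lf bf; apply/bop_predP; split => // x.
have fB y : f x - f y = f (x - y).
  by have := lf (-1) y x; rewrite !scaleN1r addrC => <-; congr f; rewrite addrC.
have bf' y : `|f y| <= (`|M| + 1) * `|y|.
  have My : 0 <= M * `|y| by apply: le_trans (bf y).
  rewrite (le_trans (bf y))// -(ger0_norm My) normrM normr_id mulrDl mul1r.
  by rewrite lerDl.
have M0 : 0 < `|M| + 1 by rewrite ltr_wpDl.
apply/cvgrPdist_lt => e e0; apply/nbhs_ballP; exists (e / (`|M| + 1)) => /=.
  by rewrite divr_gt0.
move=> y; rewrite -ball_normE/= => xy.
by rewrite fB (le_lt_trans (bf' _))// mulrC -ltr_pdivlMr.
Qed.

End operators.

Section operator_constructions.
Variables (R : realType).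
Local Notation C := R[i]%C.
Implicit Types U V W : hilbertType R.

Lemma idop_subproof V : (fun x : V => x) \in @bop_pred R V V.
Proof. by apply/bop_predP; split => [a x y|x] //; exact: cvg_id. Qed.

Definition idop V : bop V V := Bop (@idop_subproof V).

Lemma bcomp_subproof U V W (A : bop V W) (B : bop U V) :
  (fun x => A (B x)) \in @bop_pred R U W.
Proof.
apply/bop_predP; split => [a x y|x]; first by rewrite !bop_linear.
exact: (continuous_comp (@bop_continuous _ _ _ B x) (@bop_continuous _ _ _ A (B x))).
Qed.

Definition bcomp U V W (A : bop V W) (B : bop U V) : bop U W :=
  Bop (bcomp_subproof A B).

Lemma incl_subproof V (A : closed_subspace V) :
  (fun x : subsp A => x : V) \in @bop_pred R (subsp A) V.
Proof.
apply: (@bounded_bopP _ _ _ _ 1) => // x.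
rewrite mul1r -(@ler_pXn2r _ 2)// ?nnegrE// -(inner_norm (x : V)).
by rewrite -(inner_norm x).
Qed.

Definition incl V (A : closed_subspace V) : bop (subsp A) V :=
  Bop (incl_subproof A).

Lemma coord_subproof (I : countType) V (i : I) :
  (fun x : ell2 I V => x i) \in @bop_pred R (ell2 I V) V.
Proof.
apply: (@bounded_bopP _ _ _ _ 1) => // x.
rewrite mul1r -(@ler_pXn2r _ 2)// ?nnegrE// -(inner_norm x).
rewrite [leRHS]ell2_inner_sq.
have p j : 0 <= `|x j| ^+ 2 by exact: exprn_ge0.
exact: (csum_ge_term i p (ell2_sq x)).
Qed.

Definition coord (I : countType) V (i : I) : bop (ell2 I V) V :=
  Bop (coord_subproof V i).

(* The row [F_1 ... F_n] from the direct sum of n copies of V to W. *)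
Definition row_op n V W (F : 'I_n -> bop V W) : bop (ell2 'I_n V) W :=
  \sum_(i < n) bcomp (F i) (coord V i).

Lemma clran0 V W (A : bop V W) : closure (range A) 0.
Proof. by apply: subset_closure; exists 0 => //; exact: linear0. Qed.

Lemma clran_lin V W (A : bop V W) (a : C) x y : closure (range A) x ->
  closure (range A) y -> closure (range A) (a *: x + y).
Proof.
move=> /closureE_norm Ax /closureE_norm Ay; apply/closureE_norm => e e0.
have e20 : 0 < e / 2 by rewrite divr_gt0.
have a0 : 0 < `|a| + 1 by rewrite ltr_wpDl.
have [_ [x' _ <-] xx'] := Ax _ (divr_gt0 e20 a0).
have [_ [y' _ <-] yy'] := Ay _ e20.
exists (A (a *: x' + y')); first by exists (a *: x' + y').
rewrite linearP opprD addrACA -scalerBr (splitr e).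
rewrite (le_lt_trans (ler_normD _ _))// ltrD// normrZ.
apply: (@le_lt_trans _ _ ((`|a| + 1) * `|x - A x'|)).
  by rewrite mulrDl mul1r lerDl.
by rewrite mulrC -ltr_pdivlMr.
Qed.

Definition clran V W (A : bop V W) : closed_subspace W :=
  ClosedSubspace (clran0 A) (@clran_lin V W A) (@closed_closure _ (range A)).

Lemma to_clran_subproof V W (A : bop V W) x : A x \in cs_pred (clran A).
Proof. by apply/cs_predP; apply: subset_closure; exists x. Qed.

Definition to_clran V W (A : bop V W) (x : V) : subsp (clran A) :=
  Subsp (to_clran_subproof A x).

Lemma ptens_subproof (I : countType) V (c : ell2 I C) (v : V) :
  (fun i => c i *: v) \in @square_summable R I V.
Proof.
apply/square_summableP; have [h _] := csumZ (`|v| ^+ 2) (ell2_sq c).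
by apply: csum_le h => i; rewrite normrX normr_id normrZ exprMn mulrC.
Qed.

(* ell2 I V is the Hilbert tensor product of ell2 I C and V; ptens c v is the
   elementary tensor of c and v, and tens A B is the tensor product of two
   operators, characterized by its values on elementary tensors. *)
Definition ptens (I : countType) V (c : ell2 I C) (v : V) : ell2 I V :=
  Ell2 (ptens_subproof c v).

Definition tens (I : countType) V W (A : bop (ell2 I C) (ell2 I C)) (B : bop V W) :
    bop (ell2 I V) (ell2 I W) :=
  xget 0 [set T : bop (ell2 I V) (ell2 I W) | forall c v, T (ptens c v) = ptens (A c) (B v)].

(* The operators below, like tens, are the unique bounded solutions of their
   defining equations; the default 0 of xget only matters when there is none
   (e.g. the square root of an operator that is not positive). *)
Definition adj V W (A : bop V W) : bop W V :=
  xget 0 [set B : bop W V | forall x y, inner (A x) y = inner x (B y)].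

Definition opsqrt V (P : bop V V) : bop V V :=
  xget 0 [set S : bop V V | (forall x, 0 <= inner (S x) x) /\ bcomp S S = P].

Definition opinv V (A : bop V V) : bop V V :=
  xget 0 [set B : bop V V | bcomp A B = idop V /\ bcomp B A = idop V].

Definition hnorm V (x : V) : R := complex.Re `|x|.

Definition opnorm V W (A : bop V W) : R :=
  sup [set hnorm (A x) | x in [set x : V | `|x| <= 1]].

Definition norm_cvg V W T (A : T -> bop V W) (F : set_system T) (L : bop V W) : Prop :=
  opnorm (A t - L) @[t --> F] --> (0 : R).

Definition sot_cvg V W T (A : T -> bop V W) (F : set_system T) (L : bop V W) : Prop :=
  forall x, A t x @[t --> F] --> L x.

Definition isometric V W (A : bop V W) : Prop := forall x, `|A x| = `|x|.

Definition unitary V W (A : bop V W) : Prop :=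
  isometric A /\ forall y, exists x, A x = y.

Definition unitarily_equivalent n V W (T : 'I_n -> bop V V) (S : 'I_n -> bop W W) : Prop :=
  exists U : bop V W, unitary U /\ forall i, bcomp U (T i) = bcomp (S i) U.

End operator_constructions.

Section power_series.
Variables (R : realType) (n : nat).
Local Notation C := R[i]%C.

Definition word := seq 'I_n.

(* Formal power series in n noncommuting indeterminates, by coefficients. *)
Definition pser := word -> C.

Definition pser_one : pser := fun c => (c == [::])%:R.
Definition pser_Z (i : 'I_n) : pser := fun c => (c == [:: i])%:R.
Definition pser_mul (p q : pser) : pser :=
  fun c => \sum_(k < (size c).+1) p (take k c) * q (drop k c).
(* pser_word f a is the product f_a of the series f_i along the word a. *)
Definition pser_word (f : 'I_n -> pser) (a : word) : pser :=
  foldr (fun i p => pser_mul (f i) p) pser_one a.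

Definition is_poly (p : pser) : Prop :=
  exists N, forall a, (N <= size a)%N -> p a = 0.

(* p is the sum of the c_a f_a, in the sense that every coefficient of the
   partial sums is eventually the one of p.  This is c o f when c is a
   polynomial, and when the f_i have no constant term. *)
Definition is_subst (c : pser) (f : 'I_n -> pser) (p : pser) : Prop :=
  forall w : word, \forall N \near \oo,
    \sum_(k < N) \sum_(a : k.-tuple 'I_n) c a * pser_word f a w = p w.

Definition free_holomorphic (r : R) (p : pser) : Prop :=
  (limn_esup (fun k => ((\sum_(a : k.-tuple 'I_n) hnorm (p a) ^+ 2)
                          `^ (k.*2%:R^-1))%:E) <= (r^-1)%:E)%E.

Section evaluation.
Variable V : hilbertType R.
Implicit Types (Y X : 'I_n -> bop V V) (p : pser) (f : 'I_n -> pser).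

Definition word_op Y (a : word) : bop V V :=
  foldr (fun i B => bcomp (Y i) B) (idop V) a.

Definition hom_part p Y (k : nat) : bop V V :=
  \sum_(a : k.-tuple 'I_n) p a *: word_op Y a.

Definition norm_sum p Y (L : bop V V) : Prop := norm_cvg (series (hom_part p Y)) \oo L.

(* For the sums over k of the homogeneous parts: convergence in norm (above), in
   the strong operator topology, and radial convergence. *)
Definition sot_sum p Y (L : bop V V) : Prop := sot_cvg (series (hom_part p Y)) \oo L.

Definition dilate (r : R) Y : 'I_n -> bop V V := fun i => r%:C%C *: Y i.

Definition rad_sum p Y (L : bop V V) : Prop :=
  exists2 d : R, 0 < d < 1 &
  exists2 P : R -> bop V V, (forall r, d < r < 1 -> norm_sum p (dilate r Y) (P r)) &
    sot_cvg P 1^'- L.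

Definition in_CSOT f Y : Prop := forall i, exists L, sot_sum (f i) Y L.

Definition in_Crad f Y : Prop := forall i, exists L, rad_sum (f i) Y L.

(* p(Y); by Abel's theorem the two limits agree when both exist. *)
Definition peval p Y : bop V V := xget 0 [set L : bop V V | sot_sum p Y L \/ rad_sum p Y L].

Definition feval f Y : 'I_n -> bop V V := fun i => peval (f i) Y.

Definition in_ball (r : R) Y : Prop :=
  Num.sqrt (opnorm (\sum_i bcomp (Y i) (adj (Y i)))) < r.

End evaluation.
End power_series.

Section model.
Variables (R : realType) (n : nat).
Local Notation C := R[i]%C.

(* H^2(f) is represented by coordinates in its orthonormal basis (f_a): the
   vector c of H2f stands for the sum of the c_a f_a.  ftens V is H^2(f) (x) V. *)
Definition ftens (V : hilbertType R) : hilbertType R := ell2 (word n) V.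

Definition H2f : hilbertType R := ftens C.

Implicit Types (f : 'I_n -> pser R n) (g : 'I_n -> H2f) (M : 'I_n -> bop H2f H2f).

(* The formal series with coefficients c, i.e. the sum of the c_a Z_a. *)
Definition coef (c : H2f) : pser R n := fun a => c a.

(* The three cases of the model property.  Besides f, they involve the inverse g
   of f, whose i-th component is the vector of coordinates of Z_i in H^2(f), and
   the universal model M, where M_i is multiplication by Z_i on H^2(f).
   Elements of H^2(f) are identified, via (f_a), with: polynomials, on the dense
   subspace of finitely supported coordinates (case A); formal series (case S);
   functions on a ball of an infinite dimensional Hilbert space (case F). *)
Definition model_A f g M : Prop :=
  [/\ forall i, is_poly (f i) /\ is_poly (coef (g i)),
      forall i, is_subst (f i) (fun j => coef (g j)) (pser_Z R i),
      forall i, is_subst (coef (g i)) f (pser_Z R i)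
    & forall i (c : H2f) p, is_poly (coef c) -> is_subst (coef c) f p ->
        is_poly (coef (M i c)) /\
        is_subst (coef (M i c)) f (pser_mul (pser_Z R i) p)].

Definition model_S f g M : Prop :=
  [/\ forall i, f i [::] = 0 /\ (exists2 r : R, 0 < r & free_holomorphic r (f i)),
      \det (\matrix_(i, j) f i [:: j]) != 0,
      forall i, is_subst (coef (g i)) f (pser_Z R i),
      forall i (c : H2f) p, is_subst (coef c) f p ->
        is_subst (coef (M i c)) f (pser_mul (pser_Z R i) p)
      (* f_j(M) is multiplication by f_j *)
    & (in_CSOT f M \/ in_Crad f M) /\
      forall j (c : H2f) p, is_subst (coef c) f p ->
        is_subst (coef (feval f M j c)) f (pser_mul (f j) p)].

Definition model_F f g M : Prop :=
  let K : hilbertType R := ell2 nat C in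
  exists2 r : R, 0 < r &
  [/\ (forall i, free_holomorphic r (f i)) /\
      (forall X : 'I_n -> bop K K, in_ball r X -> in_ball 1 (feval f X)),
      forall p, free_holomorphic 1 p ->
        (forall X : 'I_n -> bop K K, in_ball r X -> peval p (feval f X) = 0) ->
        forall a, p a = 0,
      forall i (X : 'I_n -> bop K K), in_ball r X ->
        peval (coef (g i)) (feval f X) = X i,
      forall i (c : H2f) (X : 'I_n -> bop K K), in_ball r X ->
        peval (coef (M i c)) (feval f X) = bcomp (X i) (peval (coef c) (feval f X))
    & (in_CSOT f M \/ in_Crad f M) /\
      forall j (c : H2f) (X : 'I_n -> bop K K), in_ball r X ->
        peval (coef (feval f M j c)) (feval f X) =
        bcomp (feval f X j) (peval (coef c) (feval f X))].

Definition model_property f g M : Prop :=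
  [\/ model_A f g M, model_S f g M | model_F f g M].

Definition class_Mb f g M : Prop :=
  model_property f g M /\
  ((in_CSOT f M /\
    forall i, exists B : R, forall m, opnorm (series (hom_part (f i) M) m.+1) <= B) \/
   (in_Crad f M /\
    forall i, exists B : R, forall r : R, 0 <= r < 1 ->
      exists2 L, norm_sum (f i) (dilate r M) L & opnorm L <= B)).

Section domain.
Variables (H : hilbertType R).
Implicit Types T F : 'I_n -> bop H H.

Definition in_Bf f g T : Prop :=
  [/\ in_CSOT f T \/ in_Crad f T,
      opnorm (row_op (feval f T)) <= 1
    & (forall i, sot_sum (coef (g i)) (feval f T) (T i)) \/
      (forall i, rad_sum (coef (g i)) (feval f T) (T i))].

Definition pure f T : Prop :=
  sot_cvg (fun k => \sum_(a : k.-tuple 'I_n)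
    bcomp (word_op (feval f T) a) (adj (word_op (feval f T) a))) \oo 0.

Definition Phi f T (Y : bop H H) : bop H H :=
  \sum_i bcomp (feval f T i) (bcomp Y (adj (feval f T i))).

Definition cnc f T : Prop :=
  forall h : H, (forall m, (0 < m)%N -> inner (iter m (Phi f T) (idop H) h) h = `|h| ^+ 2) ->
    h = 0.

Definition in_Bf_pure f g T : Prop := in_Bf f g T /\ pure f T.
Definition in_Bf_cnc f g T : Prop := in_Bf f g T /\ cnc f T.

Definition Delta f T : bop H H :=
  opsqrt (idop H - \sum_i bcomp (feval f T i) (adj (feval f T i))).

Definition Delta_star f T : bop (ell2 'I_n H) (ell2 'I_n H) :=
  opsqrt (idop (ell2 'I_n H) - bcomp (adj (row_op (feval f T))) (row_op (feval f T))).

Definition Dspace f T : hilbertType R := subsp (clran (Delta f T)).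
Definition Dspace_star f T : hilbertType R := subsp (clran (Delta_star f T)).

(* Right multiplication by f_i, that is f_a |-> f_a f_i, in coordinates. *)
Definition Lambda (i : 'I_n) : bop H2f H2f :=
  xget 0 [set L : bop H2f H2f | forall c : H2f, (L c : ell2 _ _) [::] = 0 /\
    forall (a : word n) j, (L c : ell2 _ _) (rcons a j) = if j == i then (c : ell2 _ _) a else 0].

(* The Fourier representation of the characteristic function, with each Lambda_i
   replaced by r Lambda_i; the row of the Lambda_i (x) I is written through the
   coordinate projections of the direct sum of n copies of H. *)
Definition Theta_dil f T (r : R) : bop (ftens (ell2 'I_n H)) (ftens H) :=
  - tens (idop H2f) (row_op (feval f T)) +
  bcomp (tens (idop H2f) (Delta f T))
    (bcomp (opinv (idop (ftens H) -
                   r%:C%C *: \sum_i tens (Lambda i) (adj (feval f T i))))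
    (bcomp (r%:C%C *: \sum_i tens (Lambda i) (coord H i))
           (tens (idop H2f) (Delta_star f T)))).

Definition Theta f T : bop (ftens (Dspace_star f T)) (ftens (Dspace f T)) :=
  xget 0 [set Th : bop (ftens (Dspace_star f T)) (ftens (Dspace f T)) |
    forall x,
      Theta_dil f T r (tens (idop H2f) (incl (clran (Delta_star f T))) x) @[r --> 1^'-] -->
      tens (idop H2f) (incl (clran (Delta f T))) (Th x)].

Definition Delta_Theta f T : bop (ftens (Dspace_star f T)) (ftens (Dspace_star f T)) :=
  opsqrt (idop _ - bcomp (adj (Theta f T)) (Theta f T)).

Definition DTheta_space f T : hilbertType R := subsp (clran (Delta_Theta f T)).

(* Delta_Theta y, as an element of the closure of the range of Delta_Theta. *)
Definition to_DTheta f T (y : ftens (Dspace_star f T)) : DTheta_space f T :=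
  to_clran (Delta_Theta f T) y.

Definition model_sum f T : hilbertType R := dsum (ftens (Dspace f T)) (DTheta_space f T).

Definition model_space f T : hilbertType R :=
  subsp (orth [set ((Theta f T x, to_DTheta x) : model_sum f T) | x in setT]).

Definition pure_model_space f T : hilbertType R :=
  subsp (orth (range (Theta f T))).

End domain.

End model.

(* Main.v *)
Require Import Defs.
From HB Require Import structures.
From mathcomp Require Import all_boot all_order all_algebra.
From mathcomp Require Import all_classical all_reals all_analysis.
From mathcomp Require Import complex ring lra.
Set Implicit Arguments.
Unset Strict Implicit.
Unset Printing Implicit Defensive.
Import Order.TTheory GRing.Theory Num.Theory.
Import numFieldNormedType.Exports.
Local Open Scope classical_set_scope.
Local Open Scope ring_scope.

(** The model of a c.n.c. tuple [T] comes from its Poisson kernel [K], which sends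
    [h] to the family of the [Delta F_w^* h], where [F = f(T)] and [w] runs through
    the words.

    Two facts about [K] carry the proof.  First, [K^*] turns the universal model
    into [T]: [K^* (M_i (x) I) = T_i K^*] ([poisson_kernel_model]).  Indeed [M_i] is
    left multiplication by the coordinates of [Z_i] ([model_left_mult]): this is
    where the model property enters, through the injectivity of the substitution of
    [f].  And [K^*] turns left multiplication by a series into the evaluation of
    this series at [F] ([poisson_tens]), which is [T_i] because [g(f(T)) = T].
    Second, [I - Theta Theta^* = K K^*] ([Theta_poisson]), and [K] is injective
    exactly when [T] is completely non-coisometric, since [|h|^2 - |K h|^2] is the
    limit of the forms [<Phi^k(I) h, h>] ([poisson_norm]).

    The orthogonal projection of [(y, 0)] on the model space has squared norm
    [|y|^2 - |Theta^* y|^2 = |K^* y|^2].  So sending [K^* y] to this projection is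
    isometric, and it extends to a unitary because both families of vectors are
    dense.  It carries [T_i] to the compression of [(M_i (x) I) (+) D_i], whose
    adjoint leaves the model space invariant ([functional_model]).

    The operator [D_i] exists because [Theta] commutes with the left creation
    operators: these descend to isometries with orthogonal ranges on the closure of
    the range of [Delta_Theta], and von Neumann's inequality for this row bounds
    [Delta_Theta (M_i (x) I) y] by a multiple of [Delta_Theta y]
    ([defect_left_mult]).

    The tuple [T] is pure exactly when [K] is isometric.  By [I - Theta Theta^* = K K^*]
    this makes [Theta] a partial isometry; its kernel reduces the left creation
    operators, hence is zero unless it contains a constant, and constants are
    excluded by the injectivity of [K].  Conversely, when [Theta] is isometric, [K K^*]
    is a projection, and [K] is isometric because it is injective
    ([Theta_isometryP]).

    The characteristic function is studied through its dilations, which are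
    transfer functions [- F + Dl (1 - r L F^* )^-1 r L Ds] with an isometry [L], the
    row of the right creation operators.  They are contractive because the Julia
    operator of [F] is isometric ([transfer_energy]).  Their limit as [r -> 1] exists
    on vectors [f_a (x) y] because their coordinates are powers of [r] up to
    constants ([Tr_emb_cvg]). *)

(** * Norms, inner products and projections in Hilbert spaces *)

Section HilbertNorm.
Variables (R : realType) (V : hilbertType R).
Local Notation C := R[i]%C.
Implicit Types x y z : V.

Definition rin x y : R := complex.Re (inner x y).

Lemma hnormE x : `|x| = (hnorm x)%:C%C.
Proof. exact: Cge0_real. Qed.

Lemma hnorm_ge0 x : 0 <= hnorm x.
Proof. by rewrite -ler0c -hnormE. Qed.

Lemma hnorm_eq0 x : hnorm x = 0 -> x = 0.
Proof. by move=> h; apply/eqP; rewrite -normr_eq0 hnormE h. Qed.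

Lemma hnorm0 : hnorm (0 : V) = 0.
Proof. by rewrite /hnorm normr0. Qed.

Lemma hnormD x y : hnorm (x + y) <= hnorm x + hnorm y.
Proof. by rewrite -lecR rmorphD/= -!hnormE ler_normD. Qed.

Lemma hnormN x : hnorm (- x) = hnorm x.
Proof. by rewrite /hnorm normrN. Qed.

Lemma hnormB x y : hnorm (x - y) <= hnorm x + hnorm y.
Proof. by rewrite -(hnormN y) hnormD. Qed.

Lemma hdistC x y : hnorm (x - y) = hnorm (y - x).
Proof. by rewrite -hnormN opprB. Qed.

Lemma hnormZ (a : C) x : hnorm (a *: x) = hnorm a * hnorm x.
Proof.
have h : (hnorm (a *: x))%:C%C = (hnorm a * hnorm x)%:C%C :> C.
  by rewrite rmorphM/= -!hnormE normrZ.
exact: (congr1 (@complex.Re R) h).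
Qed.

Lemma hnormZr (a : R) x : hnorm (a%:C%C *: x) = `|a| * hnorm x.
Proof. by rewrite hnormZ /hnorm normC_real. Qed.

Lemma rinn x : rin x x = hnorm x ^+ 2.
Proof. by rewrite /rin inner_norm hnormE -rmorphXn. Qed.

Lemma rinC x y : rin x y = rin y x.
Proof. by rewrite /rin innerC; case: (inner y x). Qed.

Lemma rinDl x y z : rin (x + y) z = rin x z + rin y z.
Proof. by rewrite /rin innerDl raddfD. Qed.
Lemma rinDr x y z : rin z (x + y) = rin z x + rin z y.
Proof. by rewrite !(rinC z) rinDl. Qed.
Lemma rinNl x y : rin (- x) y = - rin x y.
Proof. by rewrite /rin innerNl raddfN. Qed.
Lemma rinNr x y : rin x (- y) = - rin x y.
Proof. by rewrite !(rinC x) rinNl. Qed.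
Lemma rinBl x y z : rin (x - y) z = rin x z - rin y z.
Proof. by rewrite rinDl rinNl. Qed.
Lemma rinBr x y z : rin z (x - y) = rin z x - rin z y.
Proof. by rewrite rinDr rinNr. Qed.
Lemma rinZl (a : R) x y : rin (a%:C%C *: x) y = a * rin x y.
Proof.
rewrite /rin innerZl; case: (inner x y) => b c /=.
by rewrite mul0r subr0.
Qed.
Lemma rinZr (a : R) x y : rin x (a%:C%C *: y) = a * rin x y.
Proof. by rewrite rinC rinZl rinC. Qed.
Lemma rin0l x : rin 0 x = 0.
Proof. by rewrite /rin inner0l. Qed.
Lemma rin0r x : rin x 0 = 0.
Proof. by rewrite rinC rin0l. Qed.

Definition rinE := (rinDl, rinDr, rinNl, rinNr, rinZl, rinZr).

(** The real part of the inner product determines it, since the imaginary part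
    is the real part of the product with [i y]. *)
Lemma inner_rin x y : inner x y = Complex (rin x y) (rin x ('i%C *: y)).
Proof.
rewrite /rin innerZr; case: (inner x y) => a b /=.
by rewrite /= mul0r sub0r mulN1r opprK.
Qed.

Lemma rin_inj x y : (forall z, rin x z = rin y z) -> x = y.
Proof.
move=> h; apply/eqP; rewrite -subr_eq0; apply/eqP/hnorm_eq0/eqP.
by rewrite -sqrf_eq0 -rinn rinBl h subrr.
Qed.

Lemma hnormDsq x y : hnorm (x + y) ^+ 2 = hnorm x ^+ 2 + hnorm y ^+ 2 + rin x y *+ 2.
Proof. by rewrite -!rinn !rinE (rinC y x) mulr2n; ring. Qed.

Lemma hnormBsq x y : hnorm (x - y) ^+ 2 = hnorm x ^+ 2 + hnorm y ^+ 2 - rin x y *+ 2.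
Proof. by rewrite -!rinn !rinE (rinC y x) mulr2n; ring. Qed.

Lemma hparallelogram x y :
  hnorm (x + y) ^+ 2 + hnorm (x - y) ^+ 2 = (hnorm x ^+ 2 + hnorm y ^+ 2) *+ 2.
Proof. by rewrite hnormDsq hnormBsq !mulr2n; ring. Qed.

Lemma hnormCE (z : C) : (hnorm z)%:C%C = `|z|.
Proof. by rewrite -Cge0_real. Qed.

Lemma inner_CS x y : hnorm (inner x y) <= hnorm x * hnorm y.
Proof. by rewrite -lecR rmorphM/= hnormCE -!hnormE; exact: Cauchy_Schwarz. Qed.

Lemma Re_hnorm (z : C) : `|complex.Re z| <= hnorm z.
Proof. by rewrite -lecR hnormCE; exact: Re_norm_le. Qed.

Lemma rin_CS x y : `|rin x y| <= hnorm x * hnorm y.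
Proof. exact: le_trans (Re_hnorm _) (inner_CS _ _). Qed.

Lemma rin_le x y : rin x y <= hnorm x * hnorm y.
Proof. exact: le_trans (ler_norm _) (rin_CS _ _). Qed.

Lemma hnorm_le_sq x (a : R) : 0 <= a -> (hnorm x ^+ 2 <= a ^+ 2) = (hnorm x <= a).
Proof. by move=> a0; apply: ler_pXn2r => //; rewrite nnegrE// hnorm_ge0. Qed.

Lemma hcvgP T (F : set_system T) {FF : Filter F} (u : T -> V) (l : V) :
  (u @ F --> l) <-> (forall e : R, 0 < e -> \forall t \near F, hnorm (l - u t) < e).
Proof.
split=> [/cvgrPdist_lt h e e0|h].
  have := h e%:C%C; rewrite ltcR => /(_ e0); apply: filterS => t.
  by rewrite hnormE ltcR.
apply/cvgrPdist_lt => e /Cgt0_real[-> e0].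
by apply: filterS (h _ e0) => t ht; rewrite hnormE ltcR.
Qed.

Lemma hcvg_unique T (F : set_system T) (u : T -> V) (l l' : V) {FF : ProperFilter F} :
  u @ F --> l -> u @ F --> l' -> l = l'.
Proof. by move=> ul ul'; exact: (cvg_unique (@norm_hausdorff _ _) ul ul'). Qed.

Lemma hcvgD T (F : set_system T) {FF : Filter F} (u v : T -> V) (l m : V) :
  u @ F --> l -> v @ F --> m -> (fun t => u t + v t) @ F --> l + m.
Proof. by move=> ul vm; apply: (cvgD ul vm). Qed.

Lemma hcvgZ T (F : set_system T) {FF : Filter F} (a : C) (u : T -> V) (l : V) :
  u @ F --> l -> (fun t => a *: u t) @ F --> a *: l.
Proof. by move=> ul; exact: (@cvgZl_tmp C V T F _ a u l ul). Qed.

Lemma hcvg_norm T (F : set_system T) {FF : Filter F} (u : T -> V) (l : V) :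
  u @ F --> l -> (fun t => hnorm (u t)) @ F --> hnorm l.
Proof.
move=> /hcvgP ul; apply/cvgrPdist_lt => e /ul; apply: filterS => t.
apply: le_lt_trans; rewrite ler_norml.
have h1 := hnormD (l - u t) (u t); rewrite subrK in h1.
have h2 := hnormD (u t - l) l; rewrite subrK hdistC in h2.
by apply/andP; split; lra.
Qed.

Lemma hcvg_rin T (F : set_system T) {FF : Filter F} (u : T -> V) (l y : V) :
  u @ F --> l -> (fun t => rin (u t) y) @ F --> rin l y.
Proof.
move=> /hcvgP ul; apply/cvgrPdist_lt => e e0.
have y0 : 0 < hnorm y + 1 by rewrite ltr_wpDl ?hnorm_ge0.
apply: filterS (ul _ (divr_gt0 e0 y0)) => t ht.
rewrite -rinBl; apply: le_lt_trans (rin_CS _ _) _.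
have h2 : hnorm (l - u t) * (hnorm y + 1) < e by rewrite -ltr_pdivlMr.
have := hnorm_ge0 (l - u t); have := hnorm_ge0 y; nra.
Qed.

Lemma hcauchy (u : nat -> V) :
  (forall e : R, 0 < e -> exists N, forall p q, (N <= p)%N -> (N <= q)%N ->
     hnorm (u p - u q) < e) -> exists l : V, u @ \oo --> l.
Proof.
move=> h; apply/cvg_ex/hilbert_seq_complete => e e0.
have [|N hN] := h (complex.Re (sqrtC e)).
  have /Cgt0_real[] : 0 < sqrtC e by rewrite sqrtC_gt0.
  by [].
exists N => p q Np Nq; have se : 0 < sqrtC e by rewrite sqrtC_gt0.
rewrite -(sqrtCK e) Csq_lt//; have [-> _] := Cgt0_real se.
by rewrite hnormE ltcR hN.
Qed.

Lemma hclosureP (A : set V) x :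
  closure A x <-> forall e : R, 0 < e -> exists2 z, A z & hnorm (x - z) < e.
Proof.
rewrite closureE_norm; split => h e.
  move=> e0; have [|z Az] := h e%:C%C; first by rewrite ltcR.
  by rewrite hnormE ltcR => ?; exists z.
by move=> /Cgt0_real[-> /h[z Az xz]]; exists z => //; rewrite hnormE ltcR.
Qed.

End HilbertNorm.

Section HilbertProjection.
Variables (R : realType) (V : hilbertType R).
Local Notation C := R[i]%C.

Lemma cs_addP (A : closed_subspace V) x y : cs_set A x -> cs_set A y -> cs_set A (x + y).
Proof. by move=> Ax Ay; rewrite -[x]scale1r; exact: cs_lin. Qed.

Lemma cs_scale (A : closed_subspace V) (a : C) x : cs_set A x -> cs_set A (a *: x).
Proof. by move=> Ax; rewrite -[_ *: _]addr0; apply: cs_lin => //; exact: cs_zero. Qed.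

Lemma cs_opp (A : closed_subspace V) x : cs_set A x -> cs_set A (- x).
Proof. by move=> Ax; rewrite -scaleN1r; exact: cs_scale. Qed.

Lemma cs_cvg T (F : set_system T) (A : closed_subspace V) (u : T -> V) l {FF : ProperFilter F} :
  (\forall t \near F, cs_set A (u t)) -> u @ F --> l -> cs_set A l.
Proof. by move=> uA ul; exact: (@closed_cvg _ _ F FF u (cs_set A) (@cs_closed _ _ A) uA l ul). Qed.

(** A sequence of points of [A] whose distances to [x] tend to the infimum is
    Cauchy by the parallelogram law; at its limit [p], minimality in the
    direction of [y] forces [x - p] to be orthogonal to [y]. *)
Lemma projection_thm (A : closed_subspace V) (x : V) :
  exists2 p, cs_set A p & forall y, cs_set A y -> inner (x - p) y = 0.
Proof.
pose D := [set hnorm (x - y) ^+ 2 | y in cs_set A].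
pose d := inf D.
have Dinf : has_inf D.
  split; first by exists (hnorm (x - 0) ^+ 2); exists 0 => //; exact: cs_zero.
  by exists 0 => _ [y _ <-]; rewrite sqr_ge0.
have dle y : cs_set A y -> d <= hnorm (x - y) ^+ 2.
  by move=> Ay; apply: ge_inf; [exact: Dinf.2|exists y].
have /choice[u uP] : forall k : nat, exists y, cs_set A y /\
    hnorm (x - y) ^+ 2 < d + k.+1%:R^-1.
  move=> k; have [|_ [y Ay <-] h] := @inf_adherent _ D k.+1%:R^-1 _ Dinf.
    by rewrite invr_gt0.
  by exists y.
have half2 (a b c : R) : a + b = c -> b = c - a by move=> <-; rewrite addrC addKr.
have uc p q : hnorm (u p - u q) ^+ 2 <= (p.+1%:R^-1 + q.+1%:R^-1) *+ 2.
  have := hparallelogram (x - u p) (x - u q).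
  have -> : x - u p - (x - u q) = u q - u p by rewrite opprB addrC addrA subrK.
  rewrite hdistC.
  pose m := (2^-1 : R)%:C%C *: (u p + u q).
  have Am : cs_set A m by apply: cs_scale; apply: cs_addP; apply: (uP _).1.
  have -> : x - u p + (x - u q) = (2 : R)%:C%C *: (x - m).
    rewrite scalerBr scalerA -rmorphM/= mulfV ?pnatr_eq0// scale1r.
    rewrite addrACA -opprD; congr (_ - _).
    by rewrite [(2:R)%:C%C](rmorph_nat (real_complex R) 2) scaler_nat mulr2n.
  rewrite hnormZr exprMn [`|2|]ger0_norm//.
  have := dle m Am; have := (uP p).2; have := (uP q).2.
  rewrite !mulr2n [2 ^+ 2]expr2; move: (p.+1%:R^-1) (q.+1%:R^-1) => a b; lra.
have [e|p up] := @hcauchy _ _ u.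
  move=> e0.
  have e2 : 0 < e ^+ 2 / 4 by rewrite divr_gt0// exprn_gt0.
  have [N] := ltr_add_invr e2; rewrite add0r => hN.
  exists N => p q Np Nq.
  rewrite -(@ltr_pXn2r _ 2)// ?nnegrE ?hnorm_ge0 ?(ltW e0)//.
  apply: le_lt_trans (uc p q) _.
  have k m : (N <= m)%N -> (m.+1%:R^-1 : R) <= N.+1%:R^-1.
    by move=> Nm; rewrite lef_pV2 ?posrE// ler_nat.
  move: hN (k p Np) (k q Nq); rewrite mulr2n.
  move: (p.+1%:R^-1) (q.+1%:R^-1) (N.+1%:R^-1) => a b c; lra.
have Ap : cs_set A p by apply: cs_cvg up; apply: nearW => k; exact: (uP k).1.
have dp : hnorm (x - p) ^+ 2 <= d.
  have c : (fun k => hnorm (x - u k) ^+ 2) @ \oo --> hnorm (x - p) ^+ 2.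
    have h : (fun k => hnorm (x - u k)) @ \oo --> hnorm (x - p).
      by apply: hcvg_norm; apply: cvgB => //; exact: cvg_cst.
    by rewrite expr2; under eq_fun do rewrite expr2; exact: cvgM.
  apply/ler_addgt0Pr => e e0.
  have [N] := ltr_add_invr e0; rewrite add0r => hN.
  rewrite -(cvg_lim (@Rhausdorff _) c); apply: limr_le; first by apply/cvg_ex; eexists; exact: c.
  exists N => // k /= Nk; apply: le_trans (ltW (uP k).2) _; rewrite lerD2l.
  apply: le_trans (ltW hN); by rewrite lef_pV2 ?posrE// ler_nat.
have rin0 y : cs_set A y -> rin (x - p) y = 0.
  move=> Ay.
  have key (t : R) : 0 <= t ^+ 2 * hnorm y ^+ 2 - (t * rin (x - p) y) *+ 2.
    have Aq : cs_set A (p + t%:C%C *: y) by apply: cs_addP => //; exact: cs_scale.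
    have := le_trans dp (dle _ Aq).
    rewrite opprD addrA [leRHS]hnormBsq hnormZr exprMn real_normK ?num_real// rinZr.
    lra.
  set c := rin _ _ in key *; set h := hnorm y ^+ 2 in key.
  have h0 : 0 <= h by rewrite /h sqr_ge0.
  have := key (c / (h + 1)).
  have h1 : 0 < h + 1 by rewrite ltr_wpDl.
  have -> : (c / (h + 1)) ^+ 2 * h - (c / (h + 1) * c) *+ 2 =
     - (c ^+ 2 * ((h + 2) / (h + 1) ^+ 2)).
    by rewrite mulr2n; field; rewrite gt_eqF.
  rewrite oppr_ge0 pmulr_lle0; last by rewrite divr_gt0 ?exprn_gt0// ltr_wpDl.
  by move=> c0; apply/eqP; rewrite -sqrf_eq0 eq_le c0 sqr_ge0.
exists p => // y Ay; rewrite inner_rin !rin0//; exact: cs_scale.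
Qed.

End HilbertProjection.

(** * Bounded operators and their adjoints *)

Section Bounded.
Variables (R : realType) (V W : hilbertType R).
Local Notation C := R[i]%C.
Implicit Types A B : bop V W.

Lemma bop_ext A B : (forall x, A x = B x) -> A = B.
Proof. by move=> h; apply/val_inj/funext. Qed.

Lemma bopDE A B x : (A + B) x = A x + B x. Proof. by []. Qed.
Lemma bopNE A x : (- A) x = - A x. Proof. by []. Qed.
Lemma bopBE A B x : (A - B) x = A x - B x. Proof. by []. Qed.
Lemma bopZE (a : C) A x : (a *: A) x = a *: A x. Proof. by []. Qed.
Lemma bop0E x : (0 : bop V W) x = 0. Proof. by []. Qed.
Lemma bcompE (U : hilbertType R) (D : bop W U) A x : bcomp D A x = D (A x). Proof. by []. Qed.
Lemma idopE x : idop V x = x. Proof. by []. Qed.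
Lemma bop_sumE (I : Type) (s : seq I) (P : pred I) (F : I -> bop V W) x :
  (\sum_(i <- s | P i) F i) x = \sum_(i <- s | P i) F i x.
Proof. by elim/big_rec2: _ => [//|i y1 y2 _ <-]. Qed.

Lemma bopxD A x y : A (x + y) = A x + A y. Proof. exact: linearD. Qed.
Lemma bopxB A x y : A (x - y) = A x - A y. Proof. exact: linearB. Qed.
Lemma bopxN A x : A (- x) = - A x. Proof. exact: linearN. Qed.
Lemma bopx0 A : A 0 = 0. Proof. exact: linear0. Qed.
Lemma bopxZ A (a : C) x : A (a *: x) = a *: A x.
Proof. by have := bop_linear A a x 0; rewrite !addr0 bopx0 addr0. Qed.
Lemma bopx_sum A (I : Type) (s : seq I) (P : pred I) (F : I -> V) :
  A (\sum_(i <- s | P i) F i) = \sum_(i <- s | P i) A (F i).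
Proof. by elim/big_rec2: _ => [|i y1 y2 _ <-]; rewrite ?bopx0 ?bopxD. Qed.

Lemma bop_bounded A : exists2 c : R, 0 <= c & forall x, hnorm (A x) <= c * hnorm x.
Proof.
have /hcvgP/(_ 1 ltr01) := @bop_continuous _ _ _ A 0.
rewrite linear0 => /nbhs_ballP[e /Cgt0_real[-> e0]].
set d := complex.Re e in e0 * => dA.
have d2 : 0 < d / 2 by rewrite divr_gt0.
exists (d / 2)^-1 => [|x]; first by rewrite invr_ge0 ltW.
have [->|x0] := eqVneq x 0; first by rewrite linear0 !hnorm0 mulr0.
have hx : 0 < hnorm x.
  rewrite lt_neqAle hnorm_ge0 andbT; apply: contraNN x0 => /eqP h.
  by apply/eqP/hnorm_eq0.
have := dA ((d / 2 / hnorm x)%:C%C *: x).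
have q0 : 0 < d / 2 / hnorm x by rewrite divr_gt0.
rewrite /= -ball_normE/= !sub0r normrN linearZ/= hnormE ltcR hnormN !hnormZr.
rewrite (gtr0_norm q0) divfK ?gt_eqF// => h.
have {h} : d / 2 / hnorm x * hnorm (A x) < 1 by apply: h; lra.
move=> /ltW; rewrite -ler_pdivlMl// mulr1 => /le_trans; apply.
by rewrite invfM invrK.
Qed.

Lemma bop_mk (f : V -> W) (c : R) : linear f ->
  (forall x, hnorm (f x) <= c * hnorm x) -> exists A : bop V W, forall x, A x = f x.
Proof.
move=> lf bf; have fP : f \in @bop_pred R V W.
  apply: (@bounded_bopP _ _ _ f c%:C%C) => // x.
  by rewrite !hnormE -rmorphM/= lecR.
by exists (Bop fP).
Qed.

Lemma bop_cvg T (F : set_system T) {FF : Filter F} A (u : T -> V) l :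
  u @ F --> l -> (fun t => A (u t)) @ F --> A l.
Proof. by move=> ul; apply: continuous_cvg => //; exact: bop_continuous. Qed.

Lemma opnorm_sup A : has_sup [set hnorm (A x) | x in [set x : V | `|x| <= 1]].
Proof.
split; first by exists (hnorm (A 0)), 0 => //=; rewrite normr0.
have [c c0 hc] := bop_bounded A; exists c => _ [x /= x1 <-].
apply: le_trans (hc x) _; rewrite -[leRHS]mulr1 ler_wpM2l//.
by move: x1; rewrite hnormE lecR.
Qed.

Lemma opnorm_ge0 A : 0 <= opnorm A.
Proof.
apply: le_trans (hnorm_ge0 (A 0)) _; apply: ub_le_sup; first exact: (opnorm_sup A).2.
by exists 0 => //=; rewrite normr0.
Qed.

Lemma hnorm_opnorm A x : hnorm (A x) <= opnorm A * hnorm x.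
Proof.
have [->|x0] := eqVneq x 0; first by rewrite linear0 !hnorm0 mulr0.
have hx : 0 < hnorm x.
  rewrite lt_neqAle hnorm_ge0 andbT; apply: contraNN x0 => /eqP h.
  by apply/eqP/hnorm_eq0.
rewrite -ler_pdivrMr// mulrC -[X in X * _]gtr0_norm ?invr_gt0//.
rewrite -hnormZr -linearZ/=.
apply: ub_le_sup; first exact: (opnorm_sup A).2.
exists ((hnorm x)^-1%:C%C *: x) => //=.
by rewrite hnormE hnormZr lecR gtr0_norm ?invr_gt0// mulVf ?gt_eqF.
Qed.

Lemma opnorm_le A (c : R) : 0 <= c -> (forall x, hnorm (A x) <= c * hnorm x) -> opnorm A <= c.
Proof.
move=> c0 hc; apply: ge_sup; first exact: (opnorm_sup A).1.
move=> _ [x /= x1 <-]; apply: le_trans (hc x) _.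
by rewrite -[leRHS]mulr1 ler_wpM2l//; move: x1; rewrite hnormE lecR.
Qed.

End Bounded.

Section Riesz.
Variables (R : realType).
Local Notation C := R[i]%C.
Implicit Types V W : hilbertType R.

Lemma inner_inj V (x y : V) : (forall z, inner z x = inner z y) -> x = y.
Proof. by move=> h; apply: rin_inj => z; rewrite rinC /rin h -/(rin z y) rinC. Qed.

Lemma innerBl V (x y z : V) : inner (x - y) z = inner x z - inner y z.
Proof. by rewrite innerDl innerNl. Qed.

Lemma Riesz V (phi : bop V C) : exists w, forall x, phi x = inner x w.
Proof.
have kcl : closed [set x | phi x = 0].
  move=> x /hclosureP h; apply: (@hnorm_eq0 _ C); apply/eqP.
  rewrite eq_le hnorm_ge0 andbT; apply/ler_addgt0Pr => e e0; rewrite add0r.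
  have [c c0 hc] := bop_bounded phi.
  have c1 : 0 < c + 1 by rewrite ltr_wpDl.
  have [z /= z0 xz] := h _ (divr_gt0 e0 c1).
  rewrite -[phi x]subr0 -z0 -linearB/=; apply: le_trans (hc _) _.
  have : hnorm (x - z) * (c + 1) < e by rewrite -ltr_pdivlMr.
  have := hnorm_ge0 (x - z); nra.
have k0 : [set x | phi x = 0] 0 by rewrite /= linear0.
have kl (a : C) x y : [set x | phi x = 0] x -> [set x | phi x = 0] y ->
    [set x | phi x = 0] (a *: x + y).
  by move=> /= hx hy; rewrite bop_linear hx hy scaler0 addr0.
pose K := ClosedSubspace k0 kl kcl.
have [h|/existsNP[x0 px0]] := pselect (forall x, phi x = 0).
  by exists 0 => x; rewrite inner0r h.
have [p Kp pK] := projection_thm K x0.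
pose z := x0 - p.
have pz : phi z = phi x0 by rewrite linearB/= Kp subr0.
have z0 : inner z z != 0.
  rewrite inner_norm expf_eq0/= normr_eq0; apply/eqP => h.
  by apply: px0; rewrite -pz h linear0.
exists (((phi z) / inner z z)^* *: z) => x.
rewrite innerZr conjCK.
have Kx : cs_set K (phi z *: x - phi x *: z).
  have phiZ (b : C) v : phi (b *: v) = b * phi v.
    by have := bop_linear phi b v 0; rewrite !addr0 linear0 addr0.
  change (phi (phi z *: x - phi x *: z) = 0).
  by rewrite linearB/= !phiZ; ring.
have : inner (phi z *: x - phi x *: z) z = 0.
  by rewrite innerC pK// rmorph0.
rewrite innerBl !innerZl => /eqP; rewrite subr_eq0 => /eqP h.
by rewrite -mulrA (mulrC _^-1) mulrA h mulfK.
Qed.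

Lemma adj_exists V W (A : bop V W) :
  exists B : bop W V, forall x y, inner (A x) y = inner x (B y).
Proof.
have [c c0 hc] := bop_bounded A.
have /choice[B hB] : forall y : W, exists w, forall x, inner (A x) y = inner x w.
  move=> y; have [phi hphi] : exists phi : bop V C, forall x, phi x = inner (A x) y.
    apply: (@bop_mk _ _ _ _ (c * hnorm y)) => [a x x'|x].
      by rewrite linearP innerDl innerZl.
    apply: le_trans (inner_CS _ _) _; rewrite mulrAC ler_wpM2r ?hnorm_ge0//.
  have [w hw] := Riesz phi; exists w => x; by rewrite -hphi hw.
have [B' hB'] : exists B' : bop W V, forall y, B' y = B y.
  apply: (@bop_mk _ _ _ _ c) => [a x x'|y].
    apply: inner_inj => z; rewrite -hB innerDr innerZr !hB.
    by rewrite innerDr innerZr.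
  have [->|y0] := eqVneq (hnorm (B y)) 0.
    by rewrite mulr_ge0 ?hnorm_ge0.
  have hy : 0 < hnorm (B y) by rewrite lt_neqAle eq_sym y0 hnorm_ge0.
  rewrite -(ler_pM2l hy) -expr2 -rinn /rin -hB.
  apply: le_trans (rin_le _ _) _.
  rewrite mulrA ler_wpM2r ?hnorm_ge0// mulrC; exact: hc.
by exists B' => x y; rewrite hB' hB.
Qed.

Lemma adjP V W (A : bop V W) x y : inner (A x) y = inner x (adj A y).
Proof. by have := xgetPex 0 (adj_exists A) => /(_ x y). Qed.

Lemma adjP' V W (A : bop V W) x y : inner x (A y) = inner (adj A x) y.
Proof. by rewrite innerC adjP -innerC. Qed.

Lemma rin_adj V W (A : bop V W) x y : rin (A x) y = rin x (adj A y).
Proof. by rewrite /rin adjP. Qed.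

Lemma rin_adj' V W (A : bop V W) x y : rin x (A y) = rin (adj A x) y.
Proof. by rewrite /rin adjP'. Qed.

Lemma adj_uniq V W (A : bop V W) (B : bop W V) :
  (forall x y, rin (A x) y = rin x (B y)) -> adj A = B.
Proof.
by move=> h; apply: bop_ext => y; apply: rin_inj => x; rewrite rinC -rin_adj h rinC.
Qed.

Lemma adjK V W (A : bop V W) : adj (adj A) = A.
Proof. by apply: adj_uniq => x y; rewrite rin_adj'. Qed.

Lemma adj_comp U V W (A : bop V W) (B : bop U V) : adj (bcomp A B) = bcomp (adj B) (adj A).
Proof. by apply: adj_uniq => x y; rewrite /= !rin_adj. Qed.

Lemma adjD V W (A B : bop V W) : adj (A + B) = adj A + adj B.
Proof. by apply: adj_uniq => x y; rewrite !bopDE rinDl rinDr !rin_adj. Qed.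

Lemma adjN V W (A : bop V W) : adj (- A) = - adj A.
Proof. by apply: adj_uniq => x y; rewrite !bopNE rinNl rinNr !rin_adj. Qed.

Lemma adjB V W (A B : bop V W) : adj (A - B) = adj A - adj B.
Proof. by rewrite adjD adjN. Qed.

Lemma adjZ V W (a : C) (A : bop V W) : adj (a *: A) = a^* *: adj A.
Proof.
by apply: adj_uniq => x y; rewrite !bopZE /rin innerZl innerZr conjCK adjP.
Qed.

Lemma adj_id V : adj (idop V) = idop V.
Proof. exact: adj_uniq. Qed.

Lemma adj_bound V W (A : bop V W) c : 0 <= c -> (forall x, hnorm (A x) <= c * hnorm x) ->
  forall y, hnorm (adj A y) <= c * hnorm y.
Proof.
move=> c0 hc y; have [->|y0] := eqVneq (hnorm (adj A y)) 0.
  by rewrite mulr_ge0 ?hnorm_ge0.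
have hy : 0 < hnorm (adj A y) by rewrite lt_neqAle eq_sym y0 hnorm_ge0.
rewrite -(ler_pM2l hy) -expr2 -rinn -rin_adj.
apply: le_trans (rin_le _ _) _.
by rewrite mulrA ler_wpM2r ?hnorm_ge0// mulrC; exact: hc.
Qed.

Lemma isometry_rin V W (K : bop V W) : (forall x, hnorm (K x) = hnorm x) ->
  forall x y, rin (K x) (K y) = rin x y.
Proof.
move=> h x y; have := hnormDsq x y; rewrite -h bopxD hnormDsq !h !mulr2n; lra.
Qed.

Lemma isometry_adj V W (K : bop V W) : (forall x, hnorm (K x) = hnorm x) ->
  forall x, adj K (K x) = x.
Proof. by move=> h x; apply: rin_inj => y; rewrite -rin_adj' isometry_rin. Qed.

(** The range of [A] is dense once [adj A] is injective: its orthogonal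
    complement is the kernel of [adj A]. *)
Lemma dense_range V W (A : bop V W) : (forall y, adj A y = 0 -> y = 0) ->
  forall y, cs_set (clran A) y.
Proof.
move=> inj y; have [p Kp pK] := projection_thm (clran A) y.
have -> : y = p; last by [].
apply/eqP; rewrite -subr_eq0; apply/eqP/inj/inner_inj => x.
rewrite -adjP inner0r innerC pK ?rmorph0//.
by apply: subset_closure; exists x.
Qed.

End Riesz.

Local Notation incl := Defs.incl.
Local Notation coord := Defs.coord.

(** * Limits, extensions and factorizations of operators *)

Section Limits.
Variables (R : realType) (V W : hilbertType R).
Local Notation C := R[i]%C.

Lemma hnorm_limit_le (U : hilbertType R) T (F : set_system T) (u : T -> U) l (c : R)
  {FF : ProperFilter F} : u @ F --> l -> (\forall t \near F, hnorm (u t) <= c) -> hnorm l <= c.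
Proof.
move=> ul uc; have h : hnorm (u t) @[t --> F] --> hnorm l by exact: hcvg_norm.
by rewrite -(cvg_lim (@Rhausdorff _) h); apply: limr_le => //; apply/cvg_ex; eexists; exact: h.
Qed.

Lemma bop_ptlim T (F : set_system T) (A : T -> bop V W) (f : V -> W) (c : R)
  {FF : ProperFilter F} : (forall x, A t x @[t --> F] --> f x) ->
  (\forall t \near F, forall x, hnorm (A t x) <= c * hnorm x) ->
  exists2 L : bop V W, (forall x, L x = f x) & forall x, hnorm (L x) <= c * hnorm x.
Proof.
move=> Af bA.
have bf x : hnorm (f x) <= c * hnorm x.
  by apply: (hnorm_limit_le (Af x)); apply: filterS bA => t; exact.
have [|L hL] := @bop_mk _ _ _ f c _ bf.
  move=> a x y; apply: (hcvg_unique (Af _)).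
  have -> : (fun t => A t (a *: x + y)) = (fun t => a *: A t x + A t y).
    by apply/funext => t; rewrite bop_linear.
  by apply: hcvgD => //; exact: hcvgZ.
by exists L => // x; rewrite hL.
Qed.

(** The scalar majorant is a Cauchy sequence, being nondecreasing and bounded, and it
    controls the orbits of the operators. *)
Lemma bop_cauchy (A : nat -> bop V W) (y : nat -> R) (M : R) :
  nondecreasing_seq y -> (forall k, y k <= M) ->
  (forall k x, hnorm (A k.+1 x - A k x) <= (y k.+1 - y k) * hnorm x) ->
  exists2 L : bop V W, (forall x, A k x @[k --> \oo] --> L x)
    & forall k x, hnorm (L x - A k x) <= (M - y k) * hnorm x.
Proof.
move=> yn yM dA.
have dA2 k j x : hnorm (A (k + j)%N x - A k x) <= (y (k + j)%N - y k) * hnorm x.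
  elim: j => [|j IH]; first by rewrite addn0 !subrr hnorm0 mul0r.
  rewrite addnS -(subrKA (A (k + j)%N x)) (le_trans (hnormD _ _))//.
  by have := dA (k + j)%N x; lra.
have dA3 k x : hnorm (A k x - A 0%N x) <= (y k - y 0%N) * hnorm x := dA2 0%N k x.
have cy : cvgn y by apply: nondecreasing_is_cvgn => //; exists M => _ [k _ <-].
have /choice[f hf] : forall x, exists l : W, A k x @[k --> \oo] --> l.
  move=> x; apply: hcauchy => e e0.
  have x1 : 0 < hnorm x + 1 by rewrite ltr_wpDl ?hnorm_ge0.
  have e1 : 0 < e / 2 / (hnorm x + 1) by rewrite divr_gt0// divr_gt0.
  have /cvgrPdist_lt/(_ _ e1)[N _ hN] := cy.
  exists N.
  have h k : (N <= k)%N -> hnorm (A k x - A N x) < e / 2.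
    move=> Nk; rewrite -(subnKC Nk); apply: le_lt_trans (dA2 _ _ _) _.
    rewrite subnKC//.
    have h1 : y k - y N < e / 2 / (hnorm x + 1).
      apply: le_lt_trans (hN N (leqnn _)).
      have := nondecreasing_cvgn_le yn cy k.
      have := yn _ _ Nk; have := nondecreasing_cvgn_le yn cy N.
      move=> a1 a2 a3; apply: le_trans (ler_norm _); lra.
    have h2 : (y k - y N) * (hnorm x + 1) < e / 2 by rewrite -ltr_pdivlMr.
    have := yn _ _ Nk; rewrite -subr_ge0; nra.
  move=> p q Np Nq; rewrite -(subrKA (A N x)) (splitr e).
  apply: le_lt_trans (hnormD _ _) _; rewrite ltrD ?h// hdistC h//.
have y0 k : 0 <= M - y k by rewrite subr_ge0.
have [c c0 hc] := bop_bounded (A 0%N).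
have [|L hL _] := @bop_ptlim _ \oo A f (c + (M - y 0%N)) _ hf.
  apply: nearW => k x; rewrite -(subrK (A 0%N x) (A k x)) (le_trans (hnormD _ _))//.
  by have := hc x; have := dA3 k x; have := yM k; have := hnorm_ge0 x; nra.
exists L => [x|k x]; first by rewrite hL.
have cv : (fun j => A j x - A k x) @ \oo --> L x - A k x.
  by rewrite hL; apply: cvgB => //; exact: cvg_cst.
apply: (hnorm_limit_le cv); exists k => // j /= kj.
rewrite -(subnKC kj); apply: le_trans (dA2 k _ x) _.
by rewrite ler_wpM2r ?hnorm_ge0// lerD2r.
Qed.

(** The bound makes the limits of the second components along sequences of first
    components exist and depend on the limit of the latter only. *)
Lemma bop_extend (P : V -> W -> Prop) (c : R) : 0 <= c ->
  (forall (a : C) x y x' y', P x y -> P x' y' -> P (a *: x + x') (a *: y + y')) ->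
  (forall x y, P x y -> hnorm y <= c * hnorm x) ->
  (forall x e, 0 < e -> exists x' y', P x' y' /\ hnorm (x - x') < e) ->
  exists2 A : bop V W, (forall x y, P x y -> A x = y)
    & forall x, hnorm (A x) <= c * hnorm x.
Proof.
move=> c0 Plin Pb Pd.
have Psub x y x' y' : P x y -> P x' y' -> P (x - x') (y - y').
  by move=> p p'; have := Plin (-1) _ _ _ _ p' p; rewrite !scaleN1r ![- _ + _]addrC.
pose Q (x : V) (z : W) := exists (u : nat -> V) (v : nat -> W), [/\ forall k : nat, P (u k) (v k), u @ \oo --> x & v @ \oo --> z].
have Quniq x z z' : Q x z -> Q x z' -> z = z'.
  move=> [u [v [Puv ux vz]]] [u' [v' [Puv' ux' vz']]].
  apply/eqP; rewrite -subr_eq0; apply/eqP/hnorm_eq0/eqP.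
  rewrite eq_le hnorm_ge0 andbT; apply/ler_addgt0Pr => e e0; rewrite add0r.
  have c1 : 0 < c + 1 by rewrite ltr_wpDl.
  have d1 : (fun k => u k - u' k) @ \oo --> (0 : V) by rewrite -(subrr x); exact: cvgB.
  have d2 : (fun k => v k - v' k) @ \oo --> z - z' by exact: cvgB.
  have /hcvgP/(_ _ (divr_gt0 e0 c1)) := d1.
  move=> h; apply: (hnorm_limit_le d2); apply: filterS h => k.
  rewrite sub0r hnormN => hk; apply: le_trans (Pb _ _ (Psub _ _ _ _ (Puv k) (Puv' k))) _.
  have : hnorm (u k - u' k) * (c + 1) < e by rewrite -ltr_pdivlMr.
  have := hnorm_ge0 (u k - u' k); nra.
have /choice[f fQ] : forall x, exists z, Q x z.
  move=> x.
  have /choice[u hu] : forall k : nat, exists p : V * W, P p.1 p.2 /\ hnorm (x - p.1) < k.+1%:R^-1.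
    move=> k; have [|x' [y' [p h]]] := Pd x k.+1%:R^-1; first by rewrite invr_gt0.
    by exists (x', y').
  have ux : (fun k => (u k).1) @ \oo --> x.
    apply/hcvgP => e e0; have [N] := ltr_add_invr e0; rewrite add0r => hN.
    exists N => // k /= Nk; apply: lt_trans (hu k).2 _; apply: le_lt_trans hN.
    by rewrite lef_pV2 ?posrE// ler_nat.
  have [e|z vz] := @hcauchy _ _ (fun k => (u k).2).
    move=> e0; have c1 : 0 < (c + 1) * 2 by rewrite mulr_gt0// ltr_wpDl.
    have /hcvgP/(_ _ (divr_gt0 e0 c1))[N _ hN] := ux.
    exists N => p q Np Nq.
    apply: le_lt_trans (Pb _ _ (Psub _ _ _ _ (hu p).1 (hu q).1)) _.
    have h1 : hnorm ((u p).1 - (u q).1) <= hnorm (x - (u p).1) + hnorm (x - (u q).1).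
      by rewrite (hdistC x (u p).1) -(subrKA x) hnormD.
    have := hN _ Np; have := hN _ Nq; rewrite /= => a b.
    have a' : hnorm (x - (u q).1) * ((c + 1) * 2) < e by rewrite -ltr_pdivlMr.
    have b' : hnorm (x - (u p).1) * ((c + 1) * 2) < e by rewrite -ltr_pdivlMr.
    have := hnorm_ge0 (x - (u q).1); have := hnorm_ge0 (x - (u p).1).
    move: h1 a' b'; move: (hnorm _) (hnorm _) (hnorm _) => s t w; nra.
  exists z, (fun k => (u k).1), (fun k => (u k).2); split => // k.
  exact: (hu k).1.
have bf x : hnorm (f x) <= c * hnorm x.
  have [u [v [Puv ux vz]]] := fQ x.
  have h1 : (fun k => hnorm (v k)) @ \oo --> hnorm (f x) by exact: hcvg_norm.
  have h2 : (fun k => hnorm (u k)) @ \oo --> hnorm x by exact: hcvg_norm.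
  have h3 : (fun k => c * hnorm (u k)) @ \oo --> c * hnorm x by apply: cvgM => //; exact: cvg_cst.
  apply: (ler_cvg_to h1 h3); apply: nearW => k; exact: Pb.
have lf : linear f.
  move=> a x x'; apply: (Quniq (a *: x + x')); first exact: fQ.
  have [u [v [Puv ux vz]]] := fQ x; have [u' [v' [Puv' ux' vz']]] := fQ x'.
  exists (fun k => a *: u k + u' k), (fun k => a *: v k + v' k); split.
  - by move=> k; exact: Plin.
  - by apply: hcvgD => //; exact: hcvgZ.
  - by apply: hcvgD => //; exact: hcvgZ.
have [A hA] := bop_mk lf bf.
exists A => [x y p|x]; rewrite hA//.
apply: (Quniq x (f x) y (fQ x)); exists (fun=> x), (fun=> y); split => //; exact: cvg_cst.
Qed.

End Limits.

Section Subspaces.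
Variables (R : realType).
Local Notation C := R[i]%C.
Implicit Types U V W : hilbertType R.

Lemma hnorm_subsp V (S : closed_subspace V) (x : subsp S) : hnorm x = hnorm (x : V).
Proof.
apply/eqP; rewrite -(@eqrXn2 _ 2)// ?hnorm_ge0//; apply/eqP.
by rewrite -!rinn.
Qed.

Lemma adj_incl V (S : closed_subspace V) (x : subsp S) : adj (incl S) (incl S x) = x.
Proof. by apply: inner_inj => z; rewrite -adjP. Qed.

Lemma incl_adj V (S : closed_subspace V) (x : V) : cs_set S x -> incl S (adj (incl S) x) = x.
Proof.
move=> Sx; have h : x \in cs_pred S by apply/cs_predP.
by have := congr1 (incl S) (adj_incl (Subsp h)).
Qed.

(** Douglas' factorization lemma: the relation between the [A x] and the [B x] is
    bounded, so it extends to the closure of the range of [A]. *)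
Lemma douglas U V W (A : bop U V) (B : bop U W) (c : R) : 0 <= c ->
  (forall x, hnorm (B x) <= c * hnorm (A x)) ->
  exists2 X : bop (subsp (clran A)) W, (forall x, X (to_clran A x) = B x)
    & forall z, hnorm (X z) <= c * hnorm z.
Proof.
move=> c0 hAB.
have [||||X hX bX] := @bop_extend _ _ _ (fun z y => exists x, z = to_clran A x /\ y = B x) c.
- by [].
- move=> a _ _ _ _ [x [-> ->]] [x' [-> ->]]; exists (a *: x + x').
  by rewrite linearP; split => //; apply: val_inj; rewrite /= linearP.
- by move=> _ _ [x [-> ->]]; rewrite hnorm_subsp.
- move=> z e e0; have /cs_predP/hclosureP/(_ e e0)[_ [x _ <-] h] := subspP z.
  by exists (to_clran A x), (B x); split; [exists x|rewrite hnorm_subsp].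
by exists X => // x; apply: hX; exists x.
Qed.

Lemma clran_ext U V W (A : bop U V) (X Y : bop (subsp (clran A)) W) :
  (forall x, X (to_clran A x) = Y (to_clran A x)) -> X = Y.
Proof.
move=> h; apply: bop_ext => z; apply/eqP; rewrite -subr_eq0; apply/eqP.
rewrite -bopBE; apply/hnorm_eq0/eqP; rewrite eq_le hnorm_ge0 andbT.
apply/ler_addgt0Pr => e e0; rewrite add0r.
have [c c0 hc] := bop_bounded (X - Y); have c1 : 0 < c + 1 by rewrite ltr_wpDl.
have /cs_predP/hclosureP/(_ _ (divr_gt0 e0 c1))[_ [x _ <-] d] := subspP z.
have h0 : (X - Y) (to_clran A x) = 0.
  by change (X (to_clran A x) - Y (to_clran A x) = 0); rewrite h subrr.
have := hc (z - to_clran A x); rewrite linearB [X in _ - X]h0 subr0 hnorm_subsp => /le_trans; apply.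
have : hnorm (subsp_val z - A x) * (c + 1) < e by rewrite -ltr_pdivlMr.
have := hnorm_ge0 (subsp_val z - A x); rewrite /=; nra.
Qed.

End Subspaces.

(** * Square roots of defects and inverses *)

Section SquareRoot.
Variables (R : realType).
Local Notation C := R[i]%C.
Implicit Types V W : hilbertType R.

Definition contraction V W (A : bop V W) := forall x, hnorm (A x) <= hnorm x.

(** Iterating [Y |-> (A + Y^2) / 2] from [0] converges, for a contraction [A], to
    an operator [Y] with [(1 - Y)^2 = 1 - A]. *)
Fixpoint root_iter V (A : bop V V) (k : nat) : bop V V :=
  if k is j.+1 then (2^-1 : R)%:C%C *: (A + bcomp (root_iter A j) (root_iter A j)) else 0.

(** The iteration for [A = 1], which dominates the iteration for every contraction. *)
Fixpoint scalar_iter (k : nat) : R :=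
  if k is j.+1 then (1 + scalar_iter j ^+ 2) / 2 else 0.

Lemma scalar_iter01 k : 0 <= scalar_iter k <= 1.
Proof. by elim: k => [|k IH] /=; rewrite ?lexx ?ler01//; nra. Qed.

Lemma scalar_iter_nd : nondecreasing_seq scalar_iter.
Proof. by apply/nondecreasing_seqP => k /=; have := scalar_iter01 k; nra. Qed.

Arguments scalar_iter_nd : clear implicits.

Lemma root_iter0 V (A : bop V V) x : root_iter A 0 x = 0. Proof. by []. Qed.
Lemma root_iterS V (A : bop V V) k x : root_iter A k.+1 x =
  (2^-1 : R)%:C%C *: (A x + root_iter A k (root_iter A k x)).
Proof. by []. Qed.

Lemma root_iter_bound V (A : bop V V) : contraction A ->
  forall k x, hnorm (root_iter A k x) <= scalar_iter k * hnorm x.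
Proof.
move=> cA; elim=> [|k IH] x; first by rewrite root_iter0 hnorm0 mul0r.
rewrite root_iterS hnormZr gtr0_norm ?invr_gt0//=.
have := hnormD (A x) (root_iter A k (root_iter A k x)).
have := cA x; have := IH x; have := IH (root_iter A k x); have := scalar_iter01 k.
have := hnorm_ge0 x; have := hnorm_ge0 (root_iter A k x); nra.
Qed.

Lemma root_iter_diff V (A : bop V V) : contraction A -> forall k x,
  hnorm (root_iter A k.+1 x - root_iter A k x)
    <= (scalar_iter k.+1 - scalar_iter k) * hnorm x.
Proof.
move=> cA; elim=> [|k IH] x.
  rewrite root_iterS !root_iter0 subr0 addr0 hnormZr gtr0_norm ?invr_gt0//=.
  by rewrite subr0 expr2 mulr0 addr0; have := cA x; have := hnorm_ge0 x; lra.
rewrite root_iterS [X in _ - X]root_iterS.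
set Y := root_iter A k.+1 in IH *; set Z := root_iter A k in IH *.
rewrite -scalerBr opprD addrACA subrr add0r hnormZr gtr0_norm ?invr_gt0//.
have -> : Y (Y x) - Z (Z x) = (Y (Y x) - Z (Y x)) + Z (Y x - Z x).
  by rewrite linearB/= addrA subrK.
have := hnormD (Y (Y x) - Z (Y x)) (Z (Y x - Z x)).
have := IH (Y x); have := root_iter_bound cA k (Y x - Z x); rewrite -/Z.
have := IH x; have := root_iter_bound cA k.+1 x; rewrite -/Y.
have := scalar_iter_nd k.+1 k.+2 (leqnSn k.+1); have := scalar_iter_nd k k.+1 (leqnSn k).
have -> : scalar_iter k.+2 - scalar_iter k.+1 =
  (scalar_iter k.+1 ^+ 2 - scalar_iter k ^+ 2) / 2 by rewrite /=; field.
have := scalar_iter01 k; have := scalar_iter01 k.+1.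
move: (scalar_iter k) (scalar_iter k.+1) => s t.
move: (hnorm _) (hnorm _) (hnorm _) (hnorm_ge0 x) (hnorm_ge0 (Y x)) (hnorm_ge0 (Y x - Z x)).
move: (hnorm x) (hnorm (Y x)) (hnorm (Y x - Z x)) => *; nra.
Qed.

Definition root_defect V (A : bop V V) : bop V V :=
  xget 0 [set L : bop V V | forall x, root_iter A k x @[k --> \oo] --> L x].

Lemma root_defectP V (A : bop V V) : contraction A ->
  forall x, root_iter A k x @[k --> \oo] --> root_defect A x.
Proof.
move=> cA; have [L hL _] := bop_cauchy scalar_iter_nd
  (fun k => (andP (scalar_iter01 k)).2) (root_iter_diff cA).
exact: (xgetPex 0 (ex_intro (fun L : bop V V => forall x, root_iter A k x @[k --> \oo] --> L x) L hL)).
Qed.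

Arguments root_defectP {V A} cA x.

Lemma root_defect_bound V (A : bop V V) : contraction A -> contraction (root_defect A).
Proof.
move=> cA x; apply: (hnorm_limit_le (root_defectP cA x)).
apply: nearW => k; apply: le_trans (root_iter_bound cA k x) _.
by have := scalar_iter01 k; have := hnorm_ge0 x; nra.
Qed.

Lemma root_defect_comm V W (A : bop V V) (B : bop W W) (X : bop V W) :
  contraction A -> contraction B -> bcomp X A = bcomp B X ->
  bcomp X (root_defect A) = bcomp (root_defect B) X.
Proof.
move=> cA cB XAB.
have XABE z : X (A z) = B (X z) := congr1 (fun Y : bop V W => Y z) XAB.
have it k x : X (root_iter A k x) = root_iter B k (X x).
  elim: k x => [|k IH] x; first by rewrite !root_iter0 linear0.
  by rewrite !root_iterS linearZ/= linearD/= XABE !IH.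
apply: bop_ext => x /=.
have h : (fun k => X (root_iter A k x)) @ \oo --> X (root_defect A x).
  by apply: bop_cvg; exact: root_defectP.
apply: (hcvg_unique h).
have -> : (fun k => X (root_iter A k x)) = (fun k => root_iter B k (X x)).
  by apply/funext => k; exact: it.
exact: root_defectP.
Qed.

Lemma root_defect_adj V (A : bop V V) : contraction A -> adj A = A ->
  adj (root_defect A) = root_defect A.
Proof.
move=> cA sA; apply: adj_uniq => x y.
have it k z t : rin (root_iter A k z) t = rin z (root_iter A k t).
  elim: k z t => [|k IH] z t; first by rewrite !root_iter0 rin0l rin0r.
  by rewrite !root_iterS !rinE rin_adj sA !IH.
have h1 : (fun k => rin (root_iter A k x) y) @ \oo --> rin (root_defect A x) y.
  by apply: hcvg_rin; exact: root_defectP.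
have h2 : (fun k => rin (root_iter A k x) y) @ \oo --> rin x (root_defect A y).
  under eq_fun do rewrite it rinC; rewrite rinC.
  by apply: hcvg_rin; exact: root_defectP.
exact: (cvg_unique (@Rhausdorff R) h1 h2).
Qed.

Lemma root_defect_eq V (A : bop V V) : contraction A -> forall x,
  (2 : R)%:C%C *: root_defect A x = A x + root_defect A (root_defect A x).
Proof.
move=> cA x; set Y := root_defect A.
have h1 : (fun k => A x + root_iter A k (root_iter A k x)) @ \oo --> A x + Y (Y x).
  apply: hcvgD; first exact: cvg_cst.
  have -> : (fun k => root_iter A k (root_iter A k x)) =
    (fun k => root_iter A k (root_iter A k x - Y x) + root_iter A k (Y x)).
    by apply/funext => k; rewrite linearB/= subrK.
  rewrite -[X in _ --> X]add0r; apply: hcvgD; last exact: root_defectP.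
  apply/hcvgP => e e0.
  move: (root_defectP cA x) => /hcvgP/(_ _ e0); apply: filterS => k.
  rewrite sub0r hnormN hdistC; apply: le_lt_trans.
  apply: le_trans (root_iter_bound cA _ _) _.
  by have := scalar_iter01 k; have := hnorm_ge0 (root_iter A k x - Y x); nra.
have h2 : (fun k => (2 : R)%:C%C *: root_iter A k.+1 x) @ \oo --> (2 : R)%:C%C *: Y x.
  apply: hcvgZ.
  have := root_defectP cA x.
  by rewrite -(cvg_shiftS (fun k => root_iter A k x)).
apply: (hcvg_unique h2).
have -> // : (fun k => (2 : R)%:C%C *: root_iter A k.+1 x) =
  (fun k => A x + root_iter A k (root_iter A k x)).
by apply/funext => k; rewrite root_iterS scalerA -rmorphM/= mulfV ?pnatr_eq0// scale1r.
Qed.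

(** A complex form that is real on the diagonal is symmetric. *)
Lemma inner_ge0P V (S : bop V V) : (forall x, 0 <= inner (S x) x) ->
  adj S = S /\ forall x, 0 <= rin (S x) x.
Proof.
move=> S0; have re x : 0 <= rin (S x) x.
  by have := S0 x; rewrite lecE => /andP[].
have im x : complex.Im (inner (S x) x) = 0.
  by have := S0 x; rewrite lecE => /andP[/eqP].
have h x y : complex.Im (inner (S x) y) = complex.Im (inner x (S y)).
  have := im (x + y); rewrite linearD/= innerDl !innerDr !raddfD/= !im add0r addr0.
  rewrite (innerC (S y) x); case: (inner (S x) y) (inner x (S y)) => a b [c d] /=.
  by case: (inner (S y) x) => e f /=; lra.
split => //; apply: adj_uniq => x y.
have := h x ('i%C *: y); rewrite linearZ/= !innerZr /rin.
case: (inner (S x) y) (inner x (S y)) => a b [c d] /=.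
lra.
Qed.

(** Positivity of the form at [z + t S z], for small negative [t], forces [S z = 0]. *)
Lemma rin_pos_eq0 V (S : bop V V) z : adj S = S -> (forall x, 0 <= rin (S x) x) ->
  rin (S z) z = 0 -> S z = 0.
Proof.
move=> sS S0 z0; apply/hnorm_eq0/eqP; rewrite -sqrf_eq0 -rinn; apply/eqP.
have key (t : R) : 0 <= t * rin (S z) (S z) *+ 2 + t ^+ 2 * rin (S (S z)) (S z).
  have := S0 (z + t%:C%C *: S z); rewrite linearD linearZ/= !rinE z0.
  by rewrite (rin_adj (S) (S z) z) sS expr2 mulr2n; lra.
set a := rin (S z) (S z) in key *; set b := rin _ _ in key.
have a0 : 0 <= a by rewrite /a rinn sqr_ge0.
have b0 : 0 <= b by exact: S0.
have b1 : 0 < b + 1 by lra.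
have := key (- a / (b + 1)).
have -> : - a / (b + 1) * a *+ 2 + (- a / (b + 1)) ^+ 2 * b
  = - (a ^+ 2 * ((b + 2) / (b + 1) ^+ 2)).
  by rewrite mulr2n; field; rewrite gt_eqF.
rewrite oppr_ge0 pmulr_lle0; last by rewrite divr_gt0 ?exprn_gt0//; lra.
by move=> c0; apply/eqP; rewrite -sqrf_eq0 eq_le c0 sqr_ge0.
Qed.

Definition positive V (S : bop V V) := adj S = S /\ forall x, 0 <= rin (S x) x.

Section Root.
Variables (V : hilbertType R) (A : bop V V).
Hypotheses (cA : contraction A) (sA : adj A = A).

Let r : bop V V := idop V - root_defect A.

Lemma root_sq : bcomp r r = idop V - A.
Proof.
apply: bop_ext => x; rewrite bcompE /r !bopBE !idopE linearB/=.
have h := root_defect_eq cA x; set Y := root_defect A in h *.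
have -> : Y (Y x) = (2 : R)%:C%C *: Y x - A x by rewrite h addrC addKr.
rewrite (_ : (2:R)%:C%C = 2); last exact: (rmorph_nat (real_complex R) 2).
rewrite scaler_nat mulr2n !opprB !addrA subrK.
by rewrite -!addrA; congr (_ + _); rewrite addrCA subrr addr0.
Qed.

Lemma root_positive : positive r.
Proof.
split; first by rewrite /r adjB adj_id root_defect_adj.
move=> x; rewrite /r bopBE idopE rinBl rinn subr_ge0.
apply: le_trans (rin_le _ _) _; rewrite expr2 ler_wpM2r ?hnorm_ge0//.
exact: root_defect_bound.
Qed.

Lemma root_uniq (S : bop V V) : positive S -> bcomp S S = idop V - A -> S = r.
Proof.
move=> [sS S0] SS; have [sr r0] := root_positive.
have SA : bcomp S A = bcomp A S.
  have -> : A = idop V - bcomp S S by rewrite SS opprB addrC subrK.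
  by apply: bop_ext => x; rewrite !(bcompE, bopBE, idopE) linearB.
have Sr x : S (r x) = r (S x).
  have := congr1 (fun Y : bop V V => Y x) (root_defect_comm cA cA SA).
  by rewrite /r !(bopBE, idopE) linearB/= => ->.
have SSx x : S (S x) = r (r x).
  by have := congr1 (fun Y : bop V V => Y x) (etrans SS (esym root_sq)).
apply: bop_ext => x; apply/eqP; rewrite -subr_eq0; apply/eqP.
set z := S x - r x.
have h : rin (S z) z + rin (r z) z = 0.
  rewrite -rinDl [X in rin X _](_ : _ = 0) ?rin0l//.
  have e1 : S z = r (r x) - r (S x) by rewrite (bopxB S) (SSx x) (Sr x).
  have e2 : r z = r (S x) - r (r x) by rewrite (bopxB r).
  by rewrite e1 e2 addrA subrK subrr.
have Sz : S z = 0 by apply: rin_pos_eq0 => //; have := S0 z; have := r0 z; lra.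
have rz : r z = 0 by apply: rin_pos_eq0 => //; have := S0 z; have := r0 z; lra.
apply/hnorm_eq0/eqP; rewrite -sqrf_eq0 -rinn; apply/eqP.
rewrite {1}/z rinBl rin_adj rin_adj sS sr Sz rz !rin0r subrr//.
Qed.

Lemma opsqrtE : opsqrt (idop V - A) = r.
Proof.
have [sr r0] := root_positive.
have r0' x : 0 <= inner (r x) x.
  rewrite lecE r0 andbT; apply/eqP.
  have : inner (r x) x = (inner (r x) x)^* by rewrite -innerC adjP sr.
  by case: (inner (r x) x) => a b [] /=; lra.
have [S0 SS] := xgetPex 0 (ex_intro [set S : bop V V | (forall x, 0 <= inner (S x) x) /\
   bcomp S S = idop V - A] r (conj r0' root_sq)).
exact: root_uniq (inner_ge0P S0) SS.
Qed.

Lemma opsqrt_positive : positive (opsqrt (idop V - A)).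
Proof. by rewrite opsqrtE; exact: root_positive. Qed.

Lemma opsqrt_sq x : opsqrt (idop V - A) (opsqrt (idop V - A) x) = x - A x.
Proof. by rewrite opsqrtE; have := congr1 (fun Y : bop V V => Y x) root_sq. Qed.

Lemma hnorm_opsqrt x : hnorm (opsqrt (idop V - A) x) ^+ 2 = hnorm x ^+ 2 - rin (A x) x.
Proof.
have [sS _] := opsqrt_positive.
by rewrite -rinn rin_adj sS opsqrt_sq rinBr rinn (rinC x).
Qed.

End Root.

(** The approximations of the root are polynomials in the operator. *)
Lemma opsqrt_comm V W (A : bop V V) (B : bop W W) (X : bop V W) :
  contraction A -> adj A = A -> contraction B -> adj B = B -> bcomp X A = bcomp B X ->
  forall x, X (opsqrt (idop V - A) x) = opsqrt (idop W - B) (X x).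
Proof.
move=> cA sA cB sB h x; rewrite !opsqrtE// !(bopBE, idopE) linearB/=.
by have := congr1 (fun Y : bop V W => Y x) (root_defect_comm cA cB h) => /= ->.
Qed.

End SquareRoot.

Section Neumann.
Variables (R : realType) (V : hilbertType R).
Local Notation C := R[i]%C.

Fixpoint neumann_sum (N : bop V V) (k : nat) : bop V V :=
  if k is j.+1 then idop V + bcomp N (neumann_sum N j) else 0.

Lemma neumann0 (N : bop V V) x : neumann_sum N 0 x = 0. Proof. by []. Qed.
Lemma neumannS (N : bop V V) k x : neumann_sum N k.+1 x = x + N (neumann_sum N k x).
Proof. by []. Qed.

(** A perturbation of the identity by an operator of norm [r < 1] is inverted by
    the geometric series. *)
Lemma neumann (N : bop V V) (r : R) : 0 <= r < 1 -> (forall x, hnorm (N x) <= r * hnorm x) ->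
  exists B : bop V V, bcomp (idop V - N) B = idop V /\ bcomp B (idop V - N) = idop V.
Proof.
move=> /andP[r0 r1] hN.
pose y k := \sum_(j < k) r ^+ j.
have yS k : y k.+1 - y k = r ^+ k by rewrite /y big_ord_recr/= addrAC subrr add0r.
have yn : nondecreasing_seq y.
  by apply/nondecreasing_seqP => k; rewrite -subr_ge0 yS exprn_ge0.
have yM k : y k <= (1 - r)^-1.
  have r1' : 0 < 1 - r by lra.
  rewrite -[leRHS]mul1r ler_pdivlMr//.
  have -> : y k * (1 - r) = 1 - r ^+ k.
    by rewrite -[RHS]opprB subrX1 mulrC -mulNr opprB.
  by rewrite gerBl exprn_ge0.
have [k x|L hL _] := bop_cauchy (A := neumann_sum N) yn yM.
  rewrite yS; elim: k x => [|k IH] x.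
    by rewrite neumannS !neumann0 subr0 linear0 addr0 mul1r.
  rewrite neumannS [X in _ - X]neumannS opprD addrACA subrr add0r -linearB/= exprS -mulrA.
  apply: le_trans (hN _) _; rewrite ler_wpM2l//; exact: IH.
have comm k x : N (neumann_sum N k x) = neumann_sum N k (N x).
  elim: k x => [|k IH] x; first by rewrite !neumann0 linear0.
  by rewrite !neumannS linearD/= IH.
have LE x : L x = x + N (L x).
  apply: (hcvg_unique (F := \oo) (u := fun k => neumann_sum N k.+1 x)).
    by have := hL x; rewrite -(cvg_shiftS (fun k => neumann_sum N k x)).
  apply: hcvgD; first exact: cvg_cst.
  exact: bop_cvg.
have LN x : N (L x) = L (N x).
  have h : (fun k => N (neumann_sum N k x)) @ \oo --> N (L x).
    by apply: bop_cvg; exact: hL.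
  apply: (hcvg_unique h).
  have -> : (fun k => N (neumann_sum N k x)) = (fun k => neumann_sum N k (N x)).
    by apply/funext => k; exact: comm.
  exact: hL.
exists L; split; apply: bop_ext => x.
  by rewrite bcompE bopBE !idopE {1}LE addrK.
by rewrite bcompE bopBE !idopE bopxB -LN {1}LE addrK.
Qed.

Lemma opinvP (A B : bop V V) : bcomp A B = idop V -> bcomp B A = idop V ->
  bcomp A (opinv A) = idop V /\ bcomp (opinv A) A = idop V.
Proof.
move=> h1 h2.
exact: (xgetPex 0 (ex_intro [set B | bcomp A B = idop V /\ bcomp B A = idop V] B (conj h1 h2))).
Qed.

End Neumann.

(** * Square summable families *)

Section FiniteSums.
Variables (R : realType) (I : countType).
Local Notation C := R[i]%C.
Implicit Types u : I -> C.

Lemma series_cterm u N :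
  series (cterm u) N = \sum_(i <- pmap (@pickle_inv I) (iota 0 N)) u i.
Proof.
rewrite /series/= /index_iota subn0; elim: (iota 0 N) => [|k s IH].
  by rewrite !big_nil.
by rewrite big_cons IH /= /cterm; case: pickle_inv => [i|] /=; rewrite ?big_cons ?add0r.
Qed.

(** A sum of nonnegative terms is the supremum of its finite partial sums,
    independently of the enumeration of the index type. *)
Lemma csum_fin_bound u (M : C) : (forall i, 0 <= u i) ->
  (forall s, uniq s -> \sum_(i <- s) u i <= M) -> csummable u /\ csum u <= M.
Proof.
move=> u0 uM; apply: Cseries_bounded => [|N]; first exact: cterm_ge0.
rewrite series_cterm; apply: uM; apply: (pmap_uniq (@pickle_invK I)).
exact: iota_uniq.
Qed.

Lemma csum_fin_le u s : (forall i, 0 <= u i) -> csummable u -> uniq s ->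
  \sum_(i <- s) u i <= csum u.
Proof.
move=> u0 su us; pose N := (\max_(i <- s) pickle i).+1.
apply: le_trans (Cseries_le_lim N (cterm_ge0 u0) su).
rewrite series_cterm.
set L := pmap _ _; rewrite [leRHS](bigID (mem s))/=.
have -> : \sum_(i <- s) u i = \sum_(i <- L | i \in s) u i; last first.
  by rewrite lerDl; apply: sumr_ge0.
rewrite -[RHS]big_filter; apply: perm_big; rewrite perm_sym.
apply: uniq_perm => //.
  by apply: filter_uniq; apply: (pmap_uniq (@pickle_invK I)); exact: iota_uniq.
move=> i; rewrite mem_filter mem_pmap; case si: (i \in s); rewrite ?andbF ?andTb//.
apply/mapP; exists (pickle i); last by rewrite pickleK_inv.
by rewrite mem_iota/= add0n ltnS; apply: leq_bigmax_seq.
Qed.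

Lemma csum_single u i : (forall j, j != i -> u j = 0) -> csum u = u i.
Proof.
move=> h; apply: cvg_lim; first exact: (@norm_hausdorff _ _).
apply: cvg_near_cst; exists (pickle i).+1 => // N /= Ni.
have -> : series (cterm u) N = \sum_(0 <= k < N) (if k == pickle i then u i else 0).
  apply: eq_bigr => k _; rewrite /cterm.
  case: eqP => [->|ki]; first by rewrite pickleK_inv.
  case E: (pickle_inv k) => [j|] //=; apply: h; apply/eqP => ji; apply: ki.
  by have := @pickle_invK I k; rewrite E/= ji.
by rewrite -big_mkcond/= big_nat1_eq Ni.
Qed.

End FiniteSums.

Section Ell2.
Variables (R : realType).
Local Notation C := R[i]%C.
Implicit Types (I J : countType) (U V W : hilbertType R).

Lemma ell2P_ext I V (x y : ell2 I V) : (forall i, x i = y i) -> x = y.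
Proof. by move=> h; apply/val_inj/funext. Qed.

Lemma ell2DE I V (x y : ell2 I V) i : (x + y) i = x i + y i. Proof. by []. Qed.
Lemma ell2NE I V (x : ell2 I V) i : (- x) i = - x i. Proof. by []. Qed.
Lemma ell2ZE I V (a : C) (x : ell2 I V) i : (a *: x) i = a *: x i. Proof. by []. Qed.
Lemma ell20E I V i : (0 : ell2 I V) i = 0. Proof. by []. Qed.
Lemma ell2_sumE I V (T : Type) (s : seq T) (P : pred T) (F : T -> ell2 I V) i :
  (\sum_(t <- s | P t) F t) i = \sum_(t <- s | P t) F t i.
Proof. by elim/big_rec2: _ => [//|t y1 y2 _ <-]. Qed.

Lemma sq_cmp (V : hilbertType R) (v : V) : `|v| ^+ 2 = (hnorm v ^+ 2)%:C%C.
Proof. by rewrite hnormE rmorphXn. Qed.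

Lemma ell2_fin_le I V (x : ell2 I V) s : uniq s ->
  \sum_(i <- s) hnorm (x i) ^+ 2 <= hnorm x ^+ 2.
Proof.
move=> us; rewrite -lecR -sq_cmp -inner_norm [inner x x]ell2_inner_sq rmorph_sum/=.
under eq_bigr do rewrite -sq_cmp.
apply: csum_fin_le us; last exact: ell2_sq.
by move=> i; exact: exprn_ge0.
Qed.

Lemma ell2_mk I V (f : I -> V) (M : R) :
  (forall s, uniq s -> \sum_(i <- s) hnorm (f i) ^+ 2 <= M) ->
  exists2 x : ell2 I V, (forall i, x i = f i) & hnorm x ^+ 2 <= M.
Proof.
move=> h.
have [s1 s2] : csummable (fun i => `|f i| ^+ 2 : C) /\ csum (fun i => `|f i| ^+ 2 : C) <= M%:C%C.
  apply: csum_fin_bound => [i|s us]; first exact: exprn_ge0.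
  under eq_bigr do rewrite sq_cmp.
  by rewrite -rmorph_sum/= lecR h.
have fP : f \in @square_summable R I V by apply/square_summableP.
exists (Ell2 fP) => //.
by rewrite -lecR -sq_cmp -inner_norm [inner _ _]ell2_inner_sq.
Qed.

Lemma ell2_fin_bound I V (x : ell2 I V) M :
  (forall s, uniq s -> \sum_(i <- s) hnorm (x i) ^+ 2 <= M) -> hnorm x ^+ 2 <= M.
Proof. by move=> /ell2_mk[y yx]; rewrite (@ell2P_ext _ _ y x). Qed.

(** Operators into [ell2 J W] are given by their coordinates; the default value
    disappears under the hypotheses of [mkopP]. *)
Definition mkop U J W (f : U -> J -> W) : bop U (ell2 J W) :=
  xget 0 [set A : bop U (ell2 J W) | forall x j, A x j = f x j].

Lemma mkop_uniq U J W (f : U -> J -> W) (A : bop U (ell2 J W)) :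
  (forall x j, A x j = f x j) -> mkop f = A.
Proof.
move=> h; apply: bop_ext => x; apply: ell2P_ext => j; rewrite h.
exact: (xgetPex 0 (ex_intro [set A : bop U (ell2 J W) | forall x j, A x j = f x j] A h)).
Qed.

Lemma mkopP U J W (f : U -> J -> W) (c : R) : 0 <= c ->
  (forall j (a : C) x y, f (a *: x + y) j = a *: f x j + f y j) ->
  (forall x s, uniq s -> \sum_(j <- s) hnorm (f x j) ^+ 2 <= c ^+ 2 * hnorm x ^+ 2) ->
  (forall x j, mkop f x j = f x j) /\ forall x, hnorm (mkop f x) <= c * hnorm x.
Proof.
move=> c0 lf bf.
have /choice[g gP] : forall x, exists y : ell2 J W, (forall j, y j = f x j) /\
    hnorm y ^+ 2 <= c ^+ 2 * hnorm x ^+ 2.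
  by move=> x; have [y h1 h2] := ell2_mk (bf x); exists y.
have bg x : hnorm (g x) <= c * hnorm x.
  by rewrite -hnorm_le_sq ?mulr_ge0 ?hnorm_ge0// exprMn (gP x).2.
have [|A hA] := @bop_mk _ _ _ g c _ bg.
  move=> a x y; apply: ell2P_ext => j.
  by rewrite ell2DE ell2ZE !(gP _).1 lf.
have -> : mkop f = A by apply: mkop_uniq => x j; rewrite hA (gP x).1.
by split => x; [move=> j; rewrite hA (gP x).1|rewrite hA].
Qed.

Definition emb I V (i : I) : bop V (ell2 I V) := mkop (fun v j => if j == i then v else 0).

Lemma embE I V (i : I) (v : V) j : emb V i v j = if j == i then v else 0.
Proof.
have [|||h _] := @mkopP V I V (fun v j => if j == i then v else 0) 1.
- by [].
- by move=> k a x y; case: ifP => _ //; rewrite scaler0 addr0.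
- move=> x s us; rewrite expr1n mul1r.
  have -> : \sum_(j <- s) hnorm (if j == i then x else 0) ^+ 2 =
    \sum_(j <- s | j == i) hnorm x ^+ 2.
    rewrite [RHS]big_mkcond; apply: eq_bigr => k _; case: ifP => // _.
    by rewrite hnorm0 expr0n.
  rewrite -big_filter; case si: (i \in s).
    by rewrite filter_pred1_uniq// big_seq1.
  rewrite big_filter big_seq_cond big_pred0 ?sqr_ge0// => k.
  by case: eqP => [->|]; rewrite ?si ?andbF.
- exact: h.
Qed.

Lemma embii I V (i : I) (v : V) : emb V i v i = v.
Proof. by rewrite embE eqxx. Qed.

Lemma coordE I V (i : I) (x : ell2 I V) : coord V i x = x i. Proof. by []. Qed.

Lemma inner_emb I V (i : I) v (x : ell2 I V) : inner (emb V i v) x = inner v (x i).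
Proof.
have -> : inner (emb V i v) x = csum (fun j => inner (emb V i v j) (x j)) by [].
rewrite (@csum_single _ _ _ i) ?embii// => j ji.
by rewrite embE (negbTE ji) inner0l.
Qed.

Lemma inner_emb' I V (i : I) v (x : ell2 I V) : inner x (emb V i v) = inner (x i) v.
Proof. by rewrite innerC inner_emb -innerC. Qed.

Lemma rin_emb I V (i : I) v (x : ell2 I V) : rin (emb V i v) x = rin v (x i).
Proof. by rewrite /rin inner_emb. Qed.

Lemma rin_emb' I V (i : I) v (x : ell2 I V) : rin x (emb V i v) = rin (x i) v.
Proof. by rewrite rinC rin_emb rinC. Qed.

Lemma hnorm_emb I V (i : I) (v : V) : hnorm (emb V i v) = hnorm v.
Proof.
by apply/eqP; rewrite -(@eqrXn2 _ 2)// ?hnorm_ge0// -!rinn rin_emb embii.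
Qed.

(** The vectors [emb i v] span a dense subspace: two operators that agree on them
    have adjoints with the same coordinates. *)
Lemma ell2_ext I V W (A B : bop (ell2 I V) W) :
  (forall i v, A (emb V i v) = B (emb V i v)) -> A = B.
Proof.
move=> h; rewrite -[A]adjK -[B]adjK; congr (adj _); apply: bop_ext => y.
apply: ell2P_ext => i; apply: inner_inj => v.
by rewrite -!inner_emb -!adjP h.
Qed.

Lemma dense_linear V (D : set V) : D 0 ->
  (forall (a : C) x y, D x -> D y -> D (a *: x + y)) ->
  (forall x, (forall y, D y -> inner x y = 0) -> x = 0) ->
  forall x (e : R), 0 < e -> exists2 y, D y & hnorm (x - y) < e.
Proof.
move=> D0 Dl Dp.
have cl0 : closure D 0 by exact: subset_closure.
have cll (a : C) x y : closure D x -> closure D y -> closure D (a *: x + y).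
  move=> /hclosureP Dx /hclosureP Dy; apply/hclosureP => e e0.
  have a0 : 0 < hnorm a + 1 by rewrite ltr_wpDl ?hnorm_ge0.
  have e2 : 0 < e / 2 by rewrite divr_gt0.
  have [x' Dx' hx] := Dx _ (divr_gt0 e2 a0); have [y' Dy' hy] := Dy _ e2.
  exists (a *: x' + y'); first exact: Dl.
  rewrite opprD addrACA -scalerBr; apply: le_lt_trans (hnormD _ _) _.
  rewrite (splitr e) ler_ltD// hnormZ.
  have : hnorm (x - x') * (hnorm a + 1) < e / 2 by rewrite -ltr_pdivlMr.
  have := hnorm_ge0 (x - x'); nra.
pose K := ClosedSubspace cl0 cll (@closed_closure _ D).
move=> x e e0; have [p Kp pK] := projection_thm K x.
have xp : x - p = 0.
  by apply: Dp => y Dy; apply: pK; exact: subset_closure.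
have /hclosureP/(_ e e0) := Kp.
by have /eqP := xp; rewrite subr_eq0 => /eqP <-.
Qed.

Lemma cs_total V (S : closed_subspace V) :
  (forall x, (forall y, cs_set S y -> inner x y = 0) -> x = 0) -> forall x, cs_set S x.
Proof.
move=> h x; have [p Sp pS] := projection_thm S x.
by have /eqP := h _ pS; rewrite subr_eq0 => /eqP ->.
Qed.

Lemma ell2_total I V (S : closed_subspace (ell2 I V)) :
  (forall i v, cs_set S (emb V i v)) -> forall x, cs_set S x.
Proof.
move=> h; apply: cs_total => x hx; apply: ell2P_ext => i.
apply: inner_inj => v; rewrite -inner_emb inner0r innerC hx ?rmorph0//.
Qed.

Definition ampl I V W (B : bop V W) : bop (ell2 I V) (ell2 I W) := mkop (fun (x : ell2 I V) i => B (x i)).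

Lemma amplP I V W (B : bop V W) c : 0 <= c -> (forall x, hnorm (B x) <= c * hnorm x) ->
  (forall (x : ell2 I V) i, ampl I B x i = B (x i)) /\
  forall x, hnorm (ampl I B x) <= c * hnorm x.
Proof.
move=> c0 hc; apply: mkopP => // [i a x y|x s us].
  by rewrite ell2DE ell2ZE bop_linear.
apply: le_trans (_ : \sum_(j <- s) c ^+ 2 * hnorm (x j) ^+ 2 <= _).
  apply: ler_sum => i _; rewrite -exprMn lerXn2r ?nnegrE ?hnorm_ge0 ?mulr_ge0 ?hnorm_ge0//.
by rewrite -mulr_sumr ler_wpM2l ?sqr_ge0// ell2_fin_le.
Qed.

Lemma amplE I V W (B : bop V W) (x : ell2 I V) i : ampl I B x i = B (x i).
Proof. by have [c c0 hc] := bop_bounded B; have [h _] := @amplP I _ _ _ _ c0 hc. Qed.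

Lemma ampl_emb I V W (B : bop V W) i v : ampl I B (emb V i v) = emb W i (B v).
Proof.
by apply: ell2P_ext => j; rewrite amplE !embE; case: ifP => // _; exact: bopx0.
Qed.

Lemma ampl_id I V : ampl I (idop V) = idop _.
Proof. by apply: bop_ext => x; apply: ell2P_ext => i; rewrite amplE. Qed.

Lemma ampl_adj I V W (B : bop V W) : adj (ampl I B) = ampl I (adj B).
Proof.
suff e : adj (ampl I (adj B)) = ampl I B by apply: adj_uniq => x y; rewrite rin_adj' e.
apply: ell2_ext => i v; apply: inner_inj => z.
by rewrite adjP' adjK ampl_emb !inner_emb' amplE adjP'.
Qed.

Section PushPull.
Variables (I J : countType) (V : hilbertType R).

(** The map [psi] sends a new index to the old one that it copies, if any. *)
Definition push (psi : J -> option I) : bop (ell2 I V) (ell2 J V) :=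
  mkop (fun (x : ell2 I V) j => oapp (x : I -> V) 0 (psi j)).

Lemma pushE (psi : J -> option I) x j :
  (forall j j' i, psi j = Some i -> psi j' = Some i -> j = j') ->
  push psi x j = oapp (x : I -> V) 0 (psi j).
Proof.
move=> inj.
have [||h _] := @mkopP (ell2 I V) J V (fun x j => oapp (x : I -> V) 0 (psi j)) 1 ler01.
- by move=> k a y z; case: (psi k) => //=; rewrite scaler0 addr0.
- move=> y s us; rewrite expr1n mul1r.
  have -> : \sum_(k <- s) hnorm (oapp (y : I -> V) 0 (psi k)) ^+ 2 =
      \sum_(i <- pmap psi s) hnorm (y i) ^+ 2.
    elim: s {us} => [|k s IH]; first by rewrite !big_nil.
    rewrite big_cons IH /=; case: (psi k) => [i|] /=; first by rewrite big_cons.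
    by rewrite hnorm0 expr0n add0r.
  apply: ell2_fin_le; elim: s us => [//|k s IH] /= /andP[ks /IH us].
  case E: (psi k) => [i|] //=; rewrite us andbT mem_pmap; apply/negP => /mapP[k' k's E'].
  by move: ks; rewrite (inj _ _ _ E (esym E')) k's.
- exact: h.
Qed.

End PushPull.

Lemma inner_ptens I V (c d : ell2 I C) (v w : V) :
  inner (ptens c v) (ptens d w) = inner c d * inner v w.
Proof.
have -> : inner (ptens c v) (ptens d w) = csum (fun i => inner v w * inner (c i) (d i)).
  congr csum; apply/funext => i; rewrite /= innerZl innerZr.
  by rewrite mulrA mulrC; congr (_ * _); rewrite mulrC.
have [_ ->] := csumZ (inner v w) (ell2_inner_summable c d).
exact: mulrC.
Qed.

Lemma ptensE I V (c : ell2 I C) (v : V) i : ptens c v i = c i *: v. Proof. by []. Qed.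

Lemma emb_ptens I V (i : I) (v : V) : emb V i v = ptens (emb C i 1) v.
Proof.
apply: ell2P_ext => j; rewrite ptensE !embE; case: ifP => _; rewrite ?scale1r//.
by rewrite scale0r.
Qed.

Lemma hnorm_ptens_sq I V (c : ell2 I C) (v : V) :
  hnorm (ptens c v) ^+ 2 = hnorm c ^+ 2 * hnorm v ^+ 2.
Proof.
have h : (hnorm (ptens c v) ^+ 2)%:C%C = (hnorm c ^+ 2 * hnorm v ^+ 2)%:C%C :> C.
  by rewrite -[LHS]sq_cmp -inner_norm inner_ptens !inner_norm !sq_cmp -rmorphM.
exact: (congr1 (@complex.Re R) h).
Qed.

Lemma ptensDl I V (c d : ell2 I C) (v : V) : ptens (c + d) v = ptens c v + ptens d v.
Proof. by apply: ell2P_ext => i; rewrite !ell2DE !ptensE ell2DE scalerDl. Qed.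
Lemma ptensZl I V (a : C) (c : ell2 I C) (v : V) : ptens (a *: c) v = a *: ptens c v.
Proof. by apply: ell2P_ext => i; rewrite !ell2ZE !ptensE ell2ZE scalerA. Qed.
Lemma ptensZr I V (a : C) (c : ell2 I C) (v : V) : ptens c (a *: v) = a *: ptens c v.
Proof. by apply: ell2P_ext => i; rewrite ell2ZE !ptensE !scalerA mulrC. Qed.
Lemma ptensDr I V (c : ell2 I C) (v w : V) : ptens c (v + w) = ptens c v + ptens c w.
Proof. by apply: ell2P_ext => i; rewrite !ell2DE !ptensE scalerDr. Qed.

Lemma ell2_ext_ptens I V W (A B : bop (ell2 I V) W) :
  (forall c v, A (ptens c v) = B (ptens c v)) -> A = B.
Proof. by move=> h; apply: ell2_ext => i v; rewrite emb_ptens h. Qed.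

End Ell2.

(** * Tensor products of operators *)

Section Tensor.
Variables (R : realType) (I : countType).
Local Notation C := R[i]%C.
Implicit Types (U V W : hilbertType R).

(** Splitting off the direction [e] of one of the vectors [v_k] and the
    components of the others along [e] writes a finite sum of elementary tensors
    as an orthogonal sum of one elementary tensor and a shorter sum; applying [A]
    in the first factor respects the splitting, so the norm of [A] bounds the
    whole by induction. *)
Lemma ptens_sum_bound V (A : bop (ell2 I C) (ell2 I C)) (c : R) : 0 <= c ->
  (forall x, hnorm (A x) <= c * hnorm x) -> forall s : seq (ell2 I C * V),
  hnorm (\sum_(p <- s) ptens (A p.1) p.2) ^+ 2 <=
    c ^+ 2 * hnorm (\sum_(p <- s) ptens p.1 p.2) ^+ 2.
Proof.
move=> c0 hA s; move: {2}(size s) (erefl (size s)) => m; elim: m s => [|m IH] s.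
  by move=> /size0nil ->; rewrite !big_nil !hnorm0 expr0n mulr0.
case: s => [//|[a v] s] [sm].
rewrite !big_cons /=.
have [->|v0] := eqVneq v 0.
  have p0 d : ptens d (0 : V) = 0 by apply: ell2P_ext => i; rewrite ptensE scaler0.
  by rewrite !p0 !add0r; exact: IH.
have hv : 0 < hnorm v.
  rewrite lt_neqAle hnorm_ge0 andbT; apply: contraNN v0 => /eqP h.
  by apply/eqP/hnorm_eq0.
pose e := ((hnorm v)^-1)%:C%C *: v.
have ee : inner e e = 1.
  rewrite inner_norm sq_cmp /e hnormZr gtr0_norm ?invr_gt0//.
  by rewrite mulVf ?gt_eqF// expr1n.
have ve : v = (hnorm v)%:C%C *: e.
  by rewrite /e scalerA -rmorphM/= mulfV ?gt_eqF// scale1r.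
pose l (p : ell2 I C * V) := inner p.2 e.
pose s' := [seq (p.1, p.2 - l p *: e) | p <- s].
pose b : ell2 I C := (hnorm v)%:C%C *: a + \sum_(p <- s) l p *: p.1.
have split (B : ell2 I C -> ell2 I C) : linear B ->
   ptens (B a) v + \sum_(p <- s) ptens (B p.1) p.2 =
   ptens (B b) e + \sum_(p <- s') ptens (B p.1) p.2.
  move=> lB.
  have BZ (k : C) x : B (k *: x) = k *: B x.
    have B0 : B 0 = 0.
      by have := lB (-1) 0 0; rewrite scaler0 addr0 scaleN1r addNr.
    by have := lB k x 0; rewrite !addr0 B0 addr0.
  have BD x y : B (x + y) = B x + B y by have := lB 1 x y; rewrite !scale1r.
  have B0 : B 0 = 0 by have := BZ 0 0; rewrite !scale0r.
  rewrite /s' big_map /= {1}ve /b BD BZ ptensDl ptensZl ptensZr -addrA; congr (_ + _).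
  have -> : ptens (B (\sum_(p <- s) l p *: p.1)) e = \sum_(p <- s) ptens (B p.1) (l p *: e).
    elim: (s) => [|p r IHr]; first by rewrite !big_nil B0; apply: ell2P_ext => i; rewrite ptensE scale0r.
    by rewrite !big_cons BD BZ ptensDl ptensZl -ptensZr IHr.
  rewrite -big_split/=; apply: eq_bigr => p _.
  by rewrite -ptensDr addrC subrK.
have orth (B : ell2 I C -> ell2 I C) d :
   rin (ptens d e) (\sum_(p <- s') ptens (B p.1) p.2) = 0.
  rewrite /s' big_map /=; elim: (s) => [|p r IHr]; first by rewrite big_nil rin0r.
  rewrite big_cons rinDr IHr addr0 /rin inner_ptens innerDr innerNr innerZr ee mulr1.
  by rewrite /l -innerC subrr mulr0.
have := split A (@bop_linear _ _ _ A); have := split id (fun _ _ _ => erefl).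
move=> /= -> ->; rewrite !hnormDsq (orth A) (orth id) !mul0rn !addr0 mulrDr.
apply: lerD; last by apply: IH; rewrite size_map.
rewrite (hnorm_ptens_sq (A b)) (hnorm_ptens_sq b) mulrA ler_wpM2r ?sqr_ge0//.
have := hA b; clearbody b => hb.
by rewrite -exprMn lerXn2r ?nnegrE ?hnorm_ge0 ?mulr_ge0 ?hnorm_ge0.
Qed.

Lemma tens_id_exists V (A : bop (ell2 I C) (ell2 I C)) (c : R) : 0 <= c ->
  (forall x, hnorm (A x) <= c * hnorm x) ->
  exists2 T : bop (ell2 I V) (ell2 I V), (forall d v, T (ptens d v) = ptens (A d) v)
    & forall x, hnorm (T x) <= c * hnorm x.
Proof.
move=> c0 hA.
pose P (x z : ell2 I V) := exists s : seq (ell2 I C * V),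
  x = \sum_(p <- s) ptens p.1 p.2 /\ z = \sum_(p <- s) ptens (A p.1) p.2.
have Plin (a : C) x y x' y' : P x y -> P x' y' -> P (a *: x + x') (a *: y + y').
  move=> [s [-> ->]] [s' [-> ->]].
  exists ([seq (a *: p.1, p.2) | p <- s] ++ s').
  rewrite !big_cat !big_map !scaler_sumr /=; split; congr (_ + _);
    by apply: eq_bigr => p _; rewrite ?bopxZ ptensZl.
have [||||T hT bT] := @bop_extend _ _ _ P c.
- by [].
- exact: Plin.
- move=> x z [s [-> ->]].
  rewrite -hnorm_le_sq ?mulr_ge0 ?hnorm_ge0// exprMn; exact: ptens_sum_bound.
- move=> x e e0.
  have [|||y [z Py] h] := @dense_linear _ _ [set x | exists z, P x z] _ _ _ x e e0.
  + by exists 0, [::]; rewrite !big_nil.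
  + by move=> a x1 x2 [z1 P1] [z2 P2]; exists (a *: z1 + z2); exact: Plin.
  + move=> y hy; apply: ell2P_ext => i; apply: inner_inj => v; rewrite inner0r.
    rewrite -inner_emb innerC hy ?rmorph0// emb_ptens; exists (ptens (A (emb C i 1)) v).
    by exists [:: (emb C i 1, v)]; rewrite !big_seq1.
  by exists y, z.
exists T => // d v; apply: hT; exists [:: (d, v)]; by rewrite !big_seq1.
Qed.

Lemma ampl_ptens V W (B : bop V W) (c : ell2 I C) v : ampl I B (ptens c v) = ptens c (B v).
Proof. by apply: ell2P_ext => i; rewrite amplE !ptensE bopxZ. Qed.

Lemma tensE V W (A : bop (ell2 I C) (ell2 I C)) (B : bop V W) c v :
  tens A B (ptens c v) = ptens (A c) (B v).
Proof.
have [k k0 hk] := bop_bounded A; have [T hT _] := tens_id_exists W k0 hk.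
have ex : [set T : bop (ell2 I V) (ell2 I W) | forall c v, T (ptens c v) = ptens (A c) (B v)]
    (bcomp T (ampl I B)).
  by move=> d w /=; rewrite ampl_ptens hT.
exact: (xgetPex 0 (ex_intro _ _ ex)).
Qed.

Lemma tens_uniq V W (A : bop (ell2 I C) (ell2 I C)) (B : bop V W)
  (T : bop (ell2 I V) (ell2 I W)) : (forall c v, T (ptens c v) = ptens (A c) (B v)) -> tens A B = T.
Proof. by move=> h; apply: ell2_ext_ptens => c v; rewrite tensE h. Qed.

Lemma tens_idop V W (B : bop V W) : tens (idop (ell2 I C)) B = ampl I B.
Proof. by apply: tens_uniq => c v; rewrite ampl_ptens. Qed.

Lemma tens_comp U V W (A A' : bop (ell2 I C) (ell2 I C)) (B : bop V W) (B' : bop U V) :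
  bcomp (tens A B) (tens A' B') = tens (bcomp A A') (bcomp B B').
Proof. by apply/esym/tens_uniq => c v; rewrite bcompE !tensE. Qed.

Lemma tens_bound V (A : bop (ell2 I C) (ell2 I C)) (c : R) : 0 <= c ->
  (forall x, hnorm (A x) <= c * hnorm x) ->
  forall x, hnorm (tens A (idop V) x) <= c * hnorm x.
Proof.
move=> c0 hA; have [T hT bT] := tens_id_exists V c0 hA.
by rewrite (@tens_uniq _ _ A (idop V) T).
Qed.

Lemma tens_adj V W (A : bop (ell2 I C) (ell2 I C)) (B : bop V W) :
  adj (tens A B) = tens (adj A) (adj B).
Proof.
rewrite -[RHS]adjK; congr (adj _); apply: tens_uniq => c v.
apply: ell2P_ext => i; apply: inner_inj => w.
rewrite -!inner_emb adjP' adjK emb_ptens tensE !inner_ptens.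
by rewrite -!adjP'.
Qed.

End Tensor.

Section FiniteDirectSum.
Variables (R : realType) (n : nat).
Local Notation C := R[i]%C.
Implicit Types (V W : hilbertType R).

Lemma ell2_ord_sum V (x : ell2 'I_n V) : x = \sum_i emb V i (x i).
Proof.
apply: ell2P_ext => i; rewrite ell2_sumE (bigD1 i)//= embii big1 ?addr0// => j ji.
by rewrite embE eq_sym (negbTE ji).
Qed.

Lemma rin_ord V (x y : ell2 'I_n V) : rin x y = \sum_i rin (x i) (y i).
Proof.
rewrite {1}(ell2_ord_sum x).
have -> (I : Type) (s : seq I) (F : I -> ell2 'I_n V) :
    rin (\sum_(i <- s) F i) y = \sum_(i <- s) rin (F i) y.
  by elim/big_rec2: _ => [|i z1 z2 _ <-]; rewrite ?rin0l ?rinDl.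
by apply: eq_bigr => i _; rewrite rin_emb.
Qed.

Lemma hnorm_ord V (x : ell2 'I_n V) : hnorm x ^+ 2 = \sum_i hnorm (x i) ^+ 2.
Proof. by rewrite -rinn rin_ord; apply: eq_bigr => i _; rewrite rinn. Qed.

Lemma row_opE V W (F : 'I_n -> bop V W) x : row_op F x = \sum_i F i (x i).
Proof. by rewrite /row_op bop_sumE. Qed.

Lemma row_op_emb V W (F : 'I_n -> bop V W) i v : row_op F (emb V i v) = F i v.
Proof.
rewrite row_opE (bigD1 i)//= embii big1 ?addr0// => j ji.
by rewrite embE (negbTE ji) bopx0.
Qed.

Lemma adj_row_op V W (F : 'I_n -> bop V W) h i : adj (row_op F) h i = adj (F i) h.
Proof.
by apply: inner_inj => v; rewrite -inner_emb -(adjP (row_op F)) row_op_emb adjP.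
Qed.

Lemma row_op_adj V W (F : 'I_n -> bop V W) :
  bcomp (row_op F) (adj (row_op F)) = \sum_i bcomp (F i) (adj (F i)).
Proof.
apply: bop_ext => h; rewrite bcompE row_opE bop_sumE; apply: eq_bigr => i _.
by rewrite adj_row_op.
Qed.

End FiniteDirectSum.

(** * Words, truncations and dilations *)

Section Words.
Variables (n : nat).

Fixpoint words_lt (N : nat) : seq (word n) :=
  if N is k.+1 then words_lt k ++ [seq tval a | a <- enum {: k.-tuple 'I_n}] else [::].

Lemma mem_words_lt N w : (w \in words_lt N) = (size w < N)%N.
Proof.
elim: N => [|N IH] //=; rewrite mem_cat IH ltnS [RHS]leq_eqVlt orbC; congr (_ || _).
apply/mapP/eqP => [[a _ ->]|sw]; first exact: size_tuple.
by exists (tcast sw (in_tuple w)); rewrite ?mem_enum// val_tcast.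
Qed.

Lemma words_lt_uniq N : uniq (words_lt N).
Proof.
elim: N => [|N IH] //=; rewrite cat_uniq IH map_inj_uniq ?enum_uniq ?andbT//; last exact: val_inj.
apply/hasPn => w /mapP[a _ ->]; rewrite mem_words_lt size_tuple ltnn//.
Qed.

Lemma sum_words_lt (M : nmodType) (G : word n -> M) N :
  \sum_(w <- words_lt N) G w = \sum_(k < N) \sum_(a : k.-tuple 'I_n) G a.
Proof.
elim: N => [|N IH] /=; first by rewrite big_nil big_ord0.
by rewrite big_cat big_ord_recr IH/= big_map big_enum.
Qed.

Lemma sum_tupleS (M : nmodType) k (G : word n -> M) :
  \sum_(a : k.+1.-tuple 'I_n) G a = \sum_(i < n) \sum_(a : k.-tuple 'I_n) G (i :: a).
Proof.
rewrite pair_big /= (reindex (fun p : 'I_n * k.-tuple 'I_n => [tuple of p.1 :: p.2])) //=.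
exists (fun t : k.+1.-tuple 'I_n => (thead t, [tuple of behead t])) => [[i a] _|t _] /=.
  by rewrite theadE; congr (_, _); exact: val_inj.
by rewrite -tuple_eta.
Qed.

Lemma sum_tuple0 (M : nmodType) (G : word n -> M) :
  \sum_(a : 0.-tuple 'I_n) G a = G [::].
Proof.
rewrite (bigD1 [tuple])//= big1 ?addr0// => a; case/negP; apply/eqP.
by apply: val_inj; case: a => [[|]].
Qed.

Lemma ler_sum_subseq (R : numDomainType) (T : eqType) (s L : seq T) (G : T -> R) :
  (forall t, 0 <= G t) -> uniq s -> uniq L -> {subset s <= L} ->
  \sum_(t <- s) G t <= \sum_(t <- L) G t.
Proof.
move=> G0 us uL sL; rewrite [leRHS](bigID (mem s))/=.
have -> : \sum_(t <- s) G t = \sum_(t <- L | t \in s) G t; last first.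
  by rewrite lerDl; apply: sumr_ge0.
rewrite -[RHS]big_filter; apply: perm_big; rewrite perm_sym.
apply: uniq_perm => //; first exact: filter_uniq.
by move=> t; rewrite mem_filter; case st: (t \in s) => //=; exact: sL.
Qed.

End Words.

Section Truncation.
Variables (R : realType) (n : nat) (V : hilbertType R).
Local Notation C := R[i]%C.
Local Notation E := (ell2 (word n) V).

Definition trunc N (x : E) : E := \sum_(w <- words_lt n N) emb V w (x w).

Lemma truncE N x w : trunc N x w = if (size w < N)%N then x w else 0.
Proof.
rewrite /trunc ell2_sumE -mem_words_lt.
have := words_lt_uniq n N; elim: (words_lt n N) => [|v s IH] /=; first by rewrite big_nil.
move=> /andP[vs us]; rewrite big_cons IH// embE inE.
case: (eqVneq w v) => [->|_] /=; last by rewrite add0r.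
by rewrite (negbTE vs) addr0.
Qed.

Lemma trunc_cvg x : trunc N x @[N --> \oo] --> x.
Proof.
have tx N : hnorm (x - trunc N x) ^+ 2 = hnorm x ^+ 2 - \sum_(w <- words_lt n N) hnorm (x w) ^+ 2.
  have h y : rin y (trunc N x) = \sum_(w <- words_lt n N) rin (y w) (x w).
    rewrite /trunc; elim: (words_lt n N) => [|w s IH]; first by rewrite !big_nil rin0r.
    by rewrite !big_cons rinDr IH rin_emb'.
  have h1 : rin x (trunc N x) = \sum_(w <- words_lt n N) hnorm (x w) ^+ 2.
    by rewrite h; apply: eq_bigr => w _; rewrite rinn.
  have h2 : hnorm (trunc N x) ^+ 2 = rin x (trunc N x).
    rewrite -rinn !h big_seq [RHS]big_seq; apply: eq_bigr => w.
    by rewrite mem_words_lt truncE => ->.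
  by rewrite hnormBsq h2 h1 mulr2n; ring.
apply/hcvgP => e e0.
have [s us hs] : exists2 s, uniq s & hnorm x ^+ 2 - e ^+ 2 < \sum_(w <- s) hnorm (x w) ^+ 2.
  apply: contrapT => h.
  have : hnorm x ^+ 2 <= hnorm x ^+ 2 - e ^+ 2.
    apply: ell2_fin_bound => s us; rewrite leNgt; apply/negP => hs; apply: h.
    by exists s.
  by have := exprn_gt0 2 e0; lra.
exists (\max_(w <- s) size w).+1 => // N /= sN.
rewrite -(@ltr_pXn2r _ 2)// ?nnegrE ?hnorm_ge0 ?(ltW e0)// tx.
rewrite ltrBlDl -ltrBlDr; apply: lt_le_trans hs _.
apply: ler_sum_subseq => // [w||w ws]; rewrite ?sqr_ge0 ?words_lt_uniq//.
rewrite mem_words_lt; apply: leq_trans sN.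
by rewrite ltnS; apply: leq_bigmax_seq.
Qed.

(** The radial dilation [f_a |-> r^|a| f_a]. *)
Definition dil (r : R) : bop E E := mkop (fun (x : E) w => (r ^+ size w)%:C%C *: x w).

Lemma dilP r : 0 <= r <= 1 -> (forall x w, dil r x w = (r ^+ size w)%:C%C *: x w) /\
  forall x, hnorm (dil r x) <= hnorm x.
Proof.
move=> /andP[r0 r1].
have [||h1 h2] := @mkopP _ E _ V (fun (x : E) w => (r ^+ size w)%:C%C *: x w) 1 ler01.
- by move=> w a x y; rewrite ell2DE ell2ZE scalerDr !scalerA mulrC.
- move=> x s us; rewrite expr1n mul1r; apply: le_trans (ell2_fin_le x us).
  apply: ler_sum => w _; rewrite lerXn2r ?nnegrE ?hnorm_ge0// hnormZr.
  rewrite -[leRHS]mul1r ler_wpM2r ?hnorm_ge0// ger0_norm ?exprn_ge0//.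
  exact: exprn_ile1.
by split => // x; rewrite -[leRHS]mul1r.
Qed.

End Truncation.

Section StrongLimits.
Variables (R : realType).
Local Notation C := R[i]%C.

(** Closed because of the uniform bound: strong convergence needs to be tested on a
    total family only. *)
Lemma sot_subspace (V W : hilbertType R) T (F : set_system T) {FF : ProperFilter F}
    (A : T -> bop V W) (L : bop V W) (c : R) : 0 <= c ->
  (\forall t \near F, forall x, hnorm (A t x) <= c * hnorm x) ->
  exists K : closed_subspace V, forall x, cs_set K x <-> A t x @[t --> F] --> L x.
Proof.
move=> c0 bA.
pose K := [set x | A t x @[t --> F] --> L x].
have K0 : K 0.
  rewrite /K /=; have -> : (fun t => A t 0) = (fun=> 0) by apply/funext => t; rewrite bopx0.
  by rewrite bopx0; exact: cvg_cst.
have Kl (a : C) x y : K x -> K y -> K (a *: x + y).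
  rewrite /K /= => hx hy.
  have -> : (fun t => A t (a *: x + y)) = (fun t => a *: A t x + A t y).
    by apply/funext => t; rewrite bop_linear.
  by rewrite bop_linear; apply: hcvgD => //; exact: hcvgZ.
have [d d0 hd] := bop_bounded L.
have Kc : closed K.
  move=> x /hclosureP h; apply/hcvgP => e e0.
  have cd : 0 < (c + d + 1) * 2 by nra.
  have [y Ky xy] := h _ (divr_gt0 e0 cd).
  have e2 : 0 < e / 2 by rewrite divr_gt0.
  have /hcvgP/(_ _ e2) hy : A t y @[t --> F] --> L y := Ky.
  apply: filterS2 hy bA => t hy bt.
  have -> : L x - A t x = (L y - A t y) + (L (x - y) - A t (x - y)).
    rewrite !bopxB opprB addrACA.
    rewrite [L y + _]addrC subrK; congr (_ + _).
    by rewrite addrC addrAC addrN add0r.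
  apply: le_lt_trans (hnormD _ _) _.
  have h3 : hnorm (x - y) * ((c + d + 1) * 2) < e by rewrite -ltr_pdivlMr.
  have := hnormB (L (x - y)) (A t (x - y)); have := hd (x - y); have := bt (x - y).
  have := hnorm_ge0 (x - y); move: hy h3.
  move: (hnorm (x - y)) (hnorm (L y - A t y)) (hnorm (L (x - y))) (hnorm (A t (x - y))).
  move: (hnorm _) => *; nra.
by exists (ClosedSubspace K0 Kl Kc).
Qed.

Lemma ell2_sot (I : countType) (V W : hilbertType R) T (F : set_system T) {FF : ProperFilter F}
    (A : T -> bop (ell2 I V) W) (L : bop (ell2 I V) W) (c : R) : 0 <= c ->
  (\forall t \near F, forall x, hnorm (A t x) <= c * hnorm x) ->
  (forall i v, A t (emb V i v) @[t --> F] --> L (emb V i v)) ->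
  forall x, A t x @[t --> F] --> L x.
Proof.
move=> c0 bA h x; have [K hK] := @sot_subspace _ _ _ _ _ A L c c0 bA.
by apply/hK; apply: ell2_total => i v; apply/hK.
Qed.

Lemma at_left1 (d : R) : d < 1 -> \forall r \near 1^'-, d < r < 1.
Proof.
move=> d1; near=> r; apply/andP; split; last by near: r; exact: nbhs_left_lt.
by near: r; exact: nbhs_left_gt.
Unshelve. all: by end_near. Qed.

Lemma exp_cvg1 k : (r ^+ k) @[r --> (1 : R)^'-] --> (1 : R).
Proof.
apply: cvg_at_left_filter; rewrite -[X in _ --> X](expr1n _ k).
exact: exprn_continuous.
Qed.

Lemma dil_cvg n (V : hilbertType R) (x : ell2 (word n) V) : dil n V r x @[r --> 1^'-] --> x.
Proof.
apply: (@ell2_sot _ _ _ _ _ _ (dil n V) (idop _) 1) => //.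
  apply: filterS (at_left1 ltr01) => r /andP[r0 r1] y; rewrite mul1r.
  by apply: (dilP _ _ _).2; rewrite !ltW.
move=> w v; apply/hcvgP => e e0.
have hv : 0 < hnorm v + 1 by rewrite ltr_wpDl ?hnorm_ge0.
have /cvgrPdist_lt/(_ _ (divr_gt0 e0 hv)) h := exp_cvg1 (size w).
apply: filterS2 (at_left1 ltr01) h => r /andP[r0 r1] h.
have r01 : 0 <= r <= 1 by rewrite !ltW.
have -> : idop _ (emb V w v) - dil n V r (emb V w v) = (1 - r ^+ size w)%:C%C *: emb V w v.
  apply: ell2P_ext => u; rewrite ell2DE ell2NE ell2ZE (dilP _ _ r01).1.
  rewrite idopE !embE; case: eqP => [->|_]; last by rewrite !scaler0 subr0.
  by rewrite rmorphB rmorph1 scalerBl scale1r.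
rewrite hnormZr hnorm_emb.
have : `|1 - r ^+ size w| * (hnorm v + 1) < e by rewrite -ltr_pdivlMr.
have := normr_ge0 (1 - r ^+ size w); nra.
Qed.

End StrongLimits.

(** * Evaluation of power series at tuples of operators *)

Section NormConvergence.
Variables (R : realType).
Local Notation C := R[i]%C.
Implicit Types (V W : hilbertType R).

Lemma norm_cvg_sot V W T (F : set_system T) {FF : ProperFilter F} (A : T -> bop V W) L :
  norm_cvg A F L -> forall x, A t x @[t --> F] --> L x.
Proof.
move=> /cvgrPdist_lt h x; apply/hcvgP => e e0.
have x1 : 0 < hnorm x + 1 by rewrite ltr_wpDl ?hnorm_ge0.
apply: filterS (h _ (divr_gt0 e0 x1)) => t; rewrite sub0r normrN ger0_norm ?opnorm_ge0// => ht.
rewrite hdistC; apply: le_lt_trans (hnorm_opnorm (A t - L) x) _.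
have : opnorm (A t - L) * (hnorm x + 1) < e by rewrite -ltr_pdivlMr.
have := opnorm_ge0 (A t - L); nra.
Qed.

Lemma norm_cvg_rate V W (A : nat -> bop V W) (L : bop V W) (e : nat -> R) :
  (forall k, 0 <= e k) -> e @ \oo --> (0 : R) ->
  (forall k x, hnorm (L x - A k x) <= e k * hnorm x) -> norm_cvg A \oo L.
Proof.
move=> e0 ce h.
apply: (@squeeze_cvgr _ _ _ _ (fun=> 0) e) => //; last exact: cvg_cst.
apply: nearW => k; rewrite opnorm_ge0 /=; apply: opnorm_le => // x.
by rewrite bopBE hdistC.
Qed.

Lemma norm_cvg_opnorm_le V W T (F : set_system T) {FF : ProperFilter F} (A : T -> bop V W) L
    (V' W' : hilbertType R) (A' : T -> bop V' W') L' :
  (forall t, opnorm (A' t - L') <= opnorm (A t - L)) -> norm_cvg A F L -> norm_cvg A' F L'.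
Proof.
move=> h c; apply: (@squeeze_cvgr _ _ _ _ (fun=> 0) (fun t => opnorm (A t - L))) => //.
  by apply: nearW => t; rewrite opnorm_ge0 h.
exact: cvg_cst.
Qed.

End NormConvergence.

Section Abel.
Variables (R : realType) (V : hilbertType R).
Local Notation C := R[i]%C.

Lemma geometric_le1 (r : R) N : 0 <= r < 1 -> (1 - r) * \sum_(k < N) r ^+ k <= 1.
Proof.
move=> /andP[r0 r1]; have h := subrX1 r N.
have h2 : (1 - r) * \sum_(i < N) r ^+ i = 1 - r ^+ N by lra.
by rewrite h2; have := exprn_ge0 N r0; lra.
Qed.

(** Abel's theorem, by summation by parts: the radial sums average the tails of
    the series with weights [(1 - r) r^k]. *)
Lemma abel (u : nat -> V) (s : V) (P : R -> V) (d : R) : d < 1 ->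
  series u @ \oo --> s ->
  (forall r, d < r < 1 -> series (fun k => (r ^+ k)%:C%C *: u k) @ \oo --> P r) ->
  P r @[r --> 1^'-] --> s.
Proof.
move=> d1 us Pr.
pose T N := series u N - s.
have parts r N : series (fun k => (r ^+ k)%:C%C *: u k) N - s =
    (r ^+ N)%:C%C *: T N + (1 - r)%:C%C *: \sum_(k < N) (r ^+ k)%:C%C *: T k.+1.
  elim: N => [|N IH].
    by rewrite /T /series/= !big_geq// big_ord0 !sub0r scaler0 addr0 expr0 scale1r.
  have -> : series (fun k => (r ^+ k)%:C%C *: u k) N.+1 =
      series (fun k => (r ^+ k)%:C%C *: u k) N + (r ^+ N)%:C%C *: u N by rewrite seriesSr.
  have -> : u N = T N.+1 - T N.
    by rewrite /T seriesSr opprB addrA subrK addrC addKr.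
  rewrite addrAC IH big_ord_recr/= (scalerDr (1 - r)%:C%C) (scalerBr _ (T N.+1)) [(1 - r)%:C%C *: (_ *: _)]scalerA.
  have -> : (r ^+ N)%:C%C *: T N.+1 =
      (r ^+ N.+1)%:C%C *: T N.+1 + ((1 - r)%:C%C * (r ^+ N)%:C%C) *: T N.+1.
    by rewrite -scalerDl -rmorphM -rmorphD/=; congr (_%:C%C *: _); rewrite exprS; ring.
  by rewrite addrC addrA subrK -addrA; congr (_ + _); exact: addrC.
apply/hcvgP => e e0.
have e4 : 0 < e / 4 by rewrite divr_gt0.
have /hcvgP/(_ _ e4)[K _ hK] := us.
have TK k : (K <= k)%N -> hnorm (T k) <= e / 4.
  by move=> Kk; rewrite /T hdistC; apply/ltW/hK.
pose B := \sum_(k < K) hnorm (T k.+1).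
have B0 : 0 <= B by apply: sumr_ge0 => k _; exact: hnorm_ge0.
have dB : 1 - e / 4 / (B + 1) < 1.
  by rewrite gtrBl divr_gt0// ltr_wpDl.
apply: filterS3 (at_left1 d1) (at_left1 (ltr01 : 0 < 1 :> R)) (at_left1 dB) => r rd r01 rB.
have /andP[r0 r1] := r01; have /andP[rB1 _] := rB.
have hB : (1 - r) * B <= e / 4.
  have : (1 - r) * (B + 1) <= e / 4.
    by rewrite -ler_pdivlMr ?ltr_wpDl//; move: rB1; set q := _ / (B + 1); lra.
  nra.
have key N : (K <= N)%N -> hnorm (series (fun k => (r ^+ k)%:C%C *: u k) N - s) <= e / 4 * 3.
  move=> KN; rewrite parts.
  apply: le_trans (hnormD _ _) _; rewrite !hnormZr ger0_norm ?exprn_ge0 ?(ltW r0)//.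
  rewrite ger0_norm; last by lra.
  have h1 : r ^+ N * hnorm (T N) <= e / 4.
    have := TK _ KN; have := hnorm_ge0 (T N); have := exprn_ile1 N (ltW r0) (ltW r1).
    by have := exprn_ge0 N (ltW r0); nra.
  have h2 : hnorm (\sum_(k < N) (r ^+ k)%:C%C *: T k.+1) <=
      (\sum_(k < N) r ^+ k) * (e / 4) + B.
    have : hnorm (\sum_(k < N) (r ^+ k)%:C%C *: T k.+1) <=
       \sum_(k < N) (r ^+ k * (e / 4) + (if (k < K)%N then hnorm (T k.+1) else 0)).
      elim/big_ind2: _ => [|x1 x2 y1 y2 h1' h2'|k _]; first by rewrite hnorm0.
        by apply: le_trans (hnormD _ _) _; rewrite lerD.
      rewrite hnormZr ger0_norm ?exprn_ge0 ?(ltW r0)//.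
      have rk0 := exprn_ge0 k (ltW r0); have rk1 := exprn_ile1 k (ltW r0) (ltW r1).
      case: ltnP => kK; first by have := hnorm_ge0 (T k.+1); nra.
      by rewrite addr0 ler_wpM2l// TK// ltnW.
    rewrite big_split/= -mulr_suml => /le_trans; apply; rewrite lerD2l.
    rewrite -(big_mkord xpredT (fun k => if (k < K)%N then hnorm (T k.+1) else 0)).
    rewrite (@big_cat_nat _ _ _ K)//= [X in _ + X]big_nat_cond [X in _ + X]big1 ?addr0.
      by rewrite big_mkord /B; apply: ler_sum => k _; rewrite ltn_ord.
    by move=> k /andP[/andP[Kk _] _]; rewrite ltnNge Kk.
  have h3 := geometric_le1 N (introT andP (conj (ltW r0) r1)).
  have r1' : 0 <= 1 - r by lra.
  have h4 := ler_wpM2l r1' h2.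
  have h5 : (1 - r) * (\sum_(k < N) r ^+ k) * (e / 4) <= e / 4.
    by rewrite -[leRHS]mul1r ler_wpM2r// ltW.
  by rewrite mulrDr mulrA in h4; lra.
have cv : (fun N => series (fun k => (r ^+ k)%:C%C *: u k) N - s) @ \oo --> P r - s.
  by apply: cvgB; [exact: Pr|exact: cvg_cst].
rewrite hdistC; apply: le_lt_trans (_ : e / 4 * 3 < e); last by lra.
by apply: (hnorm_limit_le cv); exists K.
Qed.

End Abel.

Section Evaluation.
Variables (R : realType) (n : nat).
Local Notation C := R[i]%C.
Implicit Types (V W : hilbertType R) (p : pser R n).

Lemma word_op_cat V (Y : 'I_n -> bop V V) a b x :
  word_op Y (a ++ b) x = word_op Y a (word_op Y b x).
Proof. by elim: a x => [|i a IH] x //=; rewrite IH. Qed.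

Lemma word_opS V (Y : 'I_n -> bop V V) i a x : word_op Y (i :: a) x = Y i (word_op Y a x).
Proof. by []. Qed.

Lemma word_op_dilate V (Y : 'I_n -> bop V V) r a x :
  word_op (dilate r Y) a x = (r ^+ size a)%:C%C *: word_op Y a x.
Proof.
elim: a x => [|i a IH] x; first by rewrite expr0 scale1r.
by rewrite !word_opS IH bopxZ /dilate bopZE scalerA -rmorphM/= exprSr.
Qed.

Lemma hom_partE V p (Y : 'I_n -> bop V V) k x :
  hom_part p Y k x = \sum_(a : k.-tuple 'I_n) p a *: word_op Y a x.
Proof. by rewrite /hom_part bop_sumE; apply: eq_bigr. Qed.

Lemma hom_part_dilate V p (Y : 'I_n -> bop V V) r k x :
  hom_part p (dilate r Y) k x = (r ^+ k)%:C%C *: hom_part p Y k x.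
Proof.
rewrite !hom_partE scaler_sumr; apply: eq_bigr => a _.
by rewrite word_op_dilate size_tuple !scalerA mulrC.
Qed.

Lemma series_bopE V W (A : nat -> bop V W) N x : series A N x = series (fun k => A k x) N.
Proof. by rewrite /series/= bop_sumE. Qed.

Lemma series_homE V p (Y : 'I_n -> bop V V) N x :
  series (hom_part p Y) N x = \sum_(w <- words_lt n N) p w *: word_op Y w x.
Proof.
rewrite series_bopE /series/= big_mkord sum_words_lt; apply: eq_bigr => k _.
exact: hom_partE.
Qed.

Lemma sot_sumP V p (Y : 'I_n -> bop V V) L : sot_sum p Y L <->
  forall x, series (fun k => hom_part p Y k x) @ \oo --> L x.
Proof.
have e x : (fun N => series (hom_part p Y) N x) = series (fun k => hom_part p Y k x).
  by apply/funext => N; rewrite series_bopE.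
by split=> h x; [rewrite -e; exact: h|rewrite e; exact: h].
Qed.

Lemma norm_sum_sot V p (Y : 'I_n -> bop V V) L : norm_sum p Y L -> sot_sum p Y L.
Proof. by move=> h x; exact: (norm_cvg_sot h). Qed.

Lemma sot_sum_uniq V p (Y : 'I_n -> bop V V) L L' : sot_sum p Y L -> sot_sum p Y L' -> L = L'.
Proof. by move=> h h'; apply: bop_ext => x; exact: (hcvg_unique (h x) (h' x)). Qed.

Lemma rad_sum_uniq V p (Y : 'I_n -> bop V V) L L' : rad_sum p Y L -> rad_sum p Y L' -> L = L'.
Proof.
move=> [d /andP[d0 d1] [P hP PL]] [d' /andP[d0' d1'] [P' hP' PL']].
apply: bop_ext => x; apply: (hcvg_unique (PL x)).
apply: cvg_trans (PL' x); apply: near_eq_cvg.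
apply: filterS2 (at_left1 d1) (at_left1 d1') => r h h'.
by have /norm_sum_sot := hP r h; move=> /sot_sum_uniq/(_ (norm_sum_sot (hP' r h'))) ->.
Qed.

Lemma sot_rad V p (Y : 'I_n -> bop V V) L L' : sot_sum p Y L -> rad_sum p Y L' -> L = L'.
Proof.
move=> /sot_sumP h [d /andP[d0 d1] [P hP PL]].
apply: bop_ext => x; apply: (hcvg_unique _ (PL x)).
apply: (abel d1 (h x)) => r hr.
have /norm_sum_sot/sot_sumP/(_ x) := hP r hr.
have -> // : (fun k => hom_part p (dilate r Y) k x) =
  (fun k => (r ^+ k)%:C%C *: hom_part p Y k x).
by apply/funext => k; exact: hom_part_dilate.
Qed.

Lemma pevalE V p (Y : 'I_n -> bop V V) L : sot_sum p Y L \/ rad_sum p Y L -> peval p Y = L.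
Proof.
move=> h; have [s|s] := xgetPex 0 (ex_intro [set L | sot_sum p Y L \/ rad_sum p Y L] L h).
  case: h => h; first exact: (sot_sum_uniq s h).
  exact: (sot_rad s h).
case: h => h; last exact: (rad_sum_uniq s h).
exact/esym/(sot_rad h s).
Qed.

Lemma pevalP V p (Y : 'I_n -> bop V V) : (exists L, sot_sum p Y L \/ rad_sum p Y L) ->
  sot_sum p Y (peval p Y) \/ rad_sum p Y (peval p Y).
Proof. by move=> [L h]; rewrite (pevalE h). Qed.

End Evaluation.

Section UnitaryConjugation.
Variables (R : realType) (n : nat) (V W : hilbertType R) (U : bop V W).
Local Notation C := R[i]%C.
Hypotheses (UU : forall x, adj U (U x) = x) (UU' : forall y, U (adj U y) = y).

Definition conj_op (A : bop V V) : bop W W := bcomp U (bcomp A (adj U)).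

Lemma hnorm_unitary x : hnorm (U x) = hnorm x.
Proof.
by apply/eqP; rewrite -(@eqrXn2 _ 2)// ?hnorm_ge0// -!rinn rin_adj UU.
Qed.

Lemma hnorm_adj_unitary y : hnorm (adj U y) = hnorm y.
Proof. by rewrite -hnorm_unitary UU'. Qed.

Lemma conj_opE A y : conj_op A y = U (A (adj U y)). Proof. by []. Qed.

Lemma conj_opB A B : conj_op A - conj_op B = conj_op (A - B).
Proof. by apply: bop_ext => y; rewrite !(bopBE, conj_opE) bopxB. Qed.

Lemma opnorm_conj A : opnorm (conj_op A) <= opnorm A.
Proof.
apply: opnorm_le => [|y]; first exact: opnorm_ge0.
by rewrite conj_opE hnorm_unitary -(hnorm_adj_unitary y); exact: hnorm_opnorm.
Qed.

Variables (Y : 'I_n -> bop V V) (Y' : 'I_n -> bop W W).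
Hypothesis YY' : forall i, Y' i = conj_op (Y i).

Lemma word_op_conj a y : word_op Y' a y = conj_op (word_op Y a) y.
Proof.
elim: a y => [|i a IH] y; first by rewrite conj_opE /= UU'.
by rewrite !word_opS IH YY' !conj_opE UU.
Qed.

Lemma hom_part_conj p k : hom_part p Y' k = conj_op (hom_part p Y k).
Proof.
apply: bop_ext => y; rewrite conj_opE !hom_partE bopx_sum; apply: eq_bigr => a _.
by rewrite word_op_conj bopxZ.
Qed.

Lemma series_hom_conj p N : series (hom_part p Y') N = conj_op (series (hom_part p Y) N).
Proof.
apply: bop_ext => y; rewrite conj_opE !series_bopE /series/= bopx_sum.
by apply: eq_bigr => k _; rewrite hom_part_conj.
Qed.

Lemma sot_cvg_conj T (F : set_system T) {FF : ProperFilter F} (A : T -> bop V V) L :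
  sot_cvg A F L -> sot_cvg (fun t => conj_op (A t)) F (conj_op L).
Proof. by move=> h y; apply: bop_cvg; exact: h. Qed.

Lemma sot_sum_conj p L : sot_sum p Y L -> sot_sum p Y' (conj_op L).
Proof.
rewrite /sot_sum (_ : series (hom_part p Y') = fun N => conj_op (series (hom_part p Y) N)).
  exact: sot_cvg_conj.
by apply/funext => N; exact: series_hom_conj.
Qed.

Lemma norm_sum_conj p L : norm_sum p Y L -> norm_sum p Y' (conj_op L).
Proof.
apply: norm_cvg_opnorm_le => N; rewrite series_hom_conj conj_opB; exact: opnorm_conj.
Qed.

End UnitaryConjugation.

Section UnitaryInvariance.
Variables (R : realType) (n : nat).
Local Notation C := R[i]%C.
Implicit Types V W : hilbertType R.

Lemma rad_sum_conj V W (U : bop V W) (Y : 'I_n -> bop V V) (Y' : 'I_n -> bop W W) p L :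
  (forall x, adj U (U x) = x) -> (forall y, U (adj U y) = y) ->
  (forall i, Y' i = conj_op U (Y i)) -> rad_sum p Y L -> rad_sum p Y' (conj_op U L).
Proof.
move=> UU UU' YY' [d d01 [P hP PL]]; exists d => //.
exists (fun r => conj_op U (P r)); last exact: sot_cvg_conj.
move=> r hr; apply: (@norm_sum_conj _ _ _ _ U UU UU' (dilate r Y)) (hP r hr) => i.
apply: bop_ext => y; rewrite /dilate YY' !(bopZE, conj_opE) bopxZ//.
Qed.

Lemma peval_conj V W (U : bop V W) (Y : 'I_n -> bop V V) (Y' : 'I_n -> bop W W) p :
  (forall x, adj U (U x) = x) -> (forall y, U (adj U y) = y) ->
  (forall i, Y' i = conj_op U (Y i)) ->
  (exists L, sot_sum p Y L \/ rad_sum p Y L) -> peval p Y' = conj_op U (peval p Y).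
Proof.
move=> UU UU' YY' /pevalP[h|h]; apply: pevalE; [left|right].
  exact: (sot_sum_conj UU UU' YY' h).
exact: (rad_sum_conj UU UU' YY' h).
Qed.

End UnitaryInvariance.

(** * Row contractions and their Poisson kernels *)

Section RowOperators.
Variables (R : realType) (n : nat) (H : hilbertType R) (F : 'I_n -> bop H H).
Local Notation C := R[i]%C.

(** The quadratic form of the iterates on the identity of the completely positive
    map [Y |-> sum_i F_i Y F_i^*]. *)
Definition cp_form k h : R := \sum_(a : k.-tuple 'I_n) hnorm (adj (word_op F a) h) ^+ 2.

Lemma adj_word_opS i a h : adj (word_op F (i :: a)) h = adj (word_op F a) (adj (F i) h).
Proof. by rewrite /= adj_comp. Qed.

Lemma cp_form0 h : cp_form 0 h = hnorm h ^+ 2.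
Proof. by rewrite /cp_form (sum_tuple0 (fun a => hnorm (adj (word_op F a) h) ^+ 2)) /= adj_id. Qed.

Lemma cp_formS k h : cp_form k.+1 h = \sum_i cp_form k (adj (F i) h).
Proof.
rewrite /cp_form (sum_tupleS k (fun a => hnorm (adj (word_op F a) h) ^+ 2)).
by apply: eq_bigr => i _; apply: eq_bigr => a _; rewrite adj_word_opS.
Qed.

Lemma cp_form_ge0 k h : 0 <= cp_form k h.
Proof. by apply: sumr_ge0 => a _; exact: sqr_ge0. Qed.

Lemma hnorm_adj_row h : hnorm (adj (row_op F) h) ^+ 2 = \sum_i hnorm (adj (F i) h) ^+ 2.
Proof. by rewrite hnorm_ord; apply: eq_bigr => i _; rewrite adj_row_op. Qed.

Lemma row_boundP (rho : R) : 0 <= rho ->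
  (forall h, \sum_i hnorm (adj (F i) h) ^+ 2 <= rho ^+ 2 * hnorm h ^+ 2) <->
  (forall x, hnorm (row_op F x) <= rho * hnorm x).
Proof.
move=> r0; split=> h x.
  rewrite -[row_op F]adjK; apply: adj_bound => // y.
  by rewrite -hnorm_le_sq ?mulr_ge0 ?hnorm_ge0// hnorm_adj_row exprMn.
rewrite -hnorm_adj_row -exprMn hnorm_le_sq ?mulr_ge0 ?hnorm_ge0//.
exact: adj_bound.
Qed.

Section Ball.
Variable rho : R.
Hypotheses (rho0 : 0 <= rho)
  (Frho : forall h, \sum_i hnorm (adj (F i) h) ^+ 2 <= rho ^+ 2 * hnorm h ^+ 2).

Lemma cp_form_le k h : cp_form k h <= (rho ^+ k) ^+ 2 * hnorm h ^+ 2.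
Proof.
elim: k h => [|k IH] h; first by rewrite cp_form0 expr0 expr1n mul1r.
rewrite cp_formS; apply: le_trans (_ : \sum_i (rho ^+ k) ^+ 2 * hnorm (adj (F i) h) ^+ 2 <= _).
  by apply: ler_sum => i _; exact: IH.
have -> : (rho ^+ k.+1) ^+ 2 * hnorm h ^+ 2 = (rho ^+ k) ^+ 2 * (rho ^+ 2 * hnorm h ^+ 2).
  by rewrite [rho ^+ k.+1]exprSr exprMn mulrA.
by rewrite -mulr_sumr ler_wpM2l ?sqr_ge0.
Qed.

(** The homogeneous part of degree [k] is the adjoint of the column of the
    [F_a^*], [|a| = k], of norm at most [rho^k], applied to the vector with
    components [c_a h]. *)
Lemma hom_part_bound (c : ell2 (word n) C) k h :
  hnorm (hom_part (coef c) F k h) <= hnorm c * rho ^+ k * hnorm h.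
Proof.
have [||AE Ab] := @mkopP _ H (k.-tuple 'I_n) H (fun h a => adj (word_op F a) h) (rho ^+ k) (exprn_ge0 k rho0).
- by move=> a b x y; rewrite bop_linear.
- move=> x s us; apply: le_trans (cp_form_le k x).
  apply: ler_sum_subseq => // [t||t _]; rewrite ?sqr_ge0 ?index_enum_uniq//.
  exact: mem_index_enum.
set A := mkop _ in AE Ab.
have Aemb a v : adj A (emb H a v) = word_op F a v.
  by apply: inner_inj => x; rewrite -adjP inner_emb' AE -adjP'.
pose x : ell2 (k.-tuple 'I_n) H := \sum_(a : k.-tuple 'I_n) emb H a (c a *: h).
have -> : hom_part (coef c) F k h = adj A x.
  by rewrite hom_partE /x bopx_sum; apply: eq_bigr => a _; rewrite Aemb bopxZ.
apply: le_trans (adj_bound (exprn_ge0 k rho0) Ab x) _.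
rewrite mulrAC [leRHS]mulrC ler_wpM2l ?exprn_ge0//.
rewrite -hnorm_le_sq ?mulr_ge0 ?hnorm_ge0//.
apply: ell2_fin_bound => s us.
have xE a : x a = c a *: h.
  rewrite /x ell2_sumE (bigD1 a)//= embii big1 ?addr0// => b ba.
  by rewrite embE eq_sym (negbTE ba).
rewrite exprMn; under eq_bigr do rewrite xE hnormZ exprMn.
rewrite -mulr_suml ler_wpM2r ?sqr_ge0//.
rewrite -(big_map val xpredT (fun w => hnorm (c w) ^+ 2)).
by apply: ell2_fin_le; rewrite map_inj_uniq//; exact: val_inj.
Qed.

Lemma ball_norm_sum (c : ell2 (word n) C) : rho < 1 -> exists G, norm_sum (coef c) F G.
Proof.
move=> rho1; have r1 : 0 < 1 - rho by lra.
have hc := hnorm_ge0 c.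
pose y k := hnorm c * (1 - rho ^+ k) / (1 - rho); pose M := hnorm c / (1 - rho).
have yS k : y k.+1 - y k = hnorm c * rho ^+ k.
  by rewrite /y exprS; field; rewrite gt_eqF.
have yM k : M - y k = hnorm c / (1 - rho) * rho ^+ k by rewrite /M /y; field; rewrite gt_eqF.
have yn : nondecreasing_seq y.
  by apply/nondecreasing_seqP => k; rewrite -subr_ge0 yS mulr_ge0 ?exprn_ge0.
have M0 : 0 <= hnorm c / (1 - rho) by rewrite divr_ge0// ltW.
have yM' k : y k <= M by rewrite -subr_ge0 yM mulr_ge0 ?exprn_ge0.
have [k x|G _ hG] := bop_cauchy (A := series (hom_part (coef c) F)) yn yM'.
  by rewrite yS seriesSr bopDE addrAC subrr add0r; exact: hom_part_bound.
exists G; apply: (@norm_cvg_rate _ _ _ _ _ (fun k => M - y k)) => //.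
  by move=> k; rewrite subr_ge0.
rewrite (_ : (fun k => M - y k) = (fun k => hnorm c / (1 - rho) * rho ^+ k)); last exact/funext.
rewrite -[X in _ --> X](mulr0 (hnorm c / (1 - rho))); apply: cvgMr.
by apply: cvg_expr; rewrite ger0_norm.
Qed.

End Ball.

Section Poisson.
Variable (Dl : bop H H).
Hypotheses (sDl : adj Dl = Dl)
  (nDl : forall h, hnorm (Dl h) ^+ 2 = hnorm h ^+ 2 - \sum_i hnorm (adj (F i) h) ^+ 2).

(** The Poisson kernel of the row [F]; [Dl] stands for its defect operator. *)
Definition poisson : bop H (ell2 (word n) H) :=
  mkop (fun h (a : word n) => Dl (adj (word_op F a) h)).

Lemma poisson_layer k h : \sum_(a : k.-tuple 'I_n) hnorm (Dl (adj (word_op F a) h)) ^+ 2 =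
  cp_form k h - cp_form k.+1 h.
Proof.
elim: k h => [|k IH] h.
  rewrite (sum_tuple0 (fun a => hnorm (Dl (adj (word_op F a) h)) ^+ 2)) cp_formS !cp_form0 /= adj_id.
  by rewrite nDl; congr (_ - _); apply: eq_bigr => i _; rewrite cp_form0.
rewrite (sum_tupleS k (fun a => hnorm (Dl (adj (word_op F a) h)) ^+ 2)) !(cp_formS _ h) -sumrB.
by apply: eq_bigr => i _; rewrite -IH; apply: eq_bigr => a _; rewrite adj_word_opS.
Qed.

Lemma poisson_partial N h :
  \sum_(w <- words_lt n N) hnorm (Dl (adj (word_op F w) h)) ^+ 2 = hnorm h ^+ 2 - cp_form N h.
Proof.
rewrite (sum_words_lt (fun w => hnorm (Dl (adj (word_op F w) h)) ^+ 2)).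
elim: N => [|N IH]; first by rewrite big_ord0 cp_form0 subrr.
by rewrite big_ord_recr/= IH poisson_layer addrA subrK.
Qed.

Lemma poisson_fin h (m : R) s : (forall k, m <= cp_form k h) -> uniq s ->
  \sum_(w <- s) hnorm (Dl (adj (word_op F w) h)) ^+ 2 <= hnorm h ^+ 2 - m.
Proof.
move=> hm us; pose N := (\max_(w <- s) size w).+1.
apply: le_trans (_ : hnorm h ^+ 2 - cp_form N h <= _); last by rewrite lerD2l lerN2 hm.
rewrite -poisson_partial; apply: ler_sum_subseq => // [w||w ws]; rewrite ?sqr_ge0 ?words_lt_uniq//.
by rewrite mem_words_lt ltnS; apply: leq_bigmax_seq.
Qed.

Lemma poissonP : (forall h w, poisson h w = Dl (adj (word_op F w) h)) /\
  forall h, hnorm (poisson h) <= hnorm h.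
Proof.
have [||h1 h2] := @mkopP _ H _ H (fun h (a : word n) => Dl (adj (word_op F a) h)) 1 ler01.
- by move=> w a x y; rewrite !bop_linear.
- move=> h s us; rewrite expr1n mul1r -[leRHS]subr0; apply: poisson_fin => // k.
  exact: cp_form_ge0.
by split => // h; rewrite -[leRHS]mul1r.
Qed.

Lemma poissonE h w : poisson h w = Dl (adj (word_op F w) h).
Proof. exact: poissonP.1. Qed.

Lemma cp_form_nincr h : nonincreasing_seq (fun k => cp_form k h).
Proof.
apply/nonincreasing_seqP => k; rewrite -subr_ge0 -poisson_layer.
by apply: sumr_ge0 => a _; exact: sqr_ge0.
Qed.

(** The defects of the layers telescope, so what the Poisson kernel loses of the
    norm is the limit of the forms. *)
Lemma poisson_norm h : cp_form k h @[k --> \oo] --> hnorm h ^+ 2 - hnorm (poisson h) ^+ 2.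
Proof.
have cq : cvgn (fun k => cp_form k h).
  apply: nonincreasing_is_cvgn; first exact: cp_form_nincr.
  by exists 0 => _ [k _ <-]; exact: cp_form_ge0.
set l := limn (fun k => cp_form k h).
have lq k : l <= cp_form k h by apply: nonincreasing_cvgn_ge => //; exact: cp_form_nincr.
have h1 : hnorm (poisson h) ^+ 2 <= hnorm h ^+ 2 - l.
  apply: ell2_fin_bound => s us; under eq_bigr do rewrite poissonE.
  exact: poisson_fin.
have h2 : hnorm h ^+ 2 - hnorm (poisson h) ^+ 2 <= l.
  apply: limr_ge => //; apply: nearW => k.
  have := @ell2_fin_le _ _ _ (poisson h) _ (words_lt_uniq n k).
  by under eq_bigr do rewrite poissonE; rewrite poisson_partial; lra.
have -> : hnorm h ^+ 2 - hnorm (poisson h) ^+ 2 = l by lra.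
exact: cq.
Qed.

Lemma adj_poisson_emb w v : adj poisson (emb H w v) = word_op F w (Dl v).
Proof.
by apply: inner_inj => h; rewrite -adjP inner_emb' poissonE adjP sDl -adjP'.
Qed.

End Poisson.
End RowOperators.

(** * Right multiplications and the Poisson transform *)

Section RightMultiplication.
Variables (R : realType) (n : nat).
Local Notation C := R[i]%C.
Implicit Types V H : hilbertType R.

Definition unrcons (i : 'I_n) (w : word n) : option (word n) :=
  if w is k :: u then if last k u == i then Some (belast k u) else None else None.

Lemma unrcons_rcons i w j : unrcons i (rcons w j) = if j == i then Some w else None.
Proof. by case: w => [|k u] //=; rewrite last_rcons belast_rcons. Qed.

Lemma unrcons_inj i (j j' w : word n) : unrcons i j = Some w -> unrcons i j' = Some w -> j = j'.
Proof.
case/lastP: j => [//|j k]; case/lastP: j' => [//|j' k'].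
by rewrite !unrcons_rcons; do 2![case: eqP => // ->]; move=> [->] [->].
Qed.

(** Right creation operators: [f_a |-> f_a f_i]. *)
Definition rcreate V i : bop (ell2 (word n) V) (ell2 (word n) V) := push V (unrcons i).

Lemma rcreate_nil V i x : rcreate V i x [::] = 0.
Proof. by rewrite /rcreate pushE//; exact: unrcons_inj. Qed.

Lemma rcreate_rcons V i x w j : rcreate V i x (rcons w j) = if j == i then x w else 0.
Proof.
rewrite /rcreate pushE; last exact: unrcons_inj.
by rewrite unrcons_rcons; case: ifP.
Qed.

Lemma rcreate_emb V i w v : rcreate V i (emb V w v) = emb V (rcons w i) v.
Proof.
apply: ell2P_ext => u; case/lastP: u => [|u j].
  by rewrite rcreate_nil embE; case: w.
by rewrite rcreate_rcons !embE eqseq_rcons andbC; case: (j == i).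
Qed.

Lemma LambdaE i : @Lambda R n i = rcreate C i.
Proof.
have ex : [set L : bop (H2f R n) (H2f R n) | forall c : H2f R n, (L c : ell2 _ _) [::] = 0 /\
    forall (a : word n) j, (L c : ell2 _ _) (rcons a j) = if j == i then (c : ell2 _ _) a else 0]
    (rcreate C i).
  by move=> c; split => [|a j]; [exact: rcreate_nil|exact: rcreate_rcons].
have h := xgetPex 0 (ex_intro _ _ ex).
apply: bop_ext => c; apply: ell2P_ext => w; have [h1 h2] := h c.
case/lastP: w => [|w j]; first by rewrite rcreate_nil; exact: h1.
by rewrite rcreate_rcons; exact: h2.
Qed.

(** Right multiplication by the word [b]: [f_a |-> f_a f_b]. *)
Fixpoint rmul V (b : word n) : bop (ell2 (word n) V) (ell2 (word n) V) :=
  if b is j :: b' then bcomp (rmul V b') (rcreate V j) else idop _.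

Lemma rmul_emb V b w v : rmul V b (emb V w v) = emb V (w ++ b) v.
Proof.
elim: b w => [|j b IH] w; first by rewrite cats0.
by rewrite [LHS]/= rcreate_emb IH cat_rcons.
Qed.

Lemma rmul_comm V (A : bop (ell2 (word n) V) (ell2 (word n) V)) :
  (forall j x, A (rcreate V j x) = rcreate V j (A x)) ->
  forall b x, A (rmul V b x) = rmul V b (A x).
Proof. by move=> h; elim=> [|j b IH] x //; rewrite [LHS]/= IH [in LHS]h. Qed.

Lemma ptens_bop (I : countType) V (v : V) :
  exists A : bop (ell2 I C) (ell2 I V), forall c, A c = ptens c v.
Proof.
apply: (@bop_mk _ _ _ _ (hnorm v)) => [a c d|c].
  by rewrite ptensDl ptensZl.
by rewrite -hnorm_le_sq ?mulr_ge0 ?hnorm_ge0// hnorm_ptens_sq exprMn mulrC.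
Qed.

Lemma ptens_rmul_trunc H (c : ell2 (word n) C) b (v : H) N :
  ptens (rmul C b (trunc N c)) v = \sum_(w <- words_lt n N) c w *: emb H (w ++ b) v.
Proof.
have [A hA] := ptens_bop (word n) v; rewrite -hA /trunc !bopx_sum; apply: eq_bigr => w _.
have -> : emb C w (c w) = c w *: emb C w 1.
  by apply: ell2P_ext => u; rewrite ell2ZE !embE; case: ifP => _; rewrite ?scaler0//; exact: esym (mulr1 _).
by rewrite !bopxZ rmul_emb hA -emb_ptens.
Qed.

Lemma ptens_rmul_cvg H T (F : set_system T) {FF : ProperFilter F} (c : T -> ell2 (word n) C) d b (v : H) :
  c t @[t --> F] --> d -> ptens (rmul C b (c t)) v @[t --> F] --> ptens (rmul C b d) v.
Proof.
move=> cd; have [A hA] := ptens_bop (word n) v; rewrite -hA.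
have -> : (fun t => ptens (rmul C b (c t)) v) = (fun t => A (rmul C b (c t))).
  by apply/funext => t; rewrite hA.
by apply: bop_cvg; apply: bop_cvg.
Qed.

(** Commutation with the right creation operators characterizes left
    multiplications, and makes no reference to the way products of elements of the
    model space are defined. *)
Definition left_mult (M : bop (ell2 (word n) C) (ell2 (word n) C)) (c : ell2 (word n) C) :=
  (forall j x, M (rcreate C j x) = rcreate C j (M x)) /\ M (emb C [::] 1) = c.

Lemma left_mult_emb M c b : left_mult M c -> M (emb C b 1) = rmul C b c.
Proof.
move=> [h1 h2]; have -> : emb C b 1 = rmul C b (emb C [::] 1) by rewrite rmul_emb.
by rewrite (rmul_comm h1) h2.
Qed.

Lemma tens_left_mult H M c b (v : H) : left_mult M c ->
  tens M (idop H) (emb H b v) = ptens (rmul C b c) v.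
Proof. by move=> h; rewrite emb_ptens tensE (left_mult_emb b h). Qed.

Lemma hom_part_dil H (F : 'I_n -> bop H H) (c : ell2 (word n) C) r k x : 0 <= r <= 1 ->
  hom_part (coef (dil n C r c)) F k x = hom_part (coef c) (dilate r F) k x.
Proof.
move=> r01; rewrite !hom_partE; apply: eq_bigr => a _.
by rewrite word_op_dilate /coef (dilP _ _ r01).1 scalerA mulrC.
Qed.

Section PoissonTransform.
Variables (H : hilbertType R) (F : 'I_n -> bop H H) (Dl : bop H H).
Hypotheses (sDl : adj Dl = Dl)
  (nDl : forall h, hnorm (Dl h) ^+ 2 = hnorm h ^+ 2 - \sum_i hnorm (adj (F i) h) ^+ 2).
Let K := poisson F Dl.

Lemma poisson_sot (c : ell2 (word n) C) G : sot_sum (coef c) F G ->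
  forall b v, adj K (ptens (rmul C b c) v) = G (word_op F b (Dl v)).
Proof.
move=> cG b v.
have h1 : adj K (ptens (rmul C b (trunc N c)) v) @[N --> \oo] --> adj K (ptens (rmul C b c) v).
  by apply: bop_cvg; apply: ptens_rmul_cvg; exact: trunc_cvg.
apply: (hcvg_unique h1).
have -> : (fun N => adj K (ptens (rmul C b (trunc N c)) v)) =
    (fun N => series (hom_part (coef c) F) N (word_op F b (Dl v))).
  apply/funext => N; rewrite ptens_rmul_trunc series_homE bopx_sum; apply: eq_bigr => w _.
  by rewrite bopxZ adj_poisson_emb// word_op_cat.
exact: cG.
Qed.

Lemma poisson_rad (c : ell2 (word n) C) G : rad_sum (coef c) F G ->
  forall b v, adj K (ptens (rmul C b c) v) = G (word_op F b (Dl v)).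
Proof.
move=> [d /andP[d0 d1] [P hP PG]] b v.
have h1 : adj K (ptens (rmul C b (dil n C r c)) v) @[r --> 1^'-] --> adj K (ptens (rmul C b c) v).
  by apply: bop_cvg; apply: ptens_rmul_cvg; exact: dil_cvg.
apply: (hcvg_unique h1); apply: cvg_trans (PG (word_op F b (Dl v))).
apply: near_eq_cvg; apply: filterS (at_left1 d1) => r hr.
have /andP[dr r1] := hr.
have r01 : 0 <= r <= 1 by rewrite !ltW// (lt_trans d0).
have rP : sot_sum (coef (dil n C r c)) F (P r).
  have := norm_sum_sot (hP r hr); rewrite /sot_sum.
  have -> // : hom_part (coef (dil n C r c)) F = hom_part (coef c) (dilate r F).
  by apply/funext => k; apply: bop_ext => x; exact: hom_part_dil.
by rewrite (poisson_sot rP).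
Qed.

(** The Poisson transform. For a polynomial [c] the identity holds termwise, because
    [K^* (f_w (x) v) = F_w Delta v]; in general it passes to the limit along truncations
    or along dilations of [c]. *)
Lemma poisson_tens M (c : ell2 (word n) C) G : left_mult M c ->
  sot_sum (coef c) F G \/ rad_sum (coef c) F G ->
  forall x, adj K (tens M (idop H) x) = G (adj K x).
Proof.
move=> hM hG x.
suff e : bcomp (adj K) (tens M (idop H)) = bcomp G (adj K).
  exact: (congr1 (fun B : bop _ _ => B x) e).
apply: ell2_ext => b v; rewrite !bcompE (tens_left_mult b v hM) adj_poisson_emb//.
by case: hG => hG; [exact: poisson_sot|exact: poisson_rad].
Qed.

End PoissonTransform.

Lemma row_defect_contraction H (F : 'I_n -> bop H H) :
  (forall h, \sum_i hnorm (adj (F i) h) ^+ 2 <= hnorm h ^+ 2) ->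
  let A := \sum_i bcomp (F i) (adj (F i)) in
  [/\ contraction A, adj A = A & forall h, rin (A h) h = \sum_i hnorm (adj (F i) h) ^+ 2].
Proof.
move=> hF A; have AE : A = bcomp (row_op F) (adj (row_op F)) by rewrite row_op_adj.
have cF x : hnorm (row_op F x) <= 1 * hnorm x.
  by apply: (row_boundP F ler01).1 => h; rewrite expr1n mul1r.
split.
- move=> h; rewrite AE bcompE; apply: le_trans (cF _) _; rewrite mul1r -[leRHS]mul1r.
  exact: adj_bound.
- by rewrite AE adj_comp adjK.
- by move=> h; rewrite AE bcompE rin_adj rinn hnorm_adj_row.
Qed.

(** Von Neumann's inequality. The Poisson kernel [K] of [r F] is isometric, so [G] is
    the compression [K^* (M (x) I) K]. *)
Lemma von_neumann H (F : 'I_n -> bop H H) M (c : ell2 (word n) C) (k r : R) :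
  (forall h, \sum_i hnorm (adj (F i) h) ^+ 2 <= hnorm h ^+ 2) ->
  left_mult M c -> 0 <= k -> (forall x, hnorm (M x) <= k * hnorm x) -> 0 < r < 1 ->
  exists2 G, norm_sum (coef c) (dilate r F) G & forall x, hnorm (G x) <= k * hnorm x.
Proof.
move=> hF hM k0 bM /andP[r0 r1].
have nF h : \sum_i hnorm (adj (dilate r F i) h) ^+ 2 = r ^+ 2 * \sum_i hnorm (adj (F i) h) ^+ 2.
  rewrite mulr_sumr; apply: eq_bigr => i _; rewrite /dilate adjZ bopZE.
  have -> : (r%:C%C)^* = r%:C%C :> C by apply/CrealP; rewrite complex_real.
  by rewrite hnormZr exprMn gtr0_norm.
have rF h : \sum_i hnorm (adj (dilate r F i) h) ^+ 2 <= r ^+ 2 * hnorm h ^+ 2.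
  by rewrite nF ler_wpM2l ?sqr_ge0.
have rF1 h : \sum_i hnorm (adj (dilate r F i) h) ^+ 2 <= hnorm h ^+ 2.
  apply: le_trans (rF h) _; rewrite -[leRHS]mul1r ler_wpM2r ?sqr_ge0//.
  by rewrite expr2; nra.
have [cA sA nA] := row_defect_contraction rF1.
set A := \sum_i _ in cA sA nA; pose Dl := opsqrt (idop H - A).
have sDl : adj Dl = Dl by have [] := opsqrt_positive cA sA.
have nDl h : hnorm (Dl h) ^+ 2 = hnorm h ^+ 2 - \sum_i hnorm (adj (dilate r F i) h) ^+ 2.
  by rewrite /Dl hnorm_opsqrt// nA.
have [G hG] := ball_norm_sum (ltW r0) rF c r1.
exists G => // x.
pose K := poisson (dilate r F) Dl.
have Kiso h : hnorm (K h) = hnorm h.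
  have q0 : cp_form (dilate r F) m h @[m --> \oo] --> (0 : R).
    apply: (@squeeze_cvgr _ _ _ _ (fun=> 0) (fun m => (r ^+ m) ^+ 2 * hnorm h ^+ 2)).
    - by apply: nearW => m; rewrite cp_form_ge0 cp_form_le// ltW.
    - exact: cvg_cst.
    - rewrite -[X in _ --> X](mul0r (hnorm h ^+ 2)); apply: cvgMl.
      rewrite -[X in _ --> X](mul0r (0 : R)).
      under eq_fun do rewrite expr2.
      by apply: cvgM; apply: cvg_expr; rewrite ger0_norm ?ltW.
  have e := cvg_unique (@Rhausdorff R) (@poisson_norm R n H (dilate r F) Dl nDl h) q0.
  apply/eqP; rewrite -(@eqrXn2 _ 2)// ?hnorm_ge0//; apply/eqP.
  by apply/esym/eqP; rewrite -subr_eq0 e.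
have KK := isometry_adj Kiso.
rewrite -{1}(KK x) -(poisson_tens sDl nDl hM (or_introl (norm_sum_sot hG))).
rewrite -[leRHS]mul1r; apply: le_trans (@adj_bound _ _ _ K 1 ler01 _ _) _.
  by move=> h; rewrite mul1r Kiso.
by rewrite !mul1r -(Kiso x); exact: tens_bound.
Qed.

End RightMultiplication.

(** * Transfer functions of contractions *)

Section Julia.
Variables (R : realType) (X Y : hilbertType R).
Local Notation C := R[i]%C.

(** This is the isometry of the Julia operator of the contraction [F]: the cross
    terms cancel because the defects are intertwined by [F]. *)
Lemma julia (F : bop X Y) (Dl : bop Y Y) (Ds : bop X X) : adj Dl = Dl ->
  (forall x, hnorm (Ds x) ^+ 2 = hnorm x ^+ 2 - hnorm (F x) ^+ 2) ->
  (forall y, hnorm (Dl y) ^+ 2 = hnorm y ^+ 2 - hnorm (adj F y) ^+ 2) ->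
  (forall x, F (Ds x) = Dl (F x)) ->
  forall x w, hnorm (- F x + Dl w) ^+ 2 + hnorm (Ds x + adj F w) ^+ 2 =
    hnorm x ^+ 2 + hnorm w ^+ 2.
Proof.
move=> sDl nDs nDl FD x w; rewrite !hnormDsq hnormN nDs nDl rinNl.
by rewrite -(rin_adj F) FD (rin_adj Dl) sDl !mulr2n; ring.
Qed.

Variables (F : bop X Y) (Dl : bop Y Y) (Ds : bop X X) (L : bop X Y).
Hypotheses (sDl : adj Dl = Dl) (sDs : adj Ds = Ds)
  (nDs : forall x, hnorm (Ds x) ^+ 2 = hnorm x ^+ 2 - hnorm (F x) ^+ 2)
  (nDl : forall y, hnorm (Dl y) ^+ 2 = hnorm y ^+ 2 - hnorm (adj F y) ^+ 2)
  (FD : forall x, F (Ds x) = Dl (F x))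
  (Liso : forall x, hnorm (L x) = hnorm x).

Let cF x : hnorm (adj F x) <= hnorm x.
Proof.
by rewrite -hnorm_le_sq ?hnorm_ge0//; have := nDl x; have := sqr_ge0 (hnorm (Dl x)); lra.
Qed.

(** With input [x], the state [w] solves [w = r L (Ds x + F^* w)], and the output of
    the transfer function is [- F x + Dl w]. *)
Definition transfer_state (r : R) : bop X Y :=
  bcomp (opinv (idop Y - r%:C%C *: bcomp L (adj F))) (bcomp (r%:C%C *: L) Ds).

Definition transfer (r : R) : bop X Y := - F + bcomp Dl (transfer_state r).

Lemma resolvent (r : R) : 0 < r < 1 ->
  bcomp (idop Y - r%:C%C *: bcomp L (adj F)) (opinv (idop Y - r%:C%C *: bcomp L (adj F))) = idop Y
  /\ bcomp (opinv (idop Y - r%:C%C *: bcomp L (adj F))) (idop Y - r%:C%C *: bcomp L (adj F)) = idop Y.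
Proof.
move=> /andP[r0 r1].
have [||B [h1 h2]] := @neumann _ Y (r%:C%C *: bcomp L (adj F)) r.
- by rewrite r1 ltW.
- by move=> x; rewrite bopZE bcompE hnormZr Liso gtr0_norm// ler_pM2l.
exact: opinvP h1 h2.
Qed.

Lemma transfer_stateE r x : 0 < r < 1 ->
  transfer_state r x = r%:C%C *: L (Ds x + adj F (transfer_state r x)).
Proof.
move=> /resolvent[h _]; set w := transfer_state r x.
have := congr1 (fun A : bop Y Y => A (r%:C%C *: L (Ds x))) h.
rewrite bcompE -/(transfer_state r x) idopE => e.
have {}e : w - r%:C%C *: L (adj F w) = r%:C%C *: L (Ds x) := e.
by rewrite bopxD scalerDr -e subrK.
Qed.

Lemma transfer_state_uniq r x w : 0 < r < 1 ->
  w = r%:C%C *: L (Ds x + adj F w) -> w = transfer_state r x.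
Proof.
move=> /resolvent[_ h] wE.
have := congr1 (fun A : bop Y Y => A w) h; rewrite bcompE idopE => <-.
rewrite /transfer_state !bcompE; congr (opinv _ _).
by rewrite bopBE idopE !bopZE bcompE {1}wE bopxD scalerDr addrK.
Qed.

(** The Julia operator maps [(x, w)] to the output and [u = Ds x + F^* w], and
    [|w| = r |u|]. *)
Lemma transfer_energy r x : 0 < r < 1 ->
  hnorm (transfer r x) ^+ 2 =
    hnorm x ^+ 2 - (1 - r ^+ 2) * hnorm (Ds x + adj F (transfer_state r x)) ^+ 2.
Proof.
move=> r01; have /andP[r0 r1] := r01.
have := julia sDl nDs nDl FD x (transfer_state r x).
rewrite {3}transfer_stateE// hnormZr Liso gtr0_norm// exprMn.
by rewrite /transfer bopDE bopNE bcompE; lra.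
Qed.

Lemma transfer_contraction r x : 0 < r < 1 -> hnorm (transfer r x) <= hnorm x.
Proof.
move=> r01; rewrite -hnorm_le_sq ?hnorm_ge0// transfer_energy// gerBl.
have /andP[r0 r1] := r01.
by rewrite mulr_ge0 ?sqr_ge0// expr2; nra.
Qed.

(** In the state [w = r L u], the norm of [u] is at most [(1 - r^2)^(-1/2) |x|],
    so replacing [r] by [1] in the pairing with a solution [v] of the adjoint
    equation costs at most a multiple of [(1 - r)^(1/2)]. *)
Lemma transfer_pairing x z v : v = Dl z + F (adj L v) ->
  rin (transfer r x) z @[r --> 1^'-] --> rin x (- adj F z + Ds (adj L v)).
Proof.
move=> vE; pose u r := Ds x + adj F (transfer_state r x).
have e r : 0 < r < 1 -> rin (transfer r x) z =
    rin x (- adj F z + Ds (adj L v)) - (1 - r) * rin (u r) (adj L v).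
  move=> r01; rewrite /transfer bopDE bopNE bcompE !rinE -rin_adj.
  have -> : rin (Dl (transfer_state r x)) z = rin (transfer_state r x) v
      - rin (adj F (transfer_state r x)) (adj L v).
    have Dz : Dl z = v - F (adj L v) by rewrite {1}vE addrK.
    by rewrite rin_adj sDl Dz rinBr (rin_adj' F).
  rewrite {1}transfer_stateE// -/(u r) rinZl.
  have -> : adj F (transfer_state r x) = u r - Ds x by rewrite /u addrC addKr.
  move: (u r) => ur; rewrite (rinBl ur) (rin_adj L) (rin_adj Ds) sDs; ring.
pose c := hnorm (adj L v).
have bnd r : 0 < r < 1 -> `|(1 - r) * rin (u r) (adj L v)| ^+ 2 <= (1 - r) * (hnorm x ^+ 2 * c ^+ 2).
  move=> r01; have /andP[r0 r1] := r01.
  have h1 : (1 - r ^+ 2) * hnorm (u r) ^+ 2 <= hnorm x ^+ 2.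
    by have := transfer_energy x r01; rewrite -/(u r); have := sqr_ge0 (hnorm (transfer r x)); lra.
  have h2 : `|rin (u r) (adj L v)| ^+ 2 <= hnorm (u r) ^+ 2 * c ^+ 2.
    by rewrite -exprMn lerXn2r ?nnegrE ?mulr_ge0 ?hnorm_ge0// rin_CS.
  rewrite normrM exprMn ger0_norm; last lra.
  have h3 : (1 - r) ^+ 2 * hnorm (u r) ^+ 2 <= (1 - r) * hnorm x ^+ 2.
    have -> : (1 - r) ^+ 2 * hnorm (u r) ^+ 2 = (1 - r) * ((1 - r) * hnorm (u r) ^+ 2) by ring.
    rewrite ler_wpM2l//; first by lra.
    apply: le_trans h1; rewrite ler_wpM2r ?sqr_ge0//; rewrite expr2; nra.
  apply: le_trans (ler_wpM2l (sqr_ge0 _) h2) _.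
  by rewrite mulrA [leRHS]mulrA ler_wpM2r ?sqr_ge0.
apply/cvgrPdist_lt => eps e0.
set b := hnorm x ^+ 2 * c ^+ 2 in bnd.
have b0 : 0 <= b by rewrite mulr_ge0 ?sqr_ge0.
have b1 : 0 < b + 1 by lra.
have d1 : 1 - eps ^+ 2 / (b + 1) < 1 by rewrite gtrBl divr_gt0 ?exprn_gt0.
apply: filterS2 (at_left1 (ltr01 : 0 < 1 :> R)) (at_left1 d1) => r r01 /andP[rd _].
rewrite e// opprB addrC subrK.
rewrite -(@ltr_pXn2r _ 2)// ?nnegrE ?(ltW e0)//.
apply: le_lt_trans (bnd r r01) _.
have h : (1 - r) * (b + 1) < eps ^+ 2.
  by rewrite -ltr_pdivlMr//; move: rd; set q := eps ^+ 2 / _; lra.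
by have /andP[_ r1] := r01; nra.
Qed.

(** The image of the state at [t] solves the equation of the state at [s t]. *)
Lemma transfer_intertwine (GX : bop X X) (GY : bop Y Y) (s t : R) x :
  0 < t < 1 -> 0 < s * t < 1 ->
  (forall u, GY (L u) = s%:C%C *: L (GX u)) -> (forall u, GX (Ds u) = Ds (GX u)) ->
  (forall y, GX (adj F y) = adj F (GY y)) -> (forall u, GY (F u) = F (GX u)) ->
  (forall y, GY (Dl y) = Dl (GY y)) ->
  GY (transfer t x) = transfer (s * t) (GX x).
Proof.
move=> t01 st01 cL cDs cF' cF'' cDl.
have e : GY (transfer_state t x) = transfer_state (s * t) (GX x).
  apply: transfer_state_uniq => //; rewrite {1}transfer_stateE// bopxZ cL bopxD cDs cF'.
  by rewrite scalerA -rmorphM/= mulrC.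
by rewrite /transfer !bopDE !bopNE !bcompE bopxD bopxN cF'' cDl e.
Qed.

End Julia.

(** * Creation operators *)

Section LeftCreation.
Variables (R : realType) (n : nat).
Local Notation C := R[i]%C.
Implicit Types V W H : hilbertType R.

Definition uncons (i : 'I_n) (w : word n) : option (word n) :=
  if w is k :: u then if k == i then Some u else None else None.

Lemma uncons_inj i (j j' w : word n) : uncons i j = Some w -> uncons i j' = Some w -> j = j'.
Proof. by case: j j' => [|k u] [|k' u'] //=; do 2![case: eqP => // ->]; move=> [->] [->]. Qed.

(** Left creation operators: [f_a |-> f_i f_a]. *)
Definition lcreate V i : bop (ell2 (word n) V) (ell2 (word n) V) := push V (uncons i).

Lemma lcreate_nil V i x : lcreate V i x [::] = 0.
Proof. by rewrite /lcreate pushE//; exact: uncons_inj. Qed.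

Lemma lcreate_cons V i x j w : lcreate V i x (j :: w) = if j == i then x w else 0.
Proof. by rewrite /lcreate pushE; [rewrite /=; case: ifP|exact: uncons_inj]. Qed.

Lemma lcreate_emb V i w v : lcreate V i (emb V w v) = emb V (i :: w) v.
Proof.
apply: ell2P_ext => -[|j u]; first by rewrite lcreate_nil embE.
by rewrite lcreate_cons !embE eqseq_cons; case: (j == i).
Qed.

Lemma adj_lcreate V i x w : adj (lcreate V i) x w = x (i :: w).
Proof. by apply: inner_inj => v; rewrite -inner_emb -adjP lcreate_emb inner_emb. Qed.

Lemma lcreate_rcreate V i j x : lcreate V i (rcreate V j x) = rcreate V j (lcreate V i x).
Proof.
have e : bcomp (lcreate V i) (rcreate V j) = bcomp (rcreate V j) (lcreate V i).
  by apply: ell2_ext => w v; rewrite !bcompE rcreate_emb !lcreate_emb rcreate_emb.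
exact: (congr1 (fun A : bop _ _ => A x) e).
Qed.

Lemma tens_lcreate V W (B : bop V W) i : tens (lcreate C i) B = bcomp (lcreate W i) (ampl _ B).
Proof.
apply: tens_uniq => c v; rewrite bcompE ampl_ptens; apply: ell2P_ext => -[|j u].
  by rewrite lcreate_nil ptensE lcreate_nil scale0r.
by rewrite lcreate_cons !ptensE lcreate_cons; case: ifP => //; rewrite scale0r.
Qed.

Lemma tens_rcreate V W (B : bop V W) (i : 'I_n) :
  tens (rcreate C i) B = bcomp (rcreate W i) (ampl _ B).
Proof.
apply: tens_uniq => c v; rewrite bcompE ampl_ptens; apply: ell2P_ext => w.
case/lastP: w => [|w j]; first by rewrite rcreate_nil ptensE rcreate_nil scale0r.
by rewrite rcreate_rcons !ptensE rcreate_rcons; case: ifP => //; rewrite scale0r.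
Qed.

Lemma ampl_lcreate V W (B : bop V W) i x :
  ampl _ B (lcreate V i x) = lcreate W i (ampl _ B x).
Proof.
apply: ell2P_ext => -[|j u]; rewrite amplE ?lcreate_nil ?lcreate_cons ?bopx0//.
by case: ifP; rewrite ?amplE ?bopx0.
Qed.

Lemma lcreate_sum V (x : ell2 (word n) V) :
  x = emb V [::] (x [::]) + \sum_i lcreate V i (adj (lcreate V i) x).
Proof.
apply: ell2P_ext => -[|j u]; rewrite ell2DE ell2_sumE embE /=.
  by rewrite big1 ?addr0// => i _; rewrite lcreate_nil.
rewrite add0r (bigD1 j)//= big1 ?addr0; last first.
  by move=> i ij; rewrite lcreate_cons eq_sym (negbTE ij).
by rewrite lcreate_cons eqxx adj_lcreate.
Qed.

Lemma adj_lcreateK V i j x : adj (lcreate V i) (lcreate V j x) = if i == j then x else 0.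
Proof.
by apply: ell2P_ext => w; rewrite adj_lcreate lcreate_cons; case: ifP.
Qed.

Lemma hnorm_lcreate V i x : hnorm (lcreate V i x) = hnorm x.
Proof.
by apply/eqP; rewrite -(@eqrXn2 _ 2)// ?hnorm_ge0// -!rinn rin_adj adj_lcreateK eqxx.
Qed.

Lemma rin_suml V (I : Type) (s : seq I) (F : I -> V) y :
  rin (\sum_(i <- s) F i) y = \sum_(i <- s) rin (F i) y.
Proof. by elim/big_rec2: _ => [|i z1 z2 _ <-]; rewrite ?rin0l ?rinDl. Qed.

Lemma lcreate_row V (x : ell2 (word n) V) :
  \sum_i hnorm (adj (lcreate V i) x) ^+ 2 <= hnorm x ^+ 2.
Proof.
rewrite -(rinn x) {2}(lcreate_sum x) rinDl rin_emb rinn rin_suml.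
under [X in _ <= _ + X]eq_bigr do rewrite rin_adj rinn.
by rewrite lerDr sqr_ge0.
Qed.

Lemma word_op_lcreate V a b v : word_op (fun i => lcreate V i) a (emb V b v) = emb V (a ++ b) v.
Proof. by elim: a => [|i a IH] //; rewrite word_opS IH lcreate_emb. Qed.

(** The row of the right creation operators, applied to the components of a family
    indexed by the letters: [f_a (x) (y_i)_i |-> sum_i f_a f_i (x) y_i]. *)
Definition rcreate_row V : bop (ell2 (word n) (ell2 'I_n V)) (ell2 (word n) V) :=
  \sum_i bcomp (rcreate V i) (ampl _ (coord V i)).

Lemma rcreate_row_rcons V x w i : rcreate_row V x (rcons w i) = x w i.
Proof.
rewrite /rcreate_row bop_sumE ell2_sumE (bigD1 i)// bcompE rcreate_rcons eqxx amplE.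
rewrite big1 => [|j /andP[_ ji]]; first exact: addr0.
by rewrite bcompE rcreate_rcons eq_sym (negbTE ji).
Qed.

Lemma rcreate_row_nil V x : rcreate_row V x [::] = 0.
Proof.
by rewrite /rcreate_row bop_sumE ell2_sumE big1// => j _; rewrite bcompE rcreate_nil.
Qed.

Lemma rcreate_row_emb V w x i : rcreate_row V (emb _ w (emb V i x)) = emb V (rcons w i) x.
Proof.
apply: ell2P_ext => u; case/lastP: u => [|u j].
  by rewrite rcreate_row_nil embE; case: w.
rewrite rcreate_row_rcons !embE eqseq_rcons; case: (u == w) => /=; last by [].
by rewrite embE.
Qed.

Lemma adj_rcreate_row V x w i : adj (rcreate_row V) x w i = x (rcons w i).
Proof.
apply: inner_inj => v.
transitivity (inner (emb _ w (emb V i v)) (adj (rcreate_row V) x)); first by rewrite !inner_emb.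
by rewrite -adjP rcreate_row_emb inner_emb.
Qed.

Lemma rcreate_row_iso V x : hnorm (rcreate_row V x) = hnorm x.
Proof.
apply/eqP; rewrite -(@eqrXn2 _ 2)// ?hnorm_ge0// -!rinn rin_adj; apply/eqP; congr rin.
apply: ell2P_ext => w; apply: ell2P_ext => i.
by rewrite adj_rcreate_row rcreate_row_rcons.
Qed.

Lemma hnorm_adj_rcreate_row V y :
  hnorm y ^+ 2 = hnorm (adj (rcreate_row V) y) ^+ 2 + hnorm (y [::]) ^+ 2.
Proof.
have e : y = rcreate_row V (adj (rcreate_row V) y) + emb V [::] (y [::]).
  apply: ell2P_ext => w; rewrite ell2DE embE; case/lastP: w => [|w j].
    by rewrite rcreate_row_nil add0r.
  rewrite rcreate_row_rcons adj_rcreate_row.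
  by have -> : (rcons w j == [::]) = false; [case: w|rewrite addr0].
rewrite {1}e hnormDsq rcreate_row_iso hnorm_emb rin_emb' rcreate_row_nil rin0l.
by rewrite mul0rn addr0.
Qed.

Lemma dil_rcreate_row V r x : 0 <= r <= 1 ->
  dil n V r (rcreate_row V x) = r%:C%C *: rcreate_row V (dil n _ r x).
Proof.
move=> r01; apply: ell2P_ext => w; rewrite ell2ZE (dilP _ _ r01).1; case/lastP: w => [|w j].
  by rewrite !rcreate_row_nil !scaler0.
by rewrite !rcreate_row_rcons (dilP _ _ r01).1 ell2ZE scalerA -rmorphM/= size_rcons exprS.
Qed.

Lemma dil_ampl V W (B : bop V W) r x : 0 <= r <= 1 ->
  dil n W r (ampl _ B x) = ampl _ B (dil n V r x).
Proof.
by move=> r01; apply: ell2P_ext => w; rewrite amplE !(dilP _ _ r01).1 amplE bopxZ.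
Qed.

Lemma dil_emb V r w v : 0 <= r <= 1 -> dil n V r (emb V w v) = (r ^+ size w)%:C%C *: emb V w v.
Proof.
move=> r01; apply: ell2P_ext => u; rewrite (dilP _ _ r01).1 ell2ZE !embE.
by case: eqP => [->|]; rewrite ?scaler0.
Qed.

End LeftCreation.

(** * The characteristic function and its relation with the Poisson kernel *)

Section AmplifiedDefects.
Variables (R : realType) (I : countType).
Implicit Types V W : hilbertType R.

Lemma ampl_defect V W (D : bop V V) (A : bop V W) :
  (forall x, hnorm (D x) ^+ 2 = hnorm x ^+ 2 - hnorm (A x) ^+ 2) ->
  forall x, hnorm (ampl I D x) ^+ 2 = hnorm x ^+ 2 - hnorm (ampl I A x) ^+ 2.
Proof.
move=> h x.
have pol y z : rin (D y) (D z) = rin y z - rin (A y) (A z).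
  have := h (y + z); rewrite !bopxD !hnormDsq !h !mulr2n; lra.
have e y : adj D (D y) = y - adj A (A y).
  by apply: rin_inj => z; rewrite rinBl -!rin_adj' pol.
rewrite -!rinn !rin_adj !ampl_adj -rinBr; congr (rin _ _).
by apply: ell2P_ext => i; rewrite ell2DE ell2NE !amplE e.
Qed.

Lemma ampl_incl V (S : closed_subspace V) (y : ell2 I V) : (forall i, cs_set S (y i)) ->
  ampl I (incl S) (adj (ampl I (incl S)) y) = y.
Proof.
by move=> h; apply: ell2P_ext => i; rewrite ampl_adj !amplE incl_adj.
Qed.

Lemma hnorm_ampl_incl V (S : closed_subspace V) (y : ell2 I (subsp S)) :
  hnorm (ampl I (incl S) y) = hnorm y.
Proof.
apply/eqP; rewrite -(@eqrXn2 _ 2)// ?hnorm_ge0// -!rinn rin_adj; apply/eqP; congr (rin _ _).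
by apply: ell2P_ext => i; rewrite ampl_adj !amplE adj_incl.
Qed.

Lemma ampl_incl_inj V (S : closed_subspace V) (y z : ell2 I (subsp S)) :
  ampl I (incl S) y = ampl I (incl S) z -> y = z.
Proof.
move=> e; apply/eqP; rewrite -subr_eq0; apply/eqP/hnorm_eq0.
by rewrite -hnorm_ampl_incl bopxB e subrr hnorm0.
Qed.

Lemma clran_mem V W (A : bop V W) x : cs_set (clran A) (A x).
Proof. by apply: subset_closure; exists x. Qed.

Lemma clran_map V W V' W' (A : bop V W) (A' : bop V' W') (X : bop W W') (Y : V -> V') :
  (forall x, X (A x) = A' (Y x)) -> forall w, cs_set (clran A) w -> cs_set (clran A') (X w).
Proof.
move=> h w /hclosureP hw; apply/hclosureP => e e0.
have [c c0 hc] := bop_bounded X; have c1 : 0 < c + 1 by rewrite ltr_wpDl.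
have [_ [x _ <-] d] := hw _ (divr_gt0 e0 c1).
exists (A' (Y x)); first by exists (Y x).
rewrite -h -bopxB; apply: le_lt_trans (hc _) _.
have : hnorm (w - A x) * (c + 1) < e by rewrite -ltr_pdivlMr.
have := hnorm_ge0 (w - A x); nra.
Qed.

End AmplifiedDefects.

Section PowerLimits.
Variable R : realType.

Lemma powV_cvg1 j : (t ^+ j)^-1 @[t --> (1 : R)^'-] --> (1 : R).
Proof. by rewrite -[X in _ --> X]invr1; apply: cvgV; [exact: oner_neq0|exact: exp_cvg1]. Qed.

Lemma pow_div_cvg1 i j : (t ^+ i / t ^+ j) ^+ 2 @[t --> (1 : R)^'-] --> (1 : R).
Proof.
have c1 : (t ^+ i / t ^+ j) @[t --> (1 : R)^'-] --> (1 : R).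
  by rewrite -[X in _ --> X](mul1r (1 : R)); apply: cvgM; [exact: exp_cvg1|exact: powV_cvg1].
rewrite -[X in _ --> X](mul1r (1 : R)).
have -> : (fun t : R => (t ^+ i / t ^+ j) ^+ 2) = (fun t => (t ^+ i / t ^+ j) * (t ^+ i / t ^+ j)).
  by apply/funext => t; rewrite expr2.
exact: cvgM.
Qed.

(** The dilations of ratios [t] and [1/2] differ by the factor [(2 t)^-1]. *)
Lemma half_gauge (t : R) i j : 0 < t ->
  (2 * t)^-1 ^+ i * (t ^+ i / t ^+ j * (2 ^+ i / 2 ^+ j)) = (2 * t)^-1 ^+ j.
Proof.
move=> t0; have t0' : t != 0 by rewrite gt_eqF.
have t2 : (2 : R) != 0 by rewrite pnatr_eq0.
rewrite !exprVn !exprMn !invfM.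
have ti : t ^+ i != 0 by exact: expf_neq0.
have tj : t ^+ j != 0 by exact: expf_neq0.
have ti2 : (2 : R) ^+ i != 0 by exact: expf_neq0.
have tj2 : (2 : R) ^+ j != 0 by exact: expf_neq0.
by move: (t ^+ i) (t ^+ j) (2 ^+ i) (2 ^+ j) ti tj ti2 tj2 => a b c d a0 b0 c0 d0; field; rewrite ?a0 ?b0 ?c0 ?d0.
Qed.

Lemma half_range (t : R) : 2^-1 < t -> t < 1 -> 0 < (2 * t)^-1 < 1.
Proof.
move=> h1 h2; have t0 : 0 < t by lra.
by rewrite invr_gt0 mulr_gt0//= invf_lt1 ?mulr_gt0//; lra.
Qed.

Lemma half_cancel (t : R) : 0 < t -> (2 * t)^-1 * t = 2^-1.
Proof. by move=> t0; field; rewrite gt_eqF. Qed.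

Lemma scale_cancel (V : hilbertType R) (a b c d : R) (u v : V) : a != 0 ->
  a%:C%C *: u = b%:C%C *: v -> a * (c * d) = b -> u = c%:C%C *: (d%:C%C *: v).
Proof.
move=> a0 e eb.
have a0' : a%:C%C != 0 :> R[i]%C.
  by apply/eqP => /(congr1 (@complex.Re R)) /= h; rewrite h eqxx in a0.
by apply: (scalerI a0'); rewrite e -eb !scalerA !rmorphM mulrA.
Qed.

End PowerLimits.

Section CharacteristicFunction.
Variables (R : realType) (n : nat) (f : 'I_n -> pser R n) (H : hilbertType R)
  (T : 'I_n -> bop H H).
Local Notation C := R[i]%C.
Local Notation F := (feval f T).
Local Notation row := (row_op F).
Local Notation Dl := (Delta f T).
Local Notation Ds := (Delta_star f T).
Local Notation W := (word n).
Local Notation Hn := (ell2 'I_n H).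
Hypothesis hF : forall h, \sum_i hnorm (adj (F i) h) ^+ 2 <= hnorm h ^+ 2.

Lemma row_contraction : contraction row.
Proof.
move=> x; rewrite -[leRHS]mul1r.
by apply: (row_boundP F ler01).1 => h; rewrite expr1n mul1r.
Qed.

Let A2 := bcomp (adj row) row.

Let cA2 : contraction A2.
Proof.
move=> x; apply: le_trans (row_contraction x).
rewrite -[leRHS]mul1r; apply: adj_bound => // y; rewrite mul1r; exact: row_contraction.
Qed.

Let sA2 : adj A2 = A2. Proof. by rewrite /A2 adj_comp adjK. Qed.

Lemma Delta_adj : adj Dl = Dl.
Proof. by have [cA sA _] := row_defect_contraction hF; have [] := opsqrt_positive cA sA. Qed.

Lemma Delta_star_adj : adj Ds = Ds.
Proof. by have [] := opsqrt_positive cA2 sA2. Qed.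

Lemma hnorm_Delta h : hnorm (Dl h) ^+ 2 = hnorm h ^+ 2 - \sum_i hnorm (adj (F i) h) ^+ 2.
Proof. by have [cA sA nA] := row_defect_contraction hF; rewrite /Delta hnorm_opsqrt// nA. Qed.

Lemma hnorm_Delta_row h : hnorm (Dl h) ^+ 2 = hnorm h ^+ 2 - hnorm (adj row h) ^+ 2.
Proof. by rewrite hnorm_Delta hnorm_adj_row. Qed.

Lemma hnorm_Delta_star x : hnorm (Ds x) ^+ 2 = hnorm x ^+ 2 - hnorm (row x) ^+ 2.
Proof. by rewrite /Delta_star (hnorm_opsqrt cA2 sA2) bcompE -rin_adj' rinn. Qed.

Lemma row_Delta x : row (Ds x) = Dl (row x).
Proof.
have [cA sA _] := row_defect_contraction hF.
apply: (opsqrt_comm cA2 sA2 cA sA).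
by apply: bop_ext => y; rewrite -row_op_adj.
Qed.

Lemma adj_row_Delta h : adj row (Dl h) = Ds (adj row h).
Proof.
have [cA sA _] := row_defect_contraction hF.
apply: (opsqrt_comm cA sA cA2 sA2).
by apply: bop_ext => y; rewrite -row_op_adj.
Qed.

Local Notation arow := (ampl W row).
Local Notation aDl := (ampl W Dl).
Local Notation aDs := (ampl W Ds).
Local Notation L := (rcreate_row n H).
Local Notation Tr := (transfer arow aDl aDs L).

Let asDl : adj aDl = aDl. Proof. by rewrite ampl_adj Delta_adj. Qed.
Let asDs : adj aDs = aDs. Proof. by rewrite ampl_adj Delta_star_adj. Qed.
Let anDs x : hnorm (aDs x) ^+ 2 = hnorm x ^+ 2 - hnorm (arow x) ^+ 2.
Proof. by apply: ampl_defect; exact: hnorm_Delta_star. Qed.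
Let anDl y : hnorm (aDl y) ^+ 2 = hnorm y ^+ 2 - hnorm (adj arow y) ^+ 2.
Proof. by rewrite ampl_adj; apply: ampl_defect; exact: hnorm_Delta_row. Qed.
Let aFD x : arow (aDs x) = aDl (arow x).
Proof. by apply: ell2P_ext => w; rewrite !amplE row_Delta. Qed.
Let Liso x : hnorm (L x) = hnorm x. Proof. exact: rcreate_row_iso. Qed.

Lemma Theta_dilE r : Theta_dil f T r = Tr r.
Proof.
rewrite /Theta_dil !tens_idop.
have -> : \sum_i tens (Lambda R i) (adj (F i)) = bcomp L (adj arow).
  apply: bop_ext => x; rewrite bop_sumE bcompE /rcreate_row bop_sumE; apply: eq_bigr => i _.
  rewrite LambdaE tens_rcreate !bcompE; congr (rcreate H i _).
  by apply: ell2P_ext => w; rewrite ampl_adj !amplE coordE adj_row_op.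
have -> // : \sum_i tens (Lambda R i) (coord H i) = L.
by rewrite /rcreate_row; apply: eq_bigr => i _; rewrite LambdaE tens_rcreate.
Qed.

(** Gauge invariance: dilating the space replaces the right creation operators by
    multiples of themselves. *)
Lemma Tr_dil s t x : 0 < s < 1 -> 0 < t < 1 -> dil n H s (Tr t x) = Tr (s * t) (dil n Hn s x).
Proof.
move=> /andP[s0 s1] t01; have /andP[t0 t1] := t01.
have s01 : 0 <= s <= 1 by rewrite !ltW.
apply: transfer_intertwine => //.
- by apply/andP; split; nra.
- by move=> u; exact: dil_rcreate_row.
- by move=> u; exact: dil_ampl.
- by move=> y; rewrite ampl_adj dil_ampl.
- by move=> u; exact: dil_ampl.
- by move=> u; exact: dil_ampl.
Qed.

(** On a vector [f_a (x) y], the gauge relation between [t] and [1/2] makes the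
    coordinate [w] of the transfer function equal to [t^(|w| - |a|)] times a constant
    [zeta w]; the contractivity for all [t] makes [zeta] square summable. *)
Lemma Tr_emb_cvg a y : exists z : ftens n H, Tr t (emb Hn a y) @[t --> 1^'-] --> z.
Proof.
set x := emb Hn a y.
have h01 : 0 < (2^-1 : R) < 1 by apply/andP; split; lra.
pose zeta (w : W) : H := (2 ^+ size w / 2 ^+ size a)%:C%C *: Tr 2^-1 x w.
have TrE t w : 2^-1 < t < 1 -> Tr t x w = (t ^+ size w / t ^+ size a)%:C%C *: zeta w.
  move=> /andP[t2 t1]; have t0 : 0 < t by apply: lt_trans t2; rewrite invr_gt0.
  have s01 := half_range t2 t1; have e := half_gauge (size w) (size a) t0.
  have := Tr_dil x s01 (introT andP (conj t0 t1)); rewrite half_cancel//.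
  move: s01 e; move: ((2 * t)^-1) => s s01 e.
  have s0 : 0 < s by exact: (proj1 (andP s01)).
  have s01' : 0 <= s <= 1 by have /andP[? ?] := s01; rewrite !ltW.
  rewrite /x (dil_emb _ _ s01') bopxZ => /(congr1 (fun z : ell2 _ _ => z w)).
  rewrite (dilP _ _ s01').1 ell2ZE -/x => e'.
  have q0 : s ^+ size w != 0 by apply: expf_neq0; exact: lt0r_neq0.
  exact: (scale_cancel q0 e' e).
have zsq s : uniq s -> \sum_(w <- s) hnorm (zeta w) ^+ 2 <= hnorm x ^+ 2.
  move=> us.
  have c : \sum_(w <- s) (t ^+ size w / t ^+ size a) ^+ 2 * hnorm (zeta w) ^+ 2 @[t --> 1^'-] -->
     \sum_(w <- s) hnorm (zeta w) ^+ 2.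
    elim: (s) => [|w s' IH].
      by under eq_fun do rewrite big_nil; rewrite big_nil; exact: cvg_cst.
    under eq_fun do rewrite big_cons; rewrite big_cons; apply: cvgD IH.
    by rewrite -[X in _ --> X]mul1r; apply: cvgMl; exact: pow_div_cvg1.
  rewrite -(cvg_lim (@Rhausdorff _) c); apply: limr_le; first by apply/cvg_ex; eexists; exact: c.
  have d1 : 2^-1 < (1 : R) by lra.
  apply: filterS (at_left1 d1) => t ht; have /andP[t2 t1] := ht; have t0 : 0 < t by lra.
  apply: le_trans (_ : hnorm (Tr t x) ^+ 2 <= _); last first.
    rewrite hnorm_le_sq ?hnorm_ge0//; apply: transfer_contraction => //.
    by rewrite t0.
  apply: le_trans (ell2_fin_le _ us); apply: ler_sum => w _.
  by rewrite TrE// (hnormZr _ (zeta w)) [(`|_| * _) ^+ 2]exprMn real_normK ?num_real.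
have [z zE _] := ell2_mk zsq; exists z.
have c1 : (t ^+ size a)^-1%:C%C *: dil n H t z @[t --> 1^'-] --> z.
  apply/hcvgP => e e0.
  have e2 : 0 < e / 2 by rewrite divr_gt0.
  have /hcvgP/(_ _ e2) h1 := @dil_cvg _ n H z.
  have z1 : 0 < hnorm z + 1 by rewrite ltr_wpDl ?hnorm_ge0.
  have c2 := @powV_cvg1 R (size a).
  have /cvgrPdist_lt/(_ _ (divr_gt0 e2 z1)) h2 := c2.
  apply: filterS3 (at_left1 (ltr01 : 0 < 1 :> R)) h1 h2 => t /andP[t0 t1] h1' h2'.
  have -> : z - (t ^+ size a)^-1%:C%C *: dil n H t z =
     (z - dil n H t z) + (1 - (t ^+ size a)^-1)%:C%C *: dil n H t z.
    by rewrite rmorphB rmorph1 scalerBl scale1r addrA subrK.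
  apply: le_lt_trans (hnormD _ _) _; rewrite hnormZr (splitr e).
  have t01 : 0 <= t <= 1 by rewrite !ltW.
  have := (dilP n H t01).2 z; have h3 : `|1 - (t ^+ size a)^-1| * (hnorm z + 1) < e / 2.
    by rewrite -ltr_pdivlMr.
  have := normr_ge0 (1 - (t ^+ size a)^-1); have := hnorm_ge0 (dil n H t z).
  move: h1' h3; move: (hnorm (z - _)) (hnorm (dil n H t z)) (hnorm z) `|_| => p q r' s'; nra.
apply: cvg_trans c1; apply: near_eq_cvg.
have d1 : 2^-1 < (1 : R) by lra.
apply: filterS (at_left1 d1) => t ht; apply: ell2P_ext => w.
have /andP[t2 t1] := ht; have t01 : 0 <= t <= 1 by apply/andP; split; lra.
by rewrite ell2ZE (dilP _ _ t01).1 TrE// zE scalerA -rmorphM/= mulrC.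
Qed.

Lemma Tr_limit : exists A : bop (ftens n Hn) (ftens n H),
  forall x, Tr t x @[t --> 1^'-] --> A x.
Proof.
have Trc : \forall t \near 1^'-, forall x, hnorm (Tr t x) <= 1 * hnorm x.
  by apply: filterS (at_left1 (ltr01 : 0 < 1 :> R)) => t t01 x; rewrite mul1r; exact: transfer_contraction.
pose P (x : ftens n Hn) (z : ftens n H) := Tr t x @[t --> 1^'-] --> z.
have Plin (a : C) x y x' y' : P x y -> P x' y' -> P (a *: x + x') (a *: y + y').
  rewrite /P => hx hy.
  have -> : (fun t => Tr t (a *: x + x')) = (fun t => a *: Tr t x + Tr t x').
    by apply/funext => t; rewrite bop_linear.
  by apply: hcvgD => //; exact: hcvgZ.
have [||||A hA bA] := @bop_extend _ _ _ P 1.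
- exact: ler01.
- exact: Plin.
- by move=> x z h; apply: (hnorm_limit_le h); apply: filterS Trc => t; exact.
- move=> x e e0.
  have [|||y [z Py] h] := @dense_linear _ _ [set x | exists z, P x z] _ _ _ x e e0.
  + exists 0; rewrite /P; have -> : (fun t => Tr t 0) = (fun=> 0) by apply/funext => t; exact: bopx0.
    exact: cvg_cst.
  + by move=> a x1 x2 [z1 P1] [z2 P2]; exists (a *: z1 + z2); exact: Plin.
  + move=> y hy; apply: ell2P_ext => i; apply: inner_inj => v; rewrite inner0r.
    by rewrite -inner_emb innerC hy ?rmorph0//; exact: Tr_emb_cvg.
  by exists y, z.
exists A; apply: (ell2_sot ler01 Trc) => i v.
by have [z hz] := Tr_emb_cvg i v; rewrite (hA _ z).
Qed.

Local Notation DH := (Dspace f T).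
Local Notation DHs := (Dspace_star f T).
Local Notation iota := (ampl W (incl (clran Dl))).
Local Notation iotas := (ampl W (incl (clran Ds))).

Lemma Theta_Tr (x : ftens n DHs) : Tr t (iotas x) @[t --> 1^'-] --> iota (Theta f T x).
Proof.
have [A hA] := Tr_limit.
have mem (y : ftens n DHs) : forall w, cs_set (clran Dl) (A (iotas y) w).
  move=> w; have c : Tr t (iotas y) w @[t --> 1^'-] --> A (iotas y) w.
    exact: (@bop_cvg R _ _ _ _ _ (coord H w) _ _ (hA (iotas y))).
  apply: cs_cvg c; apply: nearW => t.
  rewrite /transfer bopDE bopNE ell2DE ell2NE bcompE !amplE.
  apply: cs_addP; last exact: clran_mem.
  by apply: cs_opp; apply: (clran_map row_Delta); apply/cs_predP; exact: subspP.
pose Th := bcomp (adj iota) (bcomp A iotas).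
have ThE y : iota (Th y) = A (iotas y).
  by rewrite !bcompE; apply: ampl_incl; exact: mem.
have ex : [set Th : bop (ftens n DHs) (ftens n DH) |
    forall x,
      Theta_dil f T r (tens (idop (H2f R n)) (incl (clran Ds)) x) @[r --> 1^'-] -->
      tens (idop (H2f R n)) (incl (clran Dl)) (Th x)] Th.
  move=> y; rewrite !tens_idop ThE.
  have -> : (fun r => Theta_dil f T r (iotas y)) = (fun r => Tr r (iotas y)).
    by apply/funext => r; rewrite Theta_dilE.
  exact: hA.
have := xgetPex 0 (ex_intro _ _ ex) x; rewrite -/(Theta f T) !tens_idop.
have -> // : (fun r => Theta_dil f T r (iotas x)) = (fun r => Tr r (iotas x)).
by apply/funext => r; rewrite Theta_dilE.
Qed.

Arguments Theta_Tr : clear implicits.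

Lemma Theta_contraction x : hnorm (Theta f T x) <= hnorm x.
Proof.
rewrite -(hnorm_ampl_incl (Theta f T x)) -(hnorm_ampl_incl x).
apply: (hnorm_limit_le (Theta_Tr x)).
apply: filterS (at_left1 (ltr01 : 0 < 1 :> R)) => t t01; exact: transfer_contraction.
Qed.

Lemma tens_ampl_comm V V' (A : bop (H2f R n) (H2f R n)) (B : bop V V') x :
  tens A (idop V') (ampl W B x) = ampl W B (tens A (idop V) x).
Proof.
have e : bcomp (tens A (idop V')) (ampl W B) = bcomp (ampl W B) (tens A (idop V)).
  rewrite -!tens_idop !tens_comp; congr (tens _ _); exact: bop_ext.
exact: (congr1 (fun X : bop _ _ => X x) e).
Qed.

(** The characteristic function is built from right creation operators, so it
    commutes with every operator that commutes with these. *)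
Lemma Theta_comm (A : bop (H2f R n) (H2f R n)) x :
  (forall j c, A (rcreate C j c) = rcreate C j (A c)) ->
  Theta f T (tens A (idop DHs) x) = tens A (idop DH) (Theta f T x).
Proof.
move=> hA; apply: (@ampl_incl_inj _ W _ (clran Dl)); rewrite -tens_ampl_comm.
have h1 := @Theta_Tr (tens A (idop DHs) x).
have h2 : tens A (idop H) (Tr t (iotas x)) @[t --> 1^'-] --> tens A (idop H) (iota (Theta f T x)).
  by apply: bop_cvg; exact: Theta_Tr.
apply: (hcvg_unique h1); apply: cvg_trans h2; apply: near_eq_cvg.
apply: filterS (at_left1 (ltr01 : 0 < 1 :> R)) => t t01.
rewrite -tens_ampl_comm -[t in RHS]mul1r.
apply: transfer_intertwine => //; rewrite ?mul1r//.
- move=> u; rewrite scale1r.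
  have e : bcomp (tens A (idop H)) L = bcomp L (tens A (idop Hn)).
    apply: bop_ext => y; rewrite !bcompE /rcreate_row !bop_sumE bopx_sum; apply: eq_bigr => i _.
    rewrite -!tens_rcreate.
    have e2 : bcomp (tens A (idop H)) (tens (rcreate C i) (coord H i)) =
        bcomp (tens (rcreate C i) (coord H i)) (tens A (idop Hn)).
      rewrite !tens_comp; congr (tens _ _); apply: bop_ext => z; rewrite !bcompE ?hA//.
    exact: (congr1 (fun X : bop _ _ => X y) e2).
  exact: (congr1 (fun X : bop _ _ => X u) e).
- by move=> u; exact: tens_ampl_comm.
- by move=> y; rewrite ampl_adj tens_ampl_comm.
- by move=> u; exact: tens_ampl_comm.
- by move=> u; exact: tens_ampl_comm.
Qed.

Definition poisson_kernel : bop H (ftens n DH) := bcomp (adj iota) (poisson F Dl).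
Local Notation K := poisson_kernel.

Lemma iota_poisson h : iota (K h) = poisson F Dl h.
Proof.
rewrite bcompE ampl_incl// => w; rewrite (poissonE hnorm_Delta).
exact: clran_mem.
Qed.

Lemma hnorm_poisson_kernel h : hnorm (K h) = hnorm (poisson F Dl h).
Proof. by rewrite -iota_poisson hnorm_ampl_incl. Qed.

Lemma adj_poisson_kernel x : adj K x = adj (poisson F Dl) (iota x).
Proof. by rewrite /poisson_kernel adj_comp adjK. Qed.

Lemma adj_poisson_kernel_emb w d : adj K (emb DH w d) = word_op F w (Dl (incl (clran Dl) d)).
Proof. by rewrite adj_poisson_kernel ampl_emb (adj_poisson_emb Delta_adj hnorm_Delta). Qed.

(** At the limit [r = 1], [Theta^* z] is the output [- F^* z + Ds L^* v] of the adjoint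
    system, whose state equation [v = Dl z + F L^* v] need not be solvable. It is for
    finitely supported [z], and then the vacuum component of [v] is [K^* z]. *)
Definition adjoint_state (z : ftens n DH) (v : ftens n H) :=
  v = aDl (iota z) + arow (adj L v) /\ v [::] = adj K z.

Let B v := arow (adj L v).

Let BE v w : B v w = \sum_i F i (v (rcons w i)).
Proof. by rewrite /B amplE row_opE; apply: eq_bigr => i _; rewrite adj_rcreate_row. Qed.

(** Shifting [z] shifts [v]; the state equation at the vacuum adds [F_i (v [::])]. *)
Lemma shift_adjoint_state i z v : adjoint_state z v ->
  adjoint_state (lcreate DH i z) (lcreate H i v + emb H [::] (F i (v [::]))).
Proof.
move=> [vE v0]; split.
  rewrite bopxD ampl_lcreate ampl_lcreate.
  have -> : adj L (emb H [::] (F i (v [::]))) = 0.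
    apply: ell2P_ext => w; apply: ell2P_ext => j.
    by rewrite adj_rcreate_row embE; case: w.
  rewrite addr0.
  have -> : arow (adj L (lcreate H i v)) = lcreate H i (B v) + emb H [::] (F i (v [::])).
    apply: ell2P_ext => -[|k w]; rewrite -/(B _) BE ell2DE embE ?lcreate_nil ?lcreate_cons.
      rewrite eqxx add0r (bigD1 i)//= lcreate_cons eqxx big1 ?addr0// => j ji.
      by rewrite lcreate_cons (negbTE ji) bopx0.
    rewrite addr0; case: eqP => [->|ki].
      by rewrite BE; apply: eq_bigr => j _; rewrite lcreate_cons eqxx.
    rewrite big1// => j _; rewrite lcreate_cons.
    by case: eqP => // _; rewrite bopx0.
  by rewrite addrA -bopxD {1}vE.
rewrite ell2DE lcreate_nil add0r embii v0.
suff e : bcomp (F i) (adj K) = bcomp (adj K) (lcreate DH i).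
  exact: (congr1 (fun X : bop _ _ => X z) e).
by apply: ell2_ext => w d; rewrite !bcompE lcreate_emb !adj_poisson_kernel_emb.
Qed.

Lemma emb_adjoint_state w d : exists v, adjoint_state (emb DH w d) v.
Proof.
elim: w => [|i w [v hv]]; last first.
  by exists (lcreate H i v + emb H [::] (F i (v [::]))); rewrite -lcreate_emb; exact: shift_adjoint_state.
exists (emb H [::] (Dl (incl (clran Dl) d))); split; last first.
  by rewrite embii adj_poisson_kernel_emb.
rewrite !ampl_emb.
have -> : adj L (emb H [::] (Dl (incl (clran Dl) d))) = 0.
  apply: ell2P_ext => w; apply: ell2P_ext => j.
  by rewrite adj_rcreate_row embE; case: w.
by rewrite bopx0 addr0.
Qed.

Lemma adjoint_state_lin a z v z' v' : adjoint_state z v -> adjoint_state z' v' ->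
  adjoint_state (a *: z + z') (a *: v + v').
Proof.
move=> [vE v0] [vE' v0']; split; last first.
  by rewrite ell2DE ell2ZE v0 v0' bop_linear.
by rewrite !bop_linear {1}vE {1}vE' scalerDr addrACA.
Qed.

Lemma adjoint_state_dense (x : ftens n DH) (e : R) : 0 < e ->
  exists z v, adjoint_state z v /\ hnorm (x - z) < e.
Proof.
move=> e0; have [|||z [v hv] h] := @dense_linear _ _ [set z | exists v, adjoint_state z v] _ _ _ x e e0.
- by exists 0; split; rewrite !bopx0 ?addr0.
- by move=> a x1 x2 [z1 P1] [z2 P2]; exists (a *: z1 + z2); exact: adjoint_state_lin.
- move=> y hy; apply: ell2P_ext => i; apply: inner_inj => d; rewrite inner0r.
  rewrite -inner_emb innerC hy ?rmorph0//; exact: emb_adjoint_state.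
by exists z, v.
Qed.

Lemma adj_Theta_state z v : adjoint_state z v ->
  iotas (adj (Theta f T) z) = - adj arow (iota z) + aDs (adj L v).
Proof.
move=> [vE _]; set y := _ + _.
have ymem w : cs_set (clran Ds) (y w).
  rewrite /y ell2DE ell2NE amplE; apply: cs_addP; last exact: clran_mem.
  apply: cs_opp; rewrite ampl_adj amplE; apply: (clran_map adj_row_Delta).
  by rewrite amplE; apply/cs_predP; exact: subspP.
suff -> : adj (Theta f T) z = adj iotas y by rewrite ampl_incl.
apply: rin_inj => x; rewrite rinC -rin_adj [RHS]rinC -rin_adj.
have e (a b : ftens n DH) : rin (iota a) (iota b) = rin a b.
  by rewrite (isometry_rin (@hnorm_ampl_incl _ W _ (clran Dl))).
rewrite -e; apply/esym.
have h1 : rin (Tr t (iotas x)) (iota z) @[t --> 1^'-] --> rin (iota (Theta f T x)) (iota z).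
  by apply: hcvg_rin; exact: Theta_Tr.
have h2 := @transfer_pairing _ _ _ arow aDl aDs L asDl asDs anDs anDl aFD Liso (iotas x) (iota z) v vE.
exact: (cvg_unique (@Rhausdorff R) h2 h1).
Qed.

(** For an adjoint state [v] of [z], the Julia operator of [F^*] gives
    [|z|^2 - |Theta^* z|^2 = |v|^2 - |L^* v|^2], which is the squared norm of the vacuum
    component [K^* z] of [v]. The density of the adjoint states yields the identity
    [I - Theta Theta^* = K K^*], here in terms of norms. *)
Lemma Theta_poisson x : hnorm x ^+ 2 - hnorm (adj (Theta f T) x) ^+ 2 = hnorm (adj K x) ^+ 2.
Proof.
have key z v : adjoint_state z v ->
    hnorm z ^+ 2 - hnorm (adj (Theta f T) z) ^+ 2 = hnorm (adj K z) ^+ 2.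
  move=> hv; have [vE v0] := hv; rewrite -v0.
  rewrite -(hnorm_ampl_incl (adj (Theta f T) z)) (adj_Theta_state hv).
  have jul := @julia _ _ _ (adj arow) aDs aDl asDs.
  have j1 y : hnorm (aDs y) ^+ 2 = hnorm y ^+ 2 - hnorm (adj (adj arow) y) ^+ 2 by rewrite adjK.
  have j2 y : adj arow (aDl y) = aDs (adj arow y).
    by rewrite ampl_adj; apply: ell2P_ext => w; rewrite !amplE adj_row_Delta.
  have := jul anDl j1 j2 (iota z) (adj L v).
  rewrite adjK -vE hnorm_ampl_incl; have := hnorm_adj_rcreate_row v.
  move: (hnorm v) (hnorm z) (hnorm (adj L v)) (hnorm (v [::])) (hnorm (- _ + _)) => a b c d e.
  lra.
have /choice[u hu] : forall k : nat, exists z, (exists v, adjoint_state z v) /\ hnorm (x - z) < k.+1%:R^-1.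
  move=> k; have [|z [v [hv h]]] := @adjoint_state_dense x k.+1%:R^-1; first by rewrite invr_gt0.
  by exists z; split => //; exists v.
have ux : u @ \oo --> x.
  apply/hcvgP => e e0; have [N] := ltr_add_invr e0; rewrite add0r => hN.
  exists N => // k /= Nk; apply: lt_trans (hu k).2 _; apply: le_lt_trans hN.
  by rewrite lef_pV2 ?posrE// ler_nat.
have sq (V : hilbertType R) (A : bop (ftens n DH) V) :
    hnorm (A (u k)) ^+ 2 @[k --> \oo] --> hnorm (A x) ^+ 2.
  have c : hnorm (A (u k)) @[k --> \oo] --> hnorm (A x) by apply: hcvg_norm; exact: bop_cvg.
  by rewrite expr2; under eq_fun do rewrite expr2; exact: cvgM.
have h1 : hnorm (u k) ^+ 2 - hnorm (adj (Theta f T) (u k)) ^+ 2 @[k --> \oo] -->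
    hnorm x ^+ 2 - hnorm (adj (Theta f T) x) ^+ 2.
  by apply: cvgB; [exact: (sq _ (idop _))|exact: sq].
apply: (cvg_unique (@Rhausdorff R) h1).
have -> : (fun k => hnorm (u k) ^+ 2 - hnorm (adj (Theta f T) (u k)) ^+ 2) =
    (fun k => hnorm (adj K (u k)) ^+ 2).
  by apply/funext => k; have [[v hv] _] := hu k; exact: key hv.
exact: sq.
Qed.

(** The adjoint state of [f_i z] has the shifted components of [v] as its
    components of positive degree, so only [v [::] = K^* z] meets the constant [d]. *)
Lemma Theta_vacuum d i z v : adjoint_state z v ->
  rin (Theta f T (emb DHs [::] d)) (lcreate DH i z) = rin (Ds (incl (clran Ds) d) i) (adj K z).
Proof.
move=> hv; rewrite rin_adj.
have e (a b : ftens n DHs) : rin a b = rin (iotas a) (iotas b).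
  by rewrite (isometry_rin (@hnorm_ampl_incl _ W _ (clran Ds))).
rewrite e (adj_Theta_state (shift_adjoint_state i hv)) ampl_emb rin_emb.
rewrite ell2DE ell2NE ampl_adj amplE ampl_lcreate lcreate_nil bopx0 oppr0 add0r amplE.
rewrite rin_adj' Delta_star_adj.
have -> : adj L (lcreate H i v + emb H [::] (F i (v [::]))) [::] = emb H i (v [::]).
  apply: ell2P_ext => j; rewrite adj_rcreate_row ell2DE !embE addr0.
  by rewrite lcreate_cons.
by rewrite rin_emb' hv.2.
Qed.

End CharacteristicFunction.

(** * Substitution in formal power series and the universal model *)

Section PowerSeriesProduct.
Variables (R : realType) (n : nat).
Local Notation C := R[i]%C.
Implicit Types p q r : pser R n.

Lemma pser_mul_nil p q : pser_mul p q [::] = p [::] * q [::].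
Proof. by rewrite /pser_mul big_ord_recl big_ord0 addr0. Qed.

Lemma pser_mul_cons p q i w :
  pser_mul p q (i :: w) = p [::] * q (i :: w) + pser_mul (fun u => p (i :: u)) q w.
Proof. by rewrite /pser_mul big_ord_recl. Qed.

Lemma pser_mul_linl (a : C) p p' q w :
  pser_mul (fun u => a * p u + p' u) q w = a * pser_mul p q w + pser_mul p' q w.
Proof.
rewrite /pser_mul mulr_sumr -big_split; apply: eq_bigr => k _.
by rewrite mulrDl mulrA.
Qed.

Lemma pser_mulA p q r w : pser_mul (pser_mul p q) r w = pser_mul p (pser_mul q r) w.
Proof.
elim: w p => [|i w IH] p; first by rewrite !pser_mul_nil mulrA.
rewrite !pser_mul_cons pser_mul_nil.
have -> : (fun u => pser_mul p q (i :: u)) =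
    (fun u => p [::] * q (i :: u) + pser_mul (fun v => p (i :: v)) q u).
  by apply/funext => u; rewrite pser_mul_cons.
by rewrite (pser_mul_linl (p [::]) (fun u => q (i :: u))) IH mulrDr mulrA addrA.
Qed.

Lemma pser_mul1l p w : pser_mul (@pser_one R n) p w = p w.
Proof.
case: w => [|i w]; first by rewrite pser_mul_nil /pser_one eqxx mul1r.
rewrite pser_mul_cons /pser_one eqxx mul1r /pser_mul big1 ?addr0// => k _.
by rewrite mul0r.
Qed.

Lemma pser_mul1r p w : pser_mul p (@pser_one R n) w = p w.
Proof.
elim: w p => [|i w IH] p; first by rewrite pser_mul_nil /pser_one eqxx mulr1.
by rewrite pser_mul_cons IH /pser_one mulr0 add0r.
Qed.

Lemma pser_mul_Zl i p w : pser_mul (@pser_Z R n i) p w =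
  if w is j :: u then if j == i then p u else 0 else 0.
Proof.
case: w => [|j w]; first by rewrite pser_mul_nil mul0r.
rewrite pser_mul_cons /pser_Z mul0r add0r.
case: (eqVneq j i) => [->|ji].
  rewrite -[RHS]pser_mul1l; congr (pser_mul _ _ _).
  by apply/funext => u; rewrite /pser_one eqseq_cons eqxx.
rewrite /pser_mul big1// => k _; rewrite eqseq_cons (negbTE ji) mul0r//.
Qed.

Variable f : 'I_n -> pser R n.

Lemma pser_word_rcons a j w : pser_word f (rcons a j) w = pser_mul (pser_word f a) (f j) w.
Proof.
elim: a w => [|i a IH] w /=; first by rewrite pser_mul1l pser_mul1r.
by rewrite pser_mulA; congr (pser_mul _ _ _); apply/funext => u; exact: IH.
Qed.

(** Partial sums of the substitution, over words rather than over lengths. *)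
Definition psubst (c : pser R n) N w := \sum_(a <- words_lt n N) c a * pser_word f a w.

Lemma is_substP c p : is_subst c f p <-> forall w, \forall N \near \oo, psubst c N w = p w.
Proof.
have e N w : \sum_(k < N) \sum_(a : k.-tuple 'I_n) c a * pser_word f a w = psubst c N w.
  by rewrite /psubst (sum_words_lt (fun a => c a * pser_word f a w)).
by split=> h w; apply: filterS (h w) => N; rewrite e.
Qed.

Lemma sum_tuple_rcons (M : nmodType) k (G : word n -> M) :
  \sum_(a : k.+1.-tuple 'I_n) G a = \sum_(i < n) \sum_(a : k.-tuple 'I_n) G (rcons a i).
Proof.
elim: k G => [|k IH] G.
  rewrite (sum_tupleS 0 G); apply: eq_bigr => i _.
  by rewrite (sum_tuple0 (fun a => G (i :: a))) (sum_tuple0 (fun a => G (rcons a i))).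
rewrite (sum_tupleS k.+1 G).
under eq_bigr do rewrite (IH (fun a => G (_ :: a))).
rewrite exchange_big; apply: eq_bigr => j _.
by rewrite (sum_tupleS k (fun a => G (rcons a j))).
Qed.

Lemma sum_words_rcons (M : nmodType) N (G : word n -> M) :
  \sum_(a <- words_lt n N.+1) G a = G [::] + \sum_(a <- words_lt n N) \sum_(i < n) G (rcons a i).
Proof.
rewrite (sum_words_lt G) big_ord_recl (sum_tuple0 G); congr (_ + _).
rewrite (sum_words_lt (fun a => \sum_(i < n) G (rcons a i))); apply: eq_bigr => k _.
by rewrite exchange_big (sum_tuple_rcons k G).
Qed.

Lemma sum_words_cons (M : nmodType) N (G : word n -> M) :
  \sum_(a <- words_lt n N.+1) G a = G [::] + \sum_(a <- words_lt n N) \sum_(i < n) G (i :: a).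
Proof.
rewrite (sum_words_lt G) big_ord_recl (sum_tuple0 G); congr (_ + _).
rewrite (sum_words_lt (fun a => \sum_(i < n) G (i :: a))); apply: eq_bigr => k _.
by rewrite exchange_big (sum_tupleS k G).
Qed.

Lemma is_subst_lin (a : C) c p c' p' : is_subst c f p -> is_subst c' f p' ->
  is_subst (fun u => a * c u + c' u) f (fun u => a * p u + p' u).
Proof.
move=> /is_substP h /is_substP h'; apply/is_substP => w.
apply: filterS2 (h w) (h' w) => N <- <-.
by rewrite /psubst mulr_sumr -big_split; apply: eq_bigr => b _; rewrite mulrDl mulrA.
Qed.

Lemma is_subst_uniq c p p' : is_subst c f p -> is_subst c f p' -> forall w, p w = p' w.
Proof.
move=> /is_substP h /is_substP h' w.
by have [N [<- <-]] := filter_ex (filterI (h w) (h' w)).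
Qed.

Lemma is_subst_rcreate (c : ell2 (word n) C) p j : is_subst (coef c) f p ->
  is_subst (coef (rcreate C j c)) f (pser_mul p (f j)).
Proof.
move=> /is_substP h; apply/is_substP => w.
have := @filter_forall nat 'I_(size w).+1 _ \oo _ (fun k => h (take k w)).
move=> [N0 _ hN0]; exists N0.+1 => // -[//|N] /= hN.
rewrite /psubst sum_words_rcons /coef rcreate_nil mul0r add0r.
have -> : \sum_(a <- words_lt n N) \sum_(i < n) rcreate C j c (rcons a i) * pser_word f (rcons a i) w
   = \sum_(a <- words_lt n N) c a * pser_mul (pser_word f a) (f j) w.
  apply: eq_bigr => a _; rewrite (bigD1 j)//= rcreate_rcons eqxx pser_word_rcons.
  by rewrite big1 ?addr0// => i ij; rewrite rcreate_rcons (negbTE ij) mul0r.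
rewrite /pser_mul; under eq_bigr do rewrite mulr_sumr.
rewrite exchange_big; apply: eq_bigr => k _.
rewrite -(hN0 N hN k) /psubst mulr_suml; apply: eq_bigr => a _.
by rewrite mulrA.
Qed.

Lemma is_subst_lcreate c p j : is_subst c f p ->
  is_subst (pser_mul (@pser_Z R n j) c) f (pser_mul (f j) p).
Proof.
move=> /is_substP h; apply/is_substP => w.
have := @filter_forall nat 'I_(size w).+1 _ \oo _ (fun k => h (drop k w)).
move=> [N0 _ hN0]; exists N0.+1 => // -[//|N] /= hN.
rewrite /psubst sum_words_cons pser_mul_Zl mul0r add0r.
have -> : \sum_(a <- words_lt n N) \sum_(i < n) pser_mul (@pser_Z R n j) c (i :: a) * pser_word f (i :: a) w
   = \sum_(a <- words_lt n N) c a * pser_mul (f j) (pser_word f a) w.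
  apply: eq_bigr => a _; rewrite (bigD1 j)//= pser_mul_Zl eqxx.
  by rewrite big1 ?addr0// => i ij; rewrite pser_mul_Zl (negbTE ij) mul0r.
rewrite /pser_mul; under eq_bigr do rewrite mulr_sumr.
rewrite exchange_big; apply: eq_bigr => k _.
rewrite -(hN0 N hN k) /psubst mulr_sumr; apply: eq_bigr => a _.
by rewrite mulrCA.
Qed.

Lemma is_subst_ext c c' p p' : (forall a, c a = c' a) -> (forall a, p a = p' a) ->
  is_subst c f p -> is_subst c' f p'.
Proof. by move=> /funext -> /funext ->. Qed.

Lemma is_subst_one : is_subst (@pser_one R n) f (@pser_one R n).
Proof.
apply/is_substP => w; exists 1%N => // -[//|N] _ /=.
rewrite /psubst sum_words_cons /= {1}/pser_one eqxx mul1r big1 ?addr0// => a _.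
by rewrite big1// => i _; rewrite mul0r.
Qed.

Lemma coef_emb1 (b w : word n) : coef (emb C b 1) w = (w == b)%:R :> C.
Proof. by rewrite /coef embE; case: eqP. Qed.

Lemma is_subst_rmul (c : ell2 (word n) C) p b : is_subst (coef c) f p ->
  is_subst (coef (rmul C b c)) f (pser_mul p (pser_word f b)).
Proof.
elim: b c p => [|j b IH] c p h.
  by apply: is_subst_ext h => a //; rewrite /= pser_mul1r.
apply: is_subst_ext (IH _ _ (is_subst_rcreate j h)) => a //.
by rewrite /= pser_mulA.
Qed.

Lemma is_subst_emb b : is_subst (coef (emb C b 1)) f (pser_word f b).
Proof.
have h : is_subst (coef (emb C [::] 1)) f (@pser_one R n).
  by apply: is_subst_ext is_subst_one => a //; rewrite coef_emb1.
have := is_subst_rmul b h; rewrite rmul_emb /=; apply: is_subst_ext => a //.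
by rewrite pser_mul1l.
Qed.

End PowerSeriesProduct.

Section Injectivity.
Variables (R : realType) (n : nat) (f : 'I_n -> pser R n).
Local Notation C := R[i]%C.

(** For polynomial automorphisms: if [c o f = 0] then [c = (c o f) o g = 0]. *)
Lemma subst_inj_poly (g : 'I_n -> pser R n) (c : pser R n) :
  (forall i, is_poly (f i)) -> (forall i, is_subst (f i) g (pser_Z R i)) ->
  is_poly c -> is_subst c f (fun=> 0) -> forall a, c a = 0.
Proof.
move=> pf fg [N0 cN] cf.
(* Products [p q] with a polynomial [p] reduce to the monomials [p = Z_a]. *)
have mulw a q Q : is_subst q g Q ->
    is_subst (pser_mul (fun u => (u == a)%:R) q) g (pser_mul (pser_word g a) Q).
  elim: a q Q => [|i a IH] q Q h.
    have e u : pser_mul (fun u => (u == [::])%:R) q u = q u := pser_mul1l q u.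
    by apply: is_subst_ext h => u; [rewrite e|rewrite /= pser_mul1l].
  apply: is_subst_ext (is_subst_lcreate i (IH _ _ h)) => u; last by rewrite /= pser_mulA.
  rewrite -pser_mulA; congr (pser_mul _ _ _); apply/funext => v; rewrite pser_mul_Zl.
  by case: v => [|j v] //; rewrite eqseq_cons; case: (j == i).
have polysum (p : pser R n) N : (forall a, (N <= size a)%N -> p a = 0) -> forall u,
    p u = \sum_(a <- words_lt n N) p a * (u == a)%:R.
  move=> pN u; have [sN|sN] := ltnP (size u) N; last first.
    rewrite pN// big_seq big1// => a; rewrite mem_words_lt => aN.
    by case: eqP => [ua|_]; rewrite ?mulr0//; move: aN; rewrite -ua ltnNge sN.
  rewrite (bigD1_seq u) ?words_lt_uniq ?mem_words_lt//= eqxx mulr1 big1 ?addr0// => a.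
  by rewrite eq_sym => /negbTE ->; rewrite mulr0.
have is_subst_sum (s : seq (word n)) (k : word n -> C) (P Q : word n -> pser R n) :
    (forall a, is_subst (P a) g (Q a)) ->
    is_subst (fun u => \sum_(a <- s) k a * P a u) g (fun u => \sum_(a <- s) k a * Q a u).
  move=> h; elim: s => [|a s IH].
    apply/is_substP => w; exists 0%N => // N _; rewrite /psubst big_nil big1// => b _.
    by rewrite big_nil mul0r.
  by apply: is_subst_ext (is_subst_lin (k a) (h a) IH) => u; rewrite big_cons.
have mulp (p q P Q : pser R n) : is_poly p -> is_subst p g P -> is_subst q g Q ->
    is_subst (pser_mul p q) g (pser_mul P Q).
  move=> [N pN] pP qQ.
  have h1 := is_subst_sum (words_lt n N) p _ _ (fun a => mulw a q Q qQ).
  have PE w : P w = \sum_(a <- words_lt n N) p a * pser_word g a w.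
    have /is_substP/(_ w)[N1 _ hN1] := pP.
    rewrite -(hN1 (N + N1)%N (leq_addl _ _)) /psubst.
    rewrite (bigID (mem (words_lt n N)))/= [X in _ + X]big1 ?addr0; last first.
      by move=> a; rewrite mem_words_lt -leqNgt => /pN ->; rewrite mul0r.
    rewrite -big_filter; apply: perm_big; apply: uniq_perm; rewrite ?filter_uniq ?words_lt_uniq//.
    move=> a; rewrite mem_filter !mem_words_lt; case: ltnP => //= aN.
    by rewrite ltn_addr.
  have distr (s : seq (word n)) (k : word n -> C) (A : word n -> pser R n) (r : pser R n) u :
      pser_mul (fun v => \sum_(a <- s) k a * A a v) r u = \sum_(a <- s) k a * pser_mul (A a) r u.
    elim: s => [|a s IH].
      rewrite big_nil /pser_mul big1// => i _; by rewrite big_nil mul0r.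
    rewrite big_cons -IH -pser_mul_linl; congr (pser_mul _ _ _); apply/funext => v.
    by rewrite big_cons.
  apply: is_subst_ext h1 => u; rewrite -distr; congr (pser_mul _ _ _); apply/funext => v.
    by rewrite -polysum.
  by rewrite PE.
have fword a : is_subst (pser_word f a) g (fun u => (u == a)%:R).
  elim: a => [|i a IH]; first exact: is_subst_one.
  apply: is_subst_ext (mulp _ _ _ _ (pf i) (fg i) IH) => u //.
  by rewrite pser_mul_Zl; case: u => [|j v] //; rewrite eqseq_cons; case: (j == i).
have h1 := is_subst_sum (words_lt n N0) c _ _ fword.
have c0 u : \sum_(a <- words_lt n N0) c a * pser_word f a u = 0.
  have /is_substP/(_ u)[N1 _ hN1] := cf.
  transitivity (psubst f c (N0 + N1)%N u); last exact: hN1 (leq_addl _ _).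
  rewrite /psubst [RHS](bigID (mem (words_lt n N0)))/= [X in _ + X]big1 ?addr0; last first.
    by move=> a; rewrite mem_words_lt -leqNgt => /cN ->; rewrite mul0r.
  rewrite -[RHS]big_filter; apply: perm_big; apply: uniq_perm; rewrite ?filter_uniq ?words_lt_uniq//.
  move=> a; rewrite mem_filter !mem_words_lt; case: ltnP => //= aN.
  by rewrite ltn_addr.
have h2 : is_subst (fun=> 0) g (fun u => \sum_(a <- words_lt n N0) c a * (u == a)%:R).
  by apply: is_subst_ext h1 => u //; exact: c0.
have h3 : is_subst (fun=> 0) g (fun=> 0 : C).
  by apply/is_substP => w; exists 0%N => // N _; rewrite /psubst big1// => b _; rewrite mul0r.
by move=> a; rewrite (polysum c N0 cN) (is_subst_uniq h2 h3).
Qed.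

Hypothesis f0 : forall i, f i [::] = 0.

Lemma pser_word_low a w : (size w < size a)%N -> pser_word f a w = 0.
Proof.
elim: a w => [//|i a IH] w /=; rewrite ltnS => sw.
rewrite /pser_mul big_ord_recl take0 f0 mul0r add0r big1// => k _.
rewrite IH ?mulr0// size_drop lift0.
case: w sw k => [|j w] sw k; first by case: k.
by rewrite /= subSS; apply: leq_ltn_trans (leq_subr _ _) _.
Qed.

Lemma pser_word_diag i a j w : size a = size w ->
  pser_word f (i :: a) (j :: w) = f i [:: j] * pser_word f a w.
Proof.
move=> s; rewrite /= pser_mul_cons f0 mul0r add0r /pser_mul big_ord_recl take0 drop0.
rewrite big1 ?addr0// => k _; rewrite pser_word_low ?mulr0//.
rewrite size_drop lift0 s.
case: w {s} k => [|j' w] k; first by case: k.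
by rewrite /= subSS ltnS leq_subr.
Qed.

(** Without constant terms and with an invertible linear part, substitution is
    injective: the lowest homogeneous part of [c] would be killed by a
    tensor power of the Jacobian matrix. *)
Lemma subst_inj_jac (c : pser R n) : \det (\matrix_(i, j) f i [:: j]) != 0 ->
  is_subst c f (fun=> 0) -> forall a, c a = 0.
Proof.
move=> dJ /is_substP cf.
have lin (x : 'I_n -> C) : (forall j, \sum_i x i * f i [:: j] = 0) -> forall i, x i = 0.
  move=> h i; pose J := \matrix_(i, j) f i [:: j].
  have uJ : J \in unitmx by rewrite unitmxE unitfE.
  have e : (\row_i x i) *m J = 0.
    by apply/rowP => j; rewrite !mxE -[RHS](h j); apply: eq_bigr => k _; rewrite !mxE.
  have /rowP/(_ i) := congr1 (mulmxr (invmx J)) e.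
  by rewrite /= -mulmxA mulmxV// mulmx1 mul0mx !mxE.
have layer m (d : word n -> C) :
    (forall w, size w = m -> \sum_(a : m.-tuple 'I_n) d a * pser_word f a w = 0) ->
    forall a, size a = m -> d a = 0.
  elim: m d => [|m IH] d h a sa.
    have := h [::] erefl; rewrite (sum_tuple0 (fun a => d a * pser_word f a [::])) /=.
    by rewrite /pser_one eqxx mulr1; case: a sa.
  case: a sa => [//|i a] [sa].
  apply: (IH (fun a => d (i :: a))) => // w sw.
  apply: (lin (fun i => \sum_(a : m.-tuple 'I_n) d (i :: a) * pser_word f a w)) => j.
  rewrite -[RHS](h (j :: w)); last by rewrite /= sw.
  rewrite (sum_tupleS m (fun a => d a * pser_word f a (j :: w))).
  apply: eq_bigr => k _; rewrite mulr_suml; apply: eq_bigr => b _.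
  by rewrite pser_word_diag ?size_tuple// mulrAC -mulrA [f k _ * _]mulrC.
suff h m : forall a, size a = m -> c a = 0 by move=> a; exact: (h (size a)).
elim/ltn_ind: m => m IH; apply: layer => w sw.
have [N1 _ hN1] := cf w.
transitivity (psubst f c (m.+1 + N1)%N w); last exact: hN1 (leq_addl _ _).
rewrite /psubst (sum_words_lt (fun a => c a * pser_word f a w)); apply: esym.
have mN : (m < m.+1 + N1)%N by rewrite ltn_addr.
rewrite (bigD1 (Ordinal mN))//= [X in _ + X]big1 ?addr0// => k km.
rewrite big1// => a _; have [kl|kl|ke] := ltngtP k m.
- by rewrite (IH k) ?size_tuple// mul0r.
- by rewrite pser_word_low ?mulr0// sw size_tuple.
- by case/negP: km; apply/eqP/val_inj; exact: ke.
Qed.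

End Injectivity.

Section BallEvaluation.
Variables (R : realType) (n : nat).
Local Notation C := R[i]%C.

Lemma in_ball_bound (V : hilbertType R) (Y : 'I_n -> bop V V) : in_ball 1 Y ->
  exists rho : R, [/\ 0 <= rho, rho < 1 &
    forall h, \sum_i hnorm (adj (Y i) h) ^+ 2 <= rho ^+ 2 * hnorm h ^+ 2].
Proof.
rewrite /in_ball; set A := \sum_i _; set rho := Num.sqrt _ => r1.
exists rho; split => //; first exact: sqrtr_ge0.
move=> h; rewrite sqr_sqrtr ?opnorm_ge0//.
have -> : \sum_i hnorm (adj (Y i) h) ^+ 2 = rin (A h) h.
  rewrite /A bop_sumE rin_suml; apply: eq_bigr => i _.
  by rewrite bcompE rin_adj rinn.
apply: le_trans (rin_le _ _) _; rewrite expr2 mulrA ler_wpM2r ?hnorm_ge0//.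
exact: hnorm_opnorm.
Qed.

Lemma bernoulli (e : R) m : 0 < e -> m%:R * e <= (1 + e) ^+ m.
Proof.
move=> e0; suff : 1 + m%:R * e <= (1 + e) ^+ m by apply: le_trans; rewrite lerDr.
elim: m => [|m IH]; first by rewrite mul0r addr0 expr0.
rewrite exprS -natr1; have := ler0n R m; move: (m%:R) (_ ^+ m) IH => a b IH a0.
by move: IH a0 e0; nra.
Qed.

(** The roots of order [2 k] of a bounded sequence have upper limit at most [1], by
    Bernoulli's inequality. *)
Lemma eventually_root_le (B e : R) : 0 <= B -> 0 < e -> exists N : nat, forall k x,
  (N < k)%N -> 0 <= x -> x <= B -> x `^ (k.*2%:R^-1) <= 1 + e.
Proof.
move=> B0 e0; exists (Num.bound (B / e)) => k x Nk x0 xB.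
have k2 : (k.*2%:R : R) != 0.
  by rewrite pnatr_eq0 double_eq0 -lt0n; exact: leq_ltn_trans Nk.
have h1 : x <= (1 + e) ^+ k.*2.
  apply: le_trans xB _; apply: le_trans (bernoulli _ e0).
  rewrite -ler_pdivrMr//; apply: le_trans (_ : (Num.bound (B / e))%:R <= _).
    by apply/ltW/archi_boundP; rewrite divr_ge0// ltW.
  by rewrite ler_nat -addnn; apply: leq_trans (ltnW Nk) (leq_addr _ _).
have e1 : 0 <= 1 + e by rewrite addr_ge0// ltW.
apply: le_trans (_ : ((1 + e) ^+ k.*2) `^ (k.*2%:R^-1) <= _).
  by apply: ge0_ler_powR; rewrite ?nnegrE ?invr_ge0 ?exprn_ge0.
by rewrite -powR_mulrn// -powRrM mulfV// powRr1.
Qed.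

Lemma ell2_free_holomorphic (d : ell2 (word n) C) : free_holomorphic 1 (coef d).
Proof.
rewrite /free_holomorphic invr1 /limn_esup /limf_esup.
apply/lee_addgt0Pr => e e0.
pose S k := \sum_(a : k.-tuple 'I_n) hnorm (coef d a) ^+ 2.
have SB k : S k <= hnorm d ^+ 2.
  have := ell2_fin_le d (words_lt_uniq n k.+1).
  rewrite (sum_words_lt (fun a => hnorm (d a) ^+ 2)) big_ord_recr/=; apply: le_trans.
  by rewrite /S lerDr; apply: sumr_ge0 => i _; apply: sumr_ge0 => a _; exact: sqr_ge0.
have S0 k : 0 <= S k by apply: sumr_ge0 => a _; exact: sqr_ge0.
have [N hN] := eventually_root_le (sqr_ge0 (hnorm d)) e0.
apply: le_trans (_ : ereal_sup [set (S k `^ (k.*2%:R^-1))%:E | k in [set k | (N < k)%N]] <= _)%E.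
  by apply: ereal_inf_lbound; exists [set k | (N < k)%N] => //; exists N.+1.
by apply: ge_ereal_sup => _ [k /= Nk <-]; rewrite -EFinD lee_fin; exact: hN.
Qed.

Lemma sot_sum_rcreate (V : hilbertType R) (Y : 'I_n -> bop V V) (c : ell2 (word n) C) G j :
  sot_sum (coef c) Y G -> sot_sum (coef (rcreate C j c)) Y (bcomp G (Y j)).
Proof.
move=> h x; have := h (Y j x).
rewrite -(cvg_shiftS (fun N => series (hom_part (coef (rcreate C j c)) Y) N x)).
have -> // : (fun N => series (hom_part (coef (rcreate C j c)) Y) N.+1 x) =
    (fun N => series (hom_part (coef c) Y) N (Y j x)).
apply/funext => N; rewrite !series_homE sum_words_rcons /coef rcreate_nil scale0r add0r.
apply: eq_bigr => a _; rewrite (bigD1 j)//= rcreate_rcons eqxx big1 ?addr0.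
  by rewrite -cats1 word_op_cat.
by move=> i ij; rewrite rcreate_rcons (negbTE ij) scale0r.
Qed.

Lemma sot_sum_rmul (V : hilbertType R) (Y : 'I_n -> bop V V) (c : ell2 (word n) C) G b :
  sot_sum (coef c) Y G -> sot_sum (coef (rmul C b c)) Y (bcomp G (word_op Y b)).
Proof.
elim: b c G => [|j b IH] c G h.
  by have -> : bcomp G (word_op Y [::]) = G by apply: bop_ext.
have -> : bcomp G (word_op Y (j :: b)) = bcomp (bcomp G (Y j)) (word_op Y b).
  by apply: bop_ext => x; rewrite !bcompE.
exact: IH _ _ (sot_sum_rcreate (j:=j) h).
Qed.

Lemma sot_sum_vacuum (V : hilbertType R) (Y : 'I_n -> bop V V) :
  sot_sum (coef (emb C [::] 1)) Y (idop V).
Proof.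
move=> x; apply: cvg_near_cst; exists 1%N => // -[//|N] _ /=.
rewrite series_homE sum_words_cons coef_emb1 eqxx scale1r big1 ?addr0// => a _.
by rewrite big1// => i _; rewrite coef_emb1 scale0r.
Qed.

Lemma sot_sumB (V : hilbertType R) (Y : 'I_n -> bop V V) (c d : ell2 (word n) C) G G' :
  sot_sum (coef c) Y G -> sot_sum (coef d) Y G' -> sot_sum (coef (c - d)) Y (G - G').
Proof.
move=> h h' x; rewrite bopBE.
have c1 : (fun N => series (hom_part (coef c) Y) N x - series (hom_part (coef d) Y) N x)
    @ \oo --> G x - G' x by apply: cvgB; [exact: h|exact: h'].
have -> // : (fun N => series (hom_part (coef (c - d)) Y) N x) =
   (fun N => series (hom_part (coef c) Y) N x - series (hom_part (coef d) Y) N x).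
apply/funext => N; rewrite !series_homE -sumrB; apply: eq_bigr => a _.
by rewrite /coef ell2DE ell2NE scalerBl.
Qed.

End BallEvaluation.

Section ModelProperty.
Variables (R : realType) (n : nat) (f : 'I_n -> pser R n) (g : 'I_n -> H2f R n)
  (M : 'I_n -> bop (H2f R n) (H2f R n)).
Local Notation C := R[i]%C.

Lemma left_multP (A : bop (ell2 (word n) C) (ell2 (word n) C)) c :
  (forall b, A (emb C b 1) = rmul C b c) -> left_mult A c.
Proof.
move=> h; split; last exact: (h [::]).
move=> j x; suff e : bcomp A (rcreate C j) = bcomp (rcreate C j) A.
  exact: (congr1 (fun B : bop _ _ => B x) e).
apply: ell2_ext => w v; rewrite !bcompE rcreate_emb.
have e b : emb C b v = v *: emb C b 1.
  apply: ell2P_ext => u; rewrite ell2ZE !embE; case: ifP => _; last by rewrite scaler0.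
  exact: esym (mulr1 _).
rewrite !e !bopxZ !h; congr (_ *: _).
have -> b : rmul C (rcons b j) c = rcreate C j (rmul C b c).
  by elim: b c {h} => [|i b IH] c //=; exact: IH.
by [].
Qed.

Lemma poly_emb b : is_poly (coef (emb C b 1 : H2f R n)).
Proof.
exists (size b).+1 => a sa; rewrite coef_emb1; case: eqP => // ab.
by move: sa; rewrite ab ltnn.
Qed.

Lemma poly_rmul b (c : ell2 (word n) C) : is_poly (coef c) -> is_poly (coef (rmul C b c)).
Proof.
elim: b c => [//|j b IH] c [N cN]; apply: IH; exists N.+1 => a.
rewrite /coef; case/lastP: a => [|a i]; first by rewrite rcreate_nil.
by rewrite size_rcons ltnS rcreate_rcons; case: ifP => // _ /cN.
Qed.

(** Both [M_i f_b] and the product of the coordinates of [Z_i] by the word [b] become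
    [Z_i f_b] when [f] is substituted, and the substitution of [f] is injective in
    each of the three cases of the model property. *)
Lemma model_left_mult i : model_property f g M -> left_mult (M i) (g i).
Proof.
move=> hm; apply: left_multP => b.
have sub0 (c d : H2f R n) p : is_subst (coef c) f p -> is_subst (coef d) f p ->
    is_subst (coef (c - d)) f (fun=> 0).
  move=> h h'; apply: is_subst_ext (is_subst_lin (-1) h' h) => a.
    by rewrite /coef ell2DE ell2NE mulN1r addrC.
  by rewrite mulN1r addNr.
have fin (c d : H2f R n) : (forall a, coef (c - d) a = 0) -> c = d.
  move=> h; apply/eqP; rewrite -subr_eq0; apply/eqP/ell2P_ext => a.
  exact: h.
case: hm.
- move=> [pfg fgZ gfZ hM].
  have [pM sM] := hM i _ _ (poly_emb b) (is_subst_emb f b).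
  apply: fin; apply: (subst_inj_poly (fun k => (pfg k).1) fgZ).
    have [N1 h1] := pM; have [N2 h2] := poly_rmul b (pfg i).2.
    exists (maxn N1 N2) => a; rewrite geq_max => /andP[a1 a2].
    by rewrite /coef ell2DE ell2NE [X in X - _](h1 a a1) [X in _ - X](h2 a a2) subrr.
  exact: sub0 sM (is_subst_rmul b (gfZ i)).
- move=> [f0 dJ gfZ hM _].
  apply: fin; apply: (subst_inj_jac (fun k => (f0 k).1) dJ).
  exact: sub0 (hM i _ _ (is_subst_emb f b)) (is_subst_rmul b (gfZ i)).
- move=> [r r0 [[_ fball] inj gfZ hM _]].
  apply: fin; apply: inj => [|X Xr]; first exact: ell2_free_holomorphic.
  have [rho [rho0 rho1 hrho]] := in_ball_bound (fball X Xr).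
  set Y := feval f X in hrho.
  have ev (c : H2f R n) : exists2 G, sot_sum (coef c) Y G & peval (coef c) Y = G.
    have [G hG] := ball_norm_sum rho0 hrho c rho1.
    by exists G; [exact: norm_sum_sot|apply: pevalE; left; exact: norm_sum_sot].
  have [G1 s1 e1] := ev (M i (emb C b 1)); have [G2 s2 e2] := ev (g i).
  have s3 := sot_sum_rmul (b:=b) (sot_sum_vacuum Y); rewrite rmul_emb in s3.
  apply: pevalE; left.
  have := sot_sumB s1 (sot_sum_rmul (b:=b) s2).
  have -> // : G1 - bcomp G2 (word_op Y b) = 0.
  have := hM i (emb C b 1) X Xr; rewrite -/Y e1 (pevalE (or_introl s3)) => ->.
  have := gfZ i X Xr; rewrite -/Y e2 => ->.
  by apply/eqP; rewrite subr_eq0; apply/eqP; apply: bop_ext.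
Qed.

End ModelProperty.

(** * The functional model *)

Section OrthogonalRange.
Variables (R : realType).
Local Notation C := R[i]%C.
Implicit Types U V W : hilbertType R.

Lemma clran_orth V W (A : bop V W) (z : subsp (clran A)) :
  (forall x, rin (z : W) (A x) = 0) -> z = 0.
Proof.
move=> h; apply/hnorm_eq0/eqP; rewrite eq_le hnorm_ge0 andbT hnorm_subsp.
apply/ler_addgt0Pr => e e0; rewrite add0r.
have /cs_predP/hclosureP/(_ e e0)[_ [x _ <-] d] := subspP z.
have [->|z0] := eqVneq (hnorm (z : W)) 0; first exact: ltW.
have hz : 0 < hnorm (z : W) by rewrite lt_neqAle eq_sym z0 hnorm_ge0.
rewrite -(ler_pM2l hz) -expr2 -rinn -[leLHS]subr0 -(h x) -rinBr.
by apply: le_trans (rin_le _ _) _; rewrite ler_wpM2l// ltW.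
Qed.

(** The range of [A] is dense when its adjoint is injective. *)
Lemma dense_ext U V W (A : bop U V) (X Y : bop V W) :
  (forall v, adj A v = 0 -> v = 0) -> (forall u, X (A u) = Y (A u)) -> X = Y.
Proof.
move=> injA XY; rewrite -(adjK X) -(adjK Y); congr adj; apply: bop_ext => w.
apply/eqP; rewrite -subr_eq0; apply/eqP/injA/rin_inj => u.
by rewrite -rin_adj' rinBl -!rin_adj' XY subrr rin0l.
Qed.

Lemma polar V W W' (A : bop V W) (B : bop V W') :
  (forall x, hnorm (A x) ^+ 2 + hnorm (B x) ^+ 2 = hnorm x ^+ 2) ->
  forall x, adj A (A x) + adj B (B x) = x.
Proof.
move=> h x; apply: rin_inj => y; rewrite rinDl -!rin_adj'.
have := h (x + y); rewrite !bopxD !hnormDsq !mulr2n; have := h x; have := h y; lra.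
Qed.

(** [to_clran A] bundled as an operator. *)
Definition corange V W (A : bop V W) : bop V (subsp (clran A)) := bcomp (adj (incl (clran A))) A.

Lemma corangeE V W (A : bop V W) x : corange A x = to_clran A x.
Proof. by rewrite -[RHS]adj_incl. Qed.

Lemma hnorm_to_clran V W (A : bop V W) x : hnorm (to_clran A x) = hnorm (A x).
Proof. exact: hnorm_subsp. Qed.

Lemma to_clran_total V W (A : bop V W) (z : subsp (clran A)) :
  (forall x, rin z (to_clran A x) = 0) -> z = 0.
Proof. by move=> h; apply: clran_orth => x; exact: h. Qed.

Lemma unitaryP V W (U : bop V W) :
  (forall x, adj U (U x) = x) -> (forall y, U (adj U y) = y) -> unitary U.
Proof.
move=> h h'; split=> [x|y]; last by exists (adj U y).
by rewrite !hnormE (hnorm_unitary h).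
Qed.

(** The map [A x |-> B x] and its inverse are isometric with dense domains; their
    extensions are inverse to each other. *)
Lemma unitary_between V W X (A : bop X V) (B : bop X W) :
  (forall v, adj A v = 0 -> v = 0) -> (forall w, adj B w = 0 -> w = 0) ->
  (forall x, hnorm (A x) = hnorm (B x)) ->
  exists U : bop V W, [/\ forall x, U (A x) = B x, forall v, adj U (U v) = v &
    forall w, U (adj U w) = w].
Proof.
have ext V' W' (A' : bop X V') (B' : bop X W') : (forall v, adj A' v = 0 -> v = 0) ->
    (forall x, hnorm (A' x) = hnorm (B' x)) ->
    exists2 U : bop V' W', (forall x, U (A' x) = B' x) & forall v, hnorm (U v) <= hnorm v.
  move=> injA AB.
  have [||||U hU bU] := @bop_extend _ _ _ (fun v w => exists x, v = A' x /\ w = B' x) 1.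
  - exact: ler01.
  - move=> a _ _ _ _ [x [-> ->]] [x' [-> ->]]; exists (a *: x + x').
    by rewrite !(bopxD, bopxZ).
  - by move=> _ _ [x [-> ->]]; rewrite mul1r AB.
  - move=> v e e0; have [_ [x _ <-] d] := (hclosureP _ _).1 (@dense_range _ _ _ A' injA v) e e0.
    by exists (A' x), (B' x); split => //; exists x.
  exists U => [x|v]; first by apply: hU; exists x.
  by rewrite -[leRHS]mul1r.
move=> injA injB AB; have [U UA bU] := ext _ _ A B injA AB.
have [U' U'B bU'] := ext _ _ B A injB (fun x => esym (AB x)).
have U'U : bcomp U' U = idop V by apply: (dense_ext injA) => x; rewrite bcompE UA U'B.
have UU' : bcomp U U' = idop W by apply: (dense_ext injB) => x; rewrite bcompE U'B UA.
have u'u v : U' (U v) = v by exact: (congr1 (fun Z : bop _ _ => Z v) U'U).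
have uu' w : U (U' w) = w by exact: (congr1 (fun Z : bop _ _ => Z w) UU').
have iU v : hnorm (U v) = hnorm v.
  by apply/eqP; rewrite eq_le bU -{1}(u'u v) bU'.
have h := isometry_adj iU; exists U; split => // w.
by rewrite -{1}(uu' w) h uu'.
Qed.

End OrthogonalRange.

Section DirectSum.
Variables (R : realType) (V W : hilbertType R).
Local Notation C := R[i]%C.

Lemma rin_dsum (x y : dsum V W) : rin x y = rin x.1 y.1 + rin x.2 y.2.
Proof. by rewrite /rin /inner/= /dsum_inner raddfD. Qed.

Lemma hnorm_dsum (x : dsum V W) : hnorm x ^+ 2 = hnorm x.1 ^+ 2 + hnorm x.2 ^+ 2.
Proof. by rewrite -!rinn rin_dsum. Qed.

Lemma hnorm_le_sqr (V' V'' : hilbertType R) (x : V') (y : V'') :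
  hnorm x ^+ 2 <= hnorm y ^+ 2 -> hnorm x <= hnorm y.
Proof. by rewrite hnorm_le_sq ?hnorm_ge0. Qed.

Lemma dsum_ops : exists in1 : bop V (dsum V W), exists2 in2 : bop W (dsum V W),
  (forall x, in1 x = (x, 0)) & forall y, in2 y = (0, y).
Proof.
have [||in1 h1] := @bop_mk _ V (dsum V W) (fun x => (x, 0)) 1.
- move=> a x y; rewrite (_ : a *: ((x, 0) : dsum V W) + (y, 0) = (a *: x + y, a *: 0 + 0))//.
  by rewrite scaler0 addr0.
- by move=> x; rewrite mul1r; apply: hnorm_le_sqr; rewrite hnorm_dsum/= hnorm0 expr0n/= addr0.
have [||in2 h2] := @bop_mk _ W (dsum V W) (fun x => (0, x)) 1.
- move=> a x y; rewrite (_ : a *: ((0, x) : dsum V W) + (0, y) = (a *: 0 + 0, a *: x + y))//.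
  by rewrite scaler0 addr0.
- by move=> x; rewrite mul1r; apply: hnorm_le_sqr; rewrite hnorm_dsum/= hnorm0 expr0n/= add0r.
by exists in1; exists in2.
Qed.

End DirectSum.

Section FunctionalModel.
Variables (R : realType) (X Y H : hilbertType R) (Th : bop X Y) (Dl : bop X X) (K : bop H Y).
Local Notation C := R[i]%C.
Local Notation DT := (subsp (clran Dl)).
Local Notation E := (dsum Y DT).
Local Notation graph := [set ((Th x, to_clran Dl x) : E) | x in setT].
Local Notation Mo := (subsp (orth graph)).
Hypotheses (nDl : forall x, hnorm (Dl x) ^+ 2 = hnorm x ^+ 2 - hnorm (Th x) ^+ 2)
  (nK : forall y, hnorm y ^+ 2 - hnorm (adj Th y) ^+ 2 = hnorm (adj K y) ^+ 2)
  (injK : forall h, K h = 0 -> h = 0).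

Lemma orth_graphP (e : E) : cs_set (orth graph) e <->
  forall x, rin e.1 (Th x) + rin e.2 (to_clran Dl x) = 0.
Proof.
split=> [h x|h _ [x _ <-]].
  have := congr1 (@complex.Re R) (h _ (imageT _ x)).
  by rewrite -[LHS]/(rin e _) rin_dsum.
rewrite inner_rin rin_dsum/= h; congr Complex.
have -> : 'i%C *: ((Th x, to_clran Dl x) : E) = (Th ('i%C *: x), to_clran Dl ('i%C *: x)).
  by rewrite -!corangeE !bopxZ.
by rewrite rin_dsum h.
Qed.

(** A vector [(0, z)] of the model space is orthogonal to the range of [Dl]. *)
Lemma model_fst_inj (z : Mo) : (subsp_val z).1 = 0 -> z = 0.
Proof.
move=> z1; apply: val_inj => /=.
have /cs_predP/orth_graphP h := subspP z.
have z2 : (subsp_val z).2 = 0.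
  by apply: to_clran_total => x; have := h x; rewrite z1 rin0l add0r.
by move: z1 z2; case: (subsp_val z) => a b /= -> ->.
Qed.

(** The graph of [Th] and [Dl] is the range of an isometry [V], so the projection of
    [(y, 0)] is [(y, 0) - V Th^* y]. *)
Lemma model_proj : exists P : bop E Mo,
  [/\ forall e (z : Mo), rin (P e) z = rin e (subsp_val z), forall z : Mo, P (subsp_val z) = z,
      forall x, P (Th x, to_clran Dl x) = 0
    & forall y, hnorm (P (y, 0)) ^+ 2 = hnorm y ^+ 2 - hnorm (adj Th y) ^+ 2].
Proof.
pose P := adj (incl (orth graph)).
have rP e (z : Mo) : rin (P e) z = rin e (subsp_val z) by rewrite -rin_adj'.
have PV x : P (Th x, to_clran Dl x) = 0.
  apply: rin_inj => z; rewrite rP rin0l rinC rin_dsum.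
  have /cs_predP/orth_graphP h := subspP z; exact: h.
exists P; split => //; first exact: adj_incl.
move=> y; pose x := adj Th y; pose e : E := (y - Th x, - to_clran Dl x).
have eO : cs_set (orth graph) e.
  apply/orth_graphP => x'; rewrite rinBl rinNl.
  have -> : rin (to_clran Dl x) (to_clran Dl x') = rin (Dl x) (Dl x') by [].
  have := nDl (x + x'); rewrite !bopxD !hnormDsq !mulr2n (nDl x) (nDl x').
  by rewrite [rin y _]rin_adj' -/x; lra.
have Pe : P (y, 0) = P e.
  rewrite -[RHS]addr0 -(PV x) -bopxD; congr (P _).
  by rewrite /e -[RHS]/(_, _) /= subrK addNr.
have -> : hnorm (P (y, 0)) = hnorm e by rewrite Pe hnorm_subsp; congr hnorm; exact: (incl_adj eO).
rewrite hnorm_dsum/= hnormN hnorm_to_clran hnormBsq nDl [rin y _]rin_adj' -/x rinn mulr2n; lra.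
Qed.

(** The vectors [K^* y] and the projections of the [(y, 0)] have equal norms by [nK] and
    are dense, which gives [U]. The image of [T] under [U] is the compression of
    [W (+) D]: on [(y, 0)] since [T K^* = K^* W], and on [(0, Dl x)], which is
    [(Th x, Dl x) - (Th x, 0)], since [W (+) D] leaves the graph invariant. *)
Theorem functional_model : exists U : bop H Mo,
  [/\ forall h, adj U (U h) = h, forall z, U (adj U z) = z &
  forall (T : bop H H) (W : bop Y Y) (S : bop X X) (D : bop DT DT),
    (forall y, adj K (W y) = T (adj K y)) -> (forall x, Th (S x) = W (Th x)) ->
    (forall x, D (to_clran Dl x) = to_clran Dl (S x)) ->
    forall v : Mo, subsp_val (adj (conj_op U T) v) =
      (adj W (subsp_val v).1, adj D (subsp_val v).2)].
Proof.
have [P [rP Pid PV nP]] := model_proj.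
have [in1 [in2 in1E in2E]] := dsum_ops Y DT.
have [U [UK UU UU']] : exists U : bop H Mo, [/\ forall y, U (adj K y) = bcomp P in1 y,
    forall v, adj U (U v) = v & forall w, U (adj U w) = w].
  apply: unitary_between.
  - by move=> h; rewrite adjK; exact: injK.
  - move=> z h; apply: model_fst_inj; apply: rin_inj => y.
    rewrite rin0l rinC -[RHS](rin0r y) -h -rin_adj bcompE rP in1E rin_dsum/= rin0l addr0//.
  - move=> y; apply/eqP; rewrite -(@eqrXn2 _ 2)// ?hnorm_ge0//.
    by rewrite bcompE in1E nP nK.
exists U; split => // T W S D KW ThS DS v.
have h1 y : conj_op U T (P (y, 0)) = P (W y, 0).
  by have := UK y; rewrite bcompE in1E => <-; rewrite conj_opE UU -KW UK bcompE in1E.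
have split0 x : ((0, to_clran Dl x) : E) = (Th x, to_clran Dl x) - (Th x, 0).
  by rewrite -[RHS]/(_, _) /= subrr subr0.
have h2 z : conj_op U T (P (0, z)) = P (0, D z).
  have e : bcomp (conj_op U T) (bcomp P in2) = bcomp (bcomp P in2) D.
    apply: clran_ext => x.
    change (conj_op U T (P (in2 (to_clran Dl x))) = P (in2 (D (to_clran Dl x)))).
    rewrite !in2E DS !split0 !bopxB !PV !bopx0 !sub0r h1 ThS.
    by [].
  rewrite -!in2E; exact: (congr1 (fun Z : bop _ _ => Z z) e).
have key (e : E) : conj_op U T (P e) = P (W e.1, D e.2).
  have e12 (a : Y) (b : DT) : ((a, b) : E) = (a, 0) + (0, b).
    by rewrite -[RHS]/(_, _) /= addr0 add0r.
  by rewrite [in LHS](surjective_pairing e) [in LHS]e12 !bopxD h1 h2 -bopxD -e12.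
apply: rin_inj => e; rewrite rinC -[LHS]rP -rin_adj key [LHS]rP.
rewrite [LHS]rinC [LHS](rin_dsum (subsp_val v)) [RHS](rin_dsum (_, _)).
by rewrite /= -!rin_adj'.
Qed.

(** When [Th] is isometric, [Dl] vanishes, and so does the second summand. *)
Lemma isometric_model : (forall x, hnorm (Th x) = hnorm x) ->
  exists J : bop (subsp (orth (range Th))) Mo,
    [/\ forall x, adj J (J x) = x, forall v, J (adj J v) = v &
    forall x, subsp_val (J x) = (subsp_val x, 0)].
Proof.
move=> iso; have [in1 [_ in1E _]] := dsum_ops Y DT.
have D0 x : Dl x = 0.
  by apply/hnorm_eq0/eqP; rewrite -(@sqrf_eq0 R) nDl iso subrr.
have DT0 (z : DT) : z = 0 by apply: clran_orth => x; rewrite D0 rin0r.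
pose J := bcomp (adj (incl (orth graph))) (bcomp in1 (incl (orth (range Th)))).
have JE x : subsp_val (J x) = (subsp_val x, 0).
  rewrite /J !bcompE in1E; apply: incl_adj; apply/orth_graphP => u /=.
  have /cs_predP/(_ _ (imageT _ u)) := subspP x.
  by move=> /(congr1 (@complex.Re R)) h; rewrite rin0l addr0; exact: h.
have iJ x : hnorm (J x) = hnorm x.
  apply/eqP; rewrite -(@eqrXn2 _ 2)// ?hnorm_ge0// !hnorm_subsp JE.
  by rewrite hnorm_dsum/= hnorm0 expr0n/= addr0.
exists J; split => //; first exact: isometry_adj.
move=> v; have /cs_predP/orth_graphP hv := subspP v.
have aO : cs_set (orth (range Th)) (subsp_val v).1.
  move=> _ [x _ <-]; rewrite inner_rin.
  have h u : rin (subsp_val v).1 (Th u) = 0 by rewrite -(hv u) (DT0 (to_clran Dl u)) rin0r addr0.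
  by rewrite -bopxZ !h.
have vJ : v = J (adj (incl (orth (range Th))) (subsp_val v).1).
  apply: val_inj; rewrite [RHS]JE; have -> : subsp_val (adj (incl (orth (range Th))) (subsp_val v).1) = (subsp_val v).1 by exact: (incl_adj aO).
  by rewrite [LHS]surjective_pairing; congr (_, _).
by rewrite {1}vJ (isometry_adj iJ) -vJ.
Qed.

(** Here [K K^* Th = Th - Th Th^* Th = 0], so [K^* Th = 0] and [K K^* K = K]. *)
Lemma char_isometry_kernel : (forall x, hnorm (Th x) = hnorm x) ->
  forall h, hnorm (K h) = hnorm h.
Proof.
move=> iso; have p y : Th (adj Th y) + K (adj K y) = y.
  have := @polar _ _ _ _ (adj Th) (adj K); rewrite !adjK => p; apply: p => z.
  by rewrite -nK addrC subrK.
have tt := isometry_adj iso.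
have tk y : adj Th (K (adj K y)) = 0.
  by apply: (@addrI _ (adj Th y)); rewrite addr0 -{1}(tt (adj Th y)) -bopxD p.
have kt x : adj K (Th x) = 0.
  apply/hnorm_eq0/eqP; rewrite -(@sqrf_eq0 R) -rinn -rin_adj.
  by rewrite rin_adj' tk rin0l.
have kk h : adj K (K h) = h.
  apply/eqP; rewrite -subr_eq0; apply/eqP/injK; rewrite bopxB.
  apply/eqP; rewrite subr_eq0; apply/eqP.
  have tk0 : adj Th (K h) = 0 by apply: rin_inj => x; rewrite -rin_adj' rin_adj kt rin0r rin0l.
  by have := p (K h); rewrite tk0 bopx0 add0r.
by move=> h; apply/eqP; rewrite -(@eqrXn2 _ 2)// ?hnorm_ge0// -!rinn rin_adj' kk.
Qed.

(** Here [Th Th^* K = K - K K^* K = 0], so [Th^* K = 0]. *)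
Lemma kernel_isometry_char : (forall h, hnorm (K h) = hnorm h) ->
  forall y, adj Th (Th (adj Th y)) = adj Th y.
Proof.
move=> iso; have p y : Th (adj Th y) + K (adj K y) = y.
  have := @polar _ _ _ _ (adj Th) (adj K); rewrite !adjK => p; apply: p => z.
  by rewrite -nK addrC subrK.
have kk := isometry_adj iso.
have tk h : adj Th (K h) = 0.
  have t0 : Th (adj Th (K h)) = 0.
    by apply: (@addIr _ (K h)); rewrite add0r -{2}(kk h) p.
  by apply/hnorm_eq0/eqP; rewrite -(@sqrf_eq0 R) -rinn rin_adj' adjK t0 rin0l.
by move=> y; rewrite -[in RHS](p y) bopxD tk addr0.
Qed.

End FunctionalModel.

(** * The domain, pure tuples and the Poisson kernel of a tuple *)

Section Domain.
Variables (R : realType) (n : nat) (f : 'I_n -> pser R n) (g : 'I_n -> H2f R n).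
Local Notation C := R[i]%C.
Implicit Types H V W : hilbertType R.

Lemma inner_suml H (I : Type) (s : seq I) (F : I -> H) y :
  inner (\sum_(i <- s) F i) y = \sum_(i <- s) inner (F i) y.
Proof. by elim/big_rec2: _ => [|i a b _ <-]; rewrite ?inner0l ?innerDl. Qed.

Lemma iter_Phi H (T : 'I_n -> bop H H) m h :
  inner (iter m (Phi f T) (idop H) h) h = (cp_form (feval f T) m h)%:C%C.
Proof.
elim: m h => [|m IH] h; first by rewrite cp_form0 -sq_cmp -inner_norm.
rewrite iterS /Phi bop_sumE inner_suml cp_formS rmorph_sum; apply: eq_bigr => i _.
by rewrite !bcompE adjP IH.
Qed.

Lemma cncP H (T : 'I_n -> bop H H) : cnc f T <->
  forall h, (forall m, cp_form (feval f T) m h = hnorm h ^+ 2) -> h = 0.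
Proof.
split=> hc h hm; apply: hc => m; first by move=> _; rewrite iter_Phi hm sq_cmp.
case: m => [|m]; first exact: cp_form0.
have := hm m.+1 isT; rewrite iter_Phi sq_cmp; exact: complexI.
Qed.

(** Weak and strong convergence to [0] agree here, since the operator [A_k] of the
    form [cp_form k] is a positive contraction: [|A_k h|^2 <= <A_k h, h>]. *)
Lemma pureP H (T : 'I_n -> bop H H) :
  (forall h, \sum_i hnorm (adj (feval f T i) h) ^+ 2 <= hnorm h ^+ 2) ->
  pure f T <-> forall h, cp_form (feval f T) k h @[k --> \oo] --> (0 : R).
Proof.
set F := feval f T => hF.
pose A k := \sum_(a : k.-tuple 'I_n) bcomp (word_op F a) (adj (word_op F a)).
have AE k h : rin (A k h) h = cp_form F k h.
  rewrite /A bop_sumE rin_suml; apply: eq_bigr => a _.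
  by rewrite bcompE rin_adj rinn.
split=> [hp h|hc h].
  have : (fun k => rin (A k h) h) @ \oo --> rin (0 : H) h.
    by apply: hcvg_rin; exact: hp.
  rewrite rin0l; have -> // : (fun k => rin (A k h) h) = (fun k => cp_form F k h).
  by apply/funext => k; exact: AE.
have AB k : hnorm (A k h) ^+ 2 <= cp_form F k h.
  have h1 : hnorm (A k h) ^+ 2 *+ 2 <= cp_form F k h + cp_form F k (A k h).
    set y := A k h; have -> : hnorm y ^+ 2 = rin (A k h) y by rewrite rinn.
    rewrite /A bop_sumE rin_suml /cp_form -big_split -sumrMnl; apply: ler_sum => a _.
    rewrite bcompE rin_adj; have := sqr_ge0 (hnorm (adj (word_op F a) h - adj (word_op F a) y)).
    by rewrite hnormBsq subr_ge0.
  have h2 : cp_form F k (A k h) <= hnorm (A k h) ^+ 2.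
    have hF1 x : \sum_i hnorm (adj (F i) x) ^+ 2 <= 1 ^+ 2 * hnorm x ^+ 2.
      by rewrite expr1n mul1r.
    by have := cp_form_le hF1 k (A k h); rewrite !expr1n mul1r.
  by move: h1 h2; rewrite mulr2n; lra.
apply/hcvgP => e e0; rewrite bop0E.
have /cvgrPdist_lt/(_ _ (exprn_gt0 2 e0)) := hc h.
apply: filterS => k; rewrite sub0r normrN => hk; rewrite sub0r hnormN.
rewrite -(@ltr_pXn2r _ 2)// ?nnegrE ?hnorm_ge0 ?ltW//.
apply: le_lt_trans (AB k) _; apply: le_lt_trans hk; exact: ler_norm.
Qed.

Lemma in_Bf_row H (T : 'I_n -> bop H H) : in_Bf f g T ->
  forall h, \sum_i hnorm (adj (feval f T i) h) ^+ 2 <= hnorm h ^+ 2.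
Proof.
move=> [_ h1 _] h; rewrite -[leRHS]mul1r -(expr1n _ 2).
apply: (row_boundP _ ler01).2 => x; apply: le_trans (hnorm_opnorm _ _) _.
by rewrite ler_wpM2r ?hnorm_ge0.
Qed.

Lemma in_Bf_eval H (T : 'I_n -> bop H H) i : in_Bf f g T ->
  exists L, sot_sum (f i) T L \/ rad_sum (f i) T L.
Proof. by move=> [[/(_ i)[L h]|/(_ i)[L h]] _ _]; exists L; [left|right]. Qed.

(** The domain is defined by series, norms and limits, which unitaries preserve. *)
Lemma in_Bf_cnc_conj V W (U : bop V W) (T : 'I_n -> bop V V) :
  (forall x, adj U (U x) = x) -> (forall y, U (adj U y) = y) ->
  in_Bf_cnc f g T -> in_Bf_cnc f g (fun i => conj_op U (T i)).
Proof.
move=> UU UU' [hB hc]; set T' := fun i => _.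
have TT' i : T' i = conj_op U (T i) by [].
have FF' i : feval f T' i = conj_op U (feval f T i).
  by apply: (peval_conj UU UU' TT'); exact: in_Bf_eval.
have hF := in_Bf_row hB; have cpE m h : cp_form (feval f T') m h = cp_form (feval f T) m (adj U h).
  rewrite /cp_form; apply: eq_bigr => a _.
  have -> : word_op (feval f T') a = conj_op U (word_op (feval f T) a).
    by apply: bop_ext => y; exact: word_op_conj.
  by rewrite /conj_op !adj_comp adjK !bcompE (hnorm_unitary UU).
split; last first.
  apply/cncP => h hm; rewrite -(UU' h) ((cncP T).1 hc (adj U h)) ?bopx0// => m.
  by rewrite -cpE hm (hnorm_adj_unitary UU UU').
have [hf _ hg] := hB; split.
- case: hf => hf; [left|right] => i; have [L hL] := hf i; exists (conj_op U L).
    exact: (sot_sum_conj UU UU' TT').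
  exact: (rad_sum_conj UU UU' TT').
- apply: opnorm_le => // x; apply: (row_boundP _ ler01).1 => h.
  rewrite expr1n mul1r -(hnorm_adj_unitary UU UU' h); apply: le_trans (hF _).
  apply: ler_sum => i _; rewrite FF' /conj_op !adj_comp adjK !bcompE (hnorm_unitary UU)//.
- case: hg => hg; [left|right] => i; rewrite -/(T' i) TT'.
    exact: (sot_sum_conj UU UU' FF' (hg i)).
  exact: (rad_sum_conj UU UU' FF' (hg i)).
Qed.

End Domain.

Section PoissonKernel.
Variables (R : realType) (n : nat) (f : 'I_n -> pser R n) (g : 'I_n -> H2f R n)
  (M : 'I_n -> bop (H2f R n) (H2f R n)) (H : hilbertType R) (T : 'I_n -> bop H H).
Local Notation C := R[i]%C.
Hypotheses (hM : forall i, left_mult (M i) (g i)) (hT : in_Bf f g T).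
Local Notation K := (poisson_kernel f T).
Let hF := in_Bf_row hT.

Lemma poisson_kernel_model i x : adj K (tens (M i) (idop (Dspace f T)) x) = T i (adj K x).
Proof.
have hG : sot_sum (coef (g i)) (feval f T) (T i) \/ rad_sum (coef (g i)) (feval f T) (T i).
  by case: hT => _ _ [h|h]; [left|right]; exact: h.
rewrite !adj_poisson_kernel -tens_ampl_comm.
exact: (poisson_tens (Delta_adj hF) (hnorm_Delta hF) (hM i) hG).
Qed.

Lemma poisson_kernel_norm h :
  cp_form (feval f T) k h @[k --> \oo] --> hnorm h ^+ 2 - hnorm (K h) ^+ 2.
Proof. by rewrite (hnorm_poisson_kernel hF); exact: (@poisson_norm _ _ _ _ _ (hnorm_Delta hF)). Qed.

(** Since the forms [cp_form m] decrease to [|h|^2 - |K h|^2], a vector killed by [K]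
    has [cp_form m h = |h|^2] for all [m]. *)
Lemma poisson_kernel_inj h : cnc f T -> K h = 0 -> h = 0.
Proof.
move=> /cncP hc Kh; apply: hc => m.
have c := @poisson_kernel_norm h; rewrite Kh hnorm0 expr0n subr0 in c.
have nd := cp_form_nincr (hnorm_Delta hF) h.
apply/eqP; rewrite eq_le -{1}(cp_form0 (feval f T) h) (nd 0%N m (leq0n m)) /=.
rewrite -(cvg_lim (@Rhausdorff R) c).
by apply: nonincreasing_cvgn_ge => //; apply/cvg_ex; exists (hnorm h ^+ 2).
Qed.

Lemma pure_poisson_kernel : pure f T <-> forall h, hnorm (K h) = hnorm h.
Proof.
rewrite (pureP hF); split=> h x.
  apply/eqP; rewrite -(@eqrXn2 _ 2)// ?hnorm_ge0//.
  have e := cvg_unique (@Rhausdorff R) (@poisson_kernel_norm x) (h x).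
  by rewrite eq_sym -subr_eq0 e.
by have := @poisson_kernel_norm x; rewrite h subrr.
Qed.

End PoissonKernel.

(** * The operators on the range of the defect of the characteristic function *)

Section ShiftCalculus.
Variables (R : realType) (n : nat).
Local Notation C := R[i]%C.

(** On [f_w (x) v], the evaluation of [c] at the dilated left creation operators is
    left multiplication by the dilation of [c]; the uniform bound does the rest. *)
Lemma lcreate_calculus (V : hilbertType R) M (c : ell2 (word n) C) (k : R)
    (N : R -> bop (ell2 (word n) V) (ell2 (word n) V)) :
  left_mult M c -> 0 <= k ->
  (forall r, 0 < r < 1 -> norm_sum (coef c) (dilate r (fun i => lcreate V i)) (N r)) ->
  (forall r, 0 < r < 1 -> forall x, hnorm (N r x) <= k * hnorm x) ->
  forall x, N r x @[r --> 1^'-] --> tens M (idop V) x.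
Proof.
move=> hM k0 hN bN; apply: (ell2_sot k0).
  by apply: filterS (at_left1 (ltr01 : 0 < 1 :> R)) => r r01; exact: bN.
move=> w v; rewrite (tens_left_mult w v hM).
have h : ptens (rmul C w (dil n C r c)) v @[r --> 1^'-] --> ptens (rmul C w c) v.
  by apply: ptens_rmul_cvg; exact: dil_cvg.
apply: cvg_trans h; apply: near_eq_cvg.
apply: filterS (at_left1 (ltr01 : 0 < 1 :> R)) => r r01.
have r01' : 0 <= r <= 1 by case/andP: r01 => r0 r1; rewrite !ltW.
have h1 : ptens (rmul C w (trunc N0 (dil n C r c))) v @[N0 --> \oo] --> ptens (rmul C w (dil n C r c)) v.
  by apply: ptens_rmul_cvg; exact: trunc_cvg.
apply: (hcvg_unique h1).
have h2 := @norm_sum_sot _ _ _ _ _ _ (hN r r01) (emb V w v).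
have -> // : (fun N0 => ptens (rmul C w (trunc N0 (dil n C r c))) v) =
  (fun N0 => series (hom_part (coef c) (dilate r (fun i => lcreate V i))) N0 (emb V w v)).
apply/funext => N0; rewrite ptens_rmul_trunc series_homE; apply: eq_bigr => a _.
rewrite (dilP n C r01').1 word_op_dilate word_op_lcreate scalerA; congr (_ *: _).
by rewrite mulrC.
Qed.

Lemma norm_sum_intertwine (V W : hilbertType R) (A : bop V W) (Y : 'I_n -> bop V V)
    (Y' : 'I_n -> bop W W) (p : pser R n) r L L' : (forall i x, A (Y i x) = Y' i (A x)) ->
  norm_sum p (dilate r Y) L -> norm_sum p (dilate r Y') L' -> forall x, A (L x) = L' (A x).
Proof.
move=> hA hL hL' x.
have h1 : A (series (hom_part p (dilate r Y)) N x) @[N --> \oo] --> A (L x).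
  by apply: bop_cvg; exact: (@norm_sum_sot _ _ _ _ _ _ hL x).
have h2 := @norm_sum_sot _ _ _ _ _ _ hL' (A x).
apply: (hcvg_unique h1).
have -> // : (fun N => A (series (hom_part p (dilate r Y)) N x)) =
  (fun N => series (hom_part p (dilate r Y')) N (A x)).
apply/funext => N; rewrite !series_homE bopx_sum; apply: eq_bigr => a _.
rewrite bopxZ !word_op_dilate bopxZ; congr (_ *: (_ *: _)).
by elim: a => [//|i a IH]; rewrite !word_opS hA IH.
Qed.

Lemma isometries_row (V : hilbertType R) (S : 'I_n -> bop V V) :
  (forall i j x, adj (S i) (S j x) = if i == j then x else 0) ->
  forall h, \sum_i hnorm (adj (S i) h) ^+ 2 <= hnorm h ^+ 2.
Proof.
move=> hS h; rewrite -[leRHS]mul1r -(expr1n _ 2).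
apply: (row_boundP _ ler01).2 => x; rewrite mul1r.
apply: hnorm_le_sqr; rewrite row_opE -[leLHS]rinn rin_suml hnorm_ord; apply: ler_sum => i _.
rewrite rinC rin_suml (bigD1 i)//= big1 ?addr0 => [|j ji].
  by rewrite rin_adj' hS eqxx rinn.
by rewrite rin_adj' hS eq_sym (negbTE ji) rin0l.
Qed.

End ShiftCalculus.

Section DefectOperator.
Variables (R : realType) (V W : hilbertType R) (Th : bop V W).
Hypothesis cTh : forall x, hnorm (Th x) <= hnorm x.

Lemma hnorm_defect x :
  hnorm (opsqrt (idop V - bcomp (adj Th) Th) x) ^+ 2 = hnorm x ^+ 2 - hnorm (Th x) ^+ 2.
Proof.
rewrite hnorm_opsqrt.
- by rewrite bcompE -rin_adj' rinn.
- move=> y; rewrite bcompE -[leRHS]mul1r; apply: le_trans (_ : 1 * hnorm (Th y) <= _).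
    by apply: adj_bound => // z; rewrite mul1r.
  by rewrite !mul1r.
- by rewrite adj_comp adjK.
Qed.

Lemma defect_inner (Dl : bop V V) :
  (forall x, hnorm (Dl x) ^+ 2 = hnorm x ^+ 2 - hnorm (Th x) ^+ 2) ->
  forall x y, rin (Dl x) (Dl y) = rin x y - rin (Th x) (Th y).
Proof.
move=> nDl x y; have := nDl (x + y); have := nDl x; have := nDl y.
rewrite !bopxD !hnormDsq !mulr2n; move: (hnorm (Dl x) ^+ 2) (hnorm (Dl y) ^+ 2) (hnorm (Th x) ^+ 2)
  (hnorm (Th y) ^+ 2) (hnorm x ^+ 2) (hnorm y ^+ 2) (rin (Dl x) _) (rin (Th x) _) (rin x y).
by move=> *; lra.
Qed.

End DefectOperator.

Section DefectModel.
Variables (R : realType) (n : nat) (X Y : hilbertType R).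
Local Notation C := R[i]%C.
Local Notation W := (word n).
Variables (Th : bop (ell2 W X) (ell2 W Y)) (Dl : bop (ell2 W X) (ell2 W X)).
Local Notation DT := (subsp (clran Dl)).
Hypotheses (nDl : forall x, hnorm (Dl x) ^+ 2 = hnorm x ^+ 2 - hnorm (Th x) ^+ 2)
  (ThS : forall i x, Th (lcreate X i x) = lcreate Y i (Th x)).

(** Since [Th] commutes with the left creation operators, these induce on the
    closure of the range of [Dl] isometries with orthogonal ranges. *)
Lemma defect_shift : exists S : 'I_n -> bop DT DT,
  (forall i x, S i (to_clran Dl x) = to_clran Dl (lcreate X i x)) /\
  forall i j z, adj (S i) (S j z) = if i == j then z else 0.
Proof.
have inn i j x y : rin (Dl (lcreate X i x)) (Dl (lcreate X j y)) =
    if i == j then rin (Dl x) (Dl y) else 0.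
  rewrite !(defect_inner nDl) !ThS.
  by rewrite [rin (lcreate X i x) _]rin_adj [rin (lcreate Y i _) _]rin_adj !adj_lcreateK; case: eqP => // _; rewrite !rin0r subr0.
have /choice[S hS] : forall i, exists S : bop DT DT,
    forall x, S (to_clran Dl x) = to_clran Dl (lcreate X i x).
  move=> i; have [|S hS _] := @douglas _ _ _ _ Dl (bcomp (corange Dl) (lcreate X i)) 1 ler01.
    move=> x; rewrite mul1r bcompE corangeE hnorm_to_clran; apply: hnorm_le_sqr.
    by rewrite -!rinn inn eqxx.
  by exists S => x; rewrite hS bcompE corangeE.
exists S; split => // i j z.
have e : bcomp (adj (S i)) (S j) = if i == j then idop _ else 0.
  apply: clran_ext => y; rewrite bcompE hS.
  apply/eqP; rewrite -subr_eq0; apply/eqP/to_clran_total => x.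
  rewrite rinBl -rin_adj' hS; apply/eqP; rewrite subr_eq0; apply/eqP.
  rewrite -[LHS]/(rin (Dl _) (Dl _)) rinC inn; case: eqP => // _.
    by rewrite rinC.
  by rewrite bop0E rin0l.
have := congr1 (fun Z : bop _ _ => Z z) e; rewrite bcompE => ->.
by case: eqP.
Qed.

(** Left multiplications dominate their functional calculus on the closure of the
    range of [Dl] by von Neumann's inequality, hence they descend to it. *)
Lemma defect_left_mult M c : left_mult M c ->
  exists D : bop DT DT, forall y, D (to_clran Dl y) = to_clran Dl (tens M (idop X) y).
Proof.
move=> hM; have [S [hS SS]] := defect_shift.
set k := opnorm M; have k0 : 0 <= k by exact: opnorm_ge0.
have bM x : hnorm (M x) <= k * hnorm x by exact: hnorm_opnorm.
have /choice[N hN] : forall r : R, exists N : bop (ell2 W X) (ell2 W X), 0 < r < 1 ->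
    norm_sum (coef c) (dilate r (fun j => lcreate X j)) N /\
    forall x, hnorm (N x) <= k * hnorm x.
  move=> r; have [r01|_] := boolP (0 < r < 1); last by exists 0.
  by have [N h b] := von_neumann (@lcreate_row R n X) hM k0 bM r01; exists N.
have cN := @lcreate_calculus _ _ X _ _ _ _ hM k0 (fun r h => (hN r h).1) (fun r h => (hN r h).2).
have [|D hD _] := @douglas _ _ _ _ Dl (bcomp (corange Dl) (tens M (idop X))) k k0.
  move=> y; rewrite bcompE -[hnorm (Dl y)]hnorm_to_clran -corangeE.
  have h : corange Dl (N r y) @[r --> 1^'-] --> corange Dl (tens M (idop X) y).
    by apply: bop_cvg; exact: cN.
  apply: (hnorm_limit_le h); apply: filterS (at_left1 (ltr01 : 0 < 1 :> R)) => r r01.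
  have [G hG bG] := von_neumann (isometries_row SS) hM k0 bM r01.
  rewrite (norm_sum_intertwine _ (hN r r01).1 hG) ?bG// => j x.
  by rewrite !corangeE hS.
by exists D => y; rewrite hD bcompE corangeE.
Qed.

End DefectModel.

Section CharacteristicDefect.
Variables (R : realType) (n : nat) (f : 'I_n -> pser R n) (H : hilbertType R)
  (T : 'I_n -> bop H H).
Local Notation C := R[i]%C.
Hypothesis hF : forall h, \sum_i hnorm (adj (feval f T i) h) ^+ 2 <= hnorm h ^+ 2.

Lemma hnorm_Delta_Theta x :
  hnorm (Delta_Theta f T x) ^+ 2 = hnorm x ^+ 2 - hnorm (Theta f T x) ^+ 2.
Proof. exact: (hnorm_defect (Theta_contraction hF)). Qed.

Lemma tens_lcreate_id (V : hilbertType R) i :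
  tens (lcreate C i) (idop V) = lcreate V i :> bop (ell2 (word n) V) _.
Proof. by rewrite tens_lcreate ampl_id; exact: bop_ext. Qed.

Lemma Theta_lcreate i x :
  Theta f T (lcreate (Dspace_star f T) i x) = lcreate (Dspace f T) i (Theta f T x).
Proof.
have h := @Theta_comm _ _ f _ T hF (lcreate C i) x (fun j c => lcreate_rcreate i j c).
rewrite (tens_lcreate_id (Dspace_star f T)) in h.
by rewrite (tens_lcreate_id (Dspace f T)) in h.
Qed.

End CharacteristicDefect.

(** * Pure tuples and isometric characteristic functions *)

Section Reducing.
Variables (R : realType) (n : nat) (X Y : hilbertType R).
Local Notation C := R[i]%C.
Local Notation W := (word n).
Variable Th : bop (ell2 W X) (ell2 W Y).
Hypotheses (cTh : forall x, hnorm (Th x) <= hnorm x)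
  (ThS : forall i x, Th (lcreate X i x) = lcreate Y i (Th x))
  (pTh : forall y, adj Th (Th (adj Th y)) = adj Th y)
  (vTh : forall d, Th (emb X [::] d) = 0 -> d = 0).

(* This is the equality case of [|z - Th^* Th z|^2 <= |z|^2 - |Th z|^2]. *)
Let norm_fixed z : hnorm (Th z) = hnorm z -> adj Th (Th z) = z.
Proof.
move=> e; apply/eqP; rewrite -subr_eq0; apply/eqP/hnorm_eq0/eqP.
rewrite -(@sqrf_eq0 R) eq_le sqr_ge0 andbT hnormBsq -rin_adj' rinn e.
have : hnorm (adj Th (Th z)) <= 1 * hnorm (Th z).
  by apply: adj_bound => // x; rewrite mul1r.
rewrite mul1r e; have := hnorm_ge0 (adj Th (Th z)); move: (hnorm (adj Th _)) (hnorm z) => a b a0 ab.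
rewrite mulr2n; move: a0 ab; nra.
Qed.

(* The range of [Th^*], on which [Th] is isometric, is invariant under the left
   creation operators; so its complement is invariant under their adjoints. *)
Let ker_adj i x : Th x = 0 -> Th (adj (lcreate X i) x) = 0.
Proof.
move=> x0; apply: rin_inj => y; rewrite rin0l rin_adj -rin_adj'.
set u := adj Th y; have Pu : adj Th (Th u) = u by exact: pTh.
have nu : hnorm (Th u) = hnorm u.
  by apply/eqP; rewrite -(@eqrXn2 _ 2)// ?hnorm_ge0// -!rinn rin_adj' Pu.
have : adj Th (Th (lcreate X i u)) = lcreate X i u.
  by apply: norm_fixed; rewrite ThS !hnorm_lcreate.
by move=> <-; rewrite -rin_adj x0 rin0l.
Qed.

(** The kernel of [Th] reduces the left creation operators, so it contains the
    constants [x w] obtained by shifting a vector [x] of the kernel back and removing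
    its components of positive degree; by [vTh] they vanish. *)
Lemma partial_isometry_iso x : hnorm (Th x) = hnorm x.
Proof.
have ker_vac z : Th z = 0 -> z [::] = 0.
  move=> z0; apply: vTh; have := z0; rewrite [in Th z](lcreate_sum z) bopxD bopx_sum.
  by rewrite big1 ?addr0// => i _; rewrite ThS ker_adj// bopx0.
have ker0 z : Th z = 0 -> z = 0.
  move=> z0; apply: ell2P_ext => w; rewrite ell20E; elim: w z z0 => [|i w IH] z z0.
    exact: ker_vac.
  by rewrite -adj_lcreate IH// ker_adj.
have tpt z : Th (adj Th (Th z)) = Th z.
  by apply: rin_inj => y; rewrite rin_adj -rin_adj' rin_adj pTh -rin_adj.
have fix_ z : adj Th (Th z) = z.
  by apply/eqP; rewrite -subr_eq0; apply/eqP/ker0; rewrite bopxB tpt subrr.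
by apply/eqP; rewrite -(@eqrXn2 _ 2)// ?hnorm_ge0// -!rinn rin_adj' fix_.
Qed.

End Reducing.

Section PureCharacteristic.
Variables (R : realType) (n : nat) (f : 'I_n -> pser R n) (H : hilbertType R)
  (T : 'I_n -> bop H H).
Local Notation C := R[i]%C.
Local Notation K := (poisson_kernel f T).
Hypothesis hF : forall h, \sum_i hnorm (adj (feval f T i) h) ^+ 2 <= hnorm h ^+ 2.
Hypothesis injK : forall h, K h = 0 -> h = 0.

(** By [Theta_vacuum] and the density of adjoint states, [K] kills the components of
    [Delta_star d]; so [Delta_star d = 0], although [d] is in the closure of the range
    of [Delta_star]. *)
Lemma Theta_vacuum_inj d : Theta f T (emb (Dspace_star f T) [::] d) = 0 -> d = 0.
Proof.
move=> d0; pose dd := Delta_star f T (incl (clran (Delta_star f T)) d).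
have dd0 : dd = 0.
  apply: ell2P_ext => i; rewrite ell20E; apply: injK; set k := K _.
  have kz z v : adjoint_state z v -> rin k z = 0.
    by move=> st; rewrite /k rin_adj -(Theta_vacuum hF d i st) d0 rin0l.
  apply/hnorm_eq0/eqP; rewrite eq_le hnorm_ge0 andbT; apply/ler_addgt0Pr => e e0; rewrite add0r.
  have [z [v [st zk]]] := adjoint_state_dense hF k e0.
  have [->|kn] := eqVneq (hnorm k) 0; first exact: ltW.
  have hk : 0 < hnorm k by rewrite lt_neqAle eq_sym kn hnorm_ge0.
  rewrite -(ler_pM2l hk) -expr2 -rinn -[leLHS]subr0 -(kz _ _ st) -rinBr.
  by apply: le_trans (rin_le _ _) _; rewrite ler_wpM2l// ltW.
apply: clran_orth => x; rewrite rin_adj' (Delta_star_adj hF).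
by have -> : Delta_star f T (subsp_val d) = 0 by []; rewrite rin0l.
Qed.

Lemma Theta_isometryP :
  (forall x, hnorm (Theta f T x) = hnorm x) <-> forall h, hnorm (K h) = hnorm h.
Proof.
split=> h; first exact: (char_isometry_kernel (Theta_poisson hF) injK h).
move=> x; apply: partial_isometry_iso.
- exact: (Theta_contraction hF).
- exact: (Theta_lcreate hF).
- exact: (kernel_isometry_char (Theta_poisson hF) h).
- exact: Theta_vacuum_inj.
Qed.

End PureCharacteristic.

(** * Assembling the model *)

Section Equivalence.
Variables (R : realType).
Implicit Types V W : hilbertType R.

Lemma isometricP V W (A : bop V W) : isometric A <-> forall x, hnorm (A x) = hnorm x.
Proof. by split=> h x; [rewrite /hnorm h|rewrite !hnormE h]. Qed.

Lemma conj_op_equivalent n V W (U : bop V W) (T : 'I_n -> bop V V) :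
  (forall x, adj U (U x) = x) -> (forall y, U (adj U y) = y) ->
  unitarily_equivalent T (fun i => conj_op U (T i)).
Proof.
move=> UU UU'; exists U; split; first exact: unitaryP.
by move=> i; apply: bop_ext => x; rewrite [RHS]bcompE conj_opE UU.
Qed.

End Equivalence.

Theorem theorem2p3 (R : realType) (n : nat) (f : 'I_n -> pser R n)
    (g : 'I_n -> H2f R n) (M : 'I_n -> bop (H2f R n) (H2f R n))
    (H : hilbertType R) (T : 'I_n -> bop H H) :
  (0 < n)%N -> class_Mb f g M -> in_Bf_cnc f g T ->
  exists D : 'I_n -> bop (DTheta_space f T) (DTheta_space f T),
    (forall i (y : ftens n (Dspace_star f T)),
       D i (to_DTheta y) = to_DTheta (tens (M i) (idop (Dspace_star f T)) y)) /\
  exists TT : 'I_n -> bop (model_space f T) (model_space f T),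
    [/\ forall i (v : model_space f T) (x : ftens n (Dspace f T))
               (y : ftens n (Dspace_star f T)),
          subsp_val v = (x, to_DTheta y) ->
          subsp_val (adj (TT i) v) =
            (tens (adj (M i)) (idop (Dspace f T)) x, adj (D i) (to_DTheta y)),
        in_Bf_cnc f g TT,
        unitarily_equivalent T TT,
        in_Bf_pure f g T <-> isometric (Theta f T)
      & isometric (Theta f T) ->
        exists TT0 : 'I_n -> bop (pure_model_space f T) (pure_model_space f T),
          [/\ forall i (x : pure_model_space f T),
                subsp_val (adj (TT0 i) x) =
                  tens (adj (M i)) (idop (Dspace f T)) (subsp_val x),
              in_Bf_cnc f g TT0,
              unitarily_equivalent T TT0
            & exists J : bop (pure_model_space f T) (model_space f T),
                [/\ unitary J,
                    forall x : pure_model_space f T, subsp_val (J x) = (subsp_val x, 0)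
                  & forall i, bcomp J (TT0 i) = bcomp (TT i) J]]].
Proof.
move=> _ [hMod _] hT; have [hB hc] := hT.
have hM i : left_mult (M i) (g i) := model_left_mult i hMod.
have hF := in_Bf_row hB.
have injK h : poisson_kernel f T h = 0 -> h = 0 := @poisson_kernel_inj _ _ f g _ T hB h hc.
have /choice[D hD] : forall i, exists D : bop (DTheta_space f T) (DTheta_space f T),
    forall y, D (to_clran (Delta_Theta f T) y) =
      to_clran (Delta_Theta f T) (tens (M i) (idop (Dspace_star f T)) y).
  move=> i; exact: (defect_left_mult (hnorm_Delta_Theta hF) (Theta_lcreate hF) (hM i)).
exists D; split; first exact: hD.
have [U [UU UU' model]] :=
  functional_model (hnorm_Delta_Theta hF) (Theta_poisson hF) injK.
pose TT i := conj_op U (T i).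
have adjTT i v : subsp_val (adj (TT i) v) =
    (tens (adj (M i)) (idop (Dspace f T)) (subsp_val v).1, adj (D i) (subsp_val v).2).
  rewrite -[idop (Dspace f T)]adj_id -tens_adj.
  apply: (model (T i) (tens (M i) (idop (Dspace f T))) (tens (M i) (idop (Dspace_star f T)))).
  - exact: (poisson_kernel_model hM hB).
  - by move=> x; apply: (Theta_comm hF); exact: (hM i).1.
  - exact: hD.
exists TT; split.
- by move=> i v x y e; rewrite adjTT e.
- exact: in_Bf_cnc_conj.
- exact: conj_op_equivalent.
- rewrite isometricP (Theta_isometryP hF injK) -(pure_poisson_kernel hB).
  by split=> [[]|].
move=> /isometricP iso.
have [J [JJ JJ' JE]] := isometric_model (hnorm_Delta_Theta hF) iso.
have J1 x : adj (adj J) (adj J x) = x by rewrite adjK JJ'.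
have J2 x : adj J (adj (adj J) x) = x by rewrite adjK JJ.
exists (fun i => conj_op (adj J) (TT i)); split.
- move=> i x; have -> : adj (conj_op (adj J) (TT i)) x = adj J (adj (TT i) (J x)).
    by rewrite /TT /conj_op !adj_comp !adjK !bcompE.
  have := JE (adj J (adj (TT i) (J x))); rewrite JJ' adjTT JE.
  by move=> /(congr1 fst) /= ->.
- apply: in_Bf_cnc_conj => //; exact: in_Bf_cnc_conj.
- have -> : (fun i => conj_op (adj J) (TT i)) = (fun i => conj_op (bcomp (adj J) U) (T i)).
    apply/funext => i; apply: bop_ext => x.
    by rewrite /TT /conj_op !adj_comp !adjK !bcompE.
  apply: conj_op_equivalent => x; rewrite adj_comp adjK !bcompE ?JJ' ?UU//.
  by rewrite UU' JJ.
exists J; split; [exact: unitaryP|exact: JE|].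
by move=> i; apply: bop_ext => x; rewrite [LHS]bcompE conj_opE adjK JJ'.
Qed.
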